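(* Let $p\in\mathbb N_+$ and let $(X^{(n)}_i)_{i\in T_n}$ be a sequence of mean-zero random fields as in the context, with $\alpha$-mixing coefficients $(\alpha_{\ell,n})_{\ell\ge1}$ (of order $p+1$). Suppose that $$\liminf_{n\to\infty}\frac{\sigma_n^2}{|T_n|}>0,\qquad \sup_{n,\,i\in T_n}\|X_i^{(n)}\|_{p+2}<\infty,$$ and that there is a fixed integer $R\ge1$ such that $\alpha_{\ell,n}=0$ for every $\ell>R$ and every $n$. Then $$\mathcal W_p(\mathcal L(W_n),N(0,1))=\mathcal O(|T_n|^{-1/2}).$$
   Context: Setting. Fix $d\in\mathbb N_+$. $T_1\subseteq T_2\subseteq\cdots$ are finite nonempty subsets of $\mathbb Z^d$ with $|T_n|\to\infty$. For each $n$, $(X^{(n)}_i)_{i\in T_n}$ is a family of real random variables with mean zero and finite second moments (no stationarity is assumed). Put $\sigma_n^2:=\operatorname{Var}(\sum_{i\in T_n}X^{(n)}_i)$ and $W_n:=\sigma_n^{-1}\sum_{i\in T_n}X^{(n)}_i$ (defined when $\sigma_n>0$). $\|X\|_r:=(\mathbb E|X|^r)^{1/r}$. Mixing coefficients. For sub-$\sigma$-algebras $\mathcal A,\mathcal B$, $\alpha(\mathcal A,\mathcal B):=\sup_{A\in\mathcal A,B\in\mathcal B}|\mathbb P(A\cap B)-\mathbb P(A)\mathbb P(B)|$. For positive integers $\ell,q$, $\alpha^{[q]}_{\ell,n}:=0\vee\sup\{\alpha(\sigma(X^{(n)}_i:i\in U_1),\sigma(X^{(n)}_i:i\in U_2)):U_1,U_2\subseteq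 T_n,\ |U_1|\le q,\ d(U_1,U_2)\ge\ell\}$, where $d(U_1,U_2)=\min\{\|i_1-i_2\|:i_1\in U_1,i_2\in U_2\}$ and $\|\cdot\|$ is the maximum norm. Throughout, $\alpha_{\ell,n}:=\alpha_{\ell,n}^{[p+1]}$. Wasserstein distance. $\mathcal W_p(\nu,\mu):=\inf_\gamma(\mathbb E_{(X,Y)\sim\gamma}|X-Y|^p)^{1/p}$, the infimum being over all couplings $\gamma$ of $\nu$ and $\mu$. $\mathcal L(W)$ is the law of $W$. $\mathcal O$-notation is as $n\to\infty$, with implied constants not depending on $n$. *)

(* Defs.v *)
From HB Require Import structures.
From mathcomp Require Import all_boot all_order all_algebra.
From mathcomp Require Import finmap.
From mathcomp Require Import all_classical all_reals all_analysis.
From mathcomp Require Import measurable_realfun.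

Set Implicit Arguments.
Unset Strict Implicit.
Unset Printing Implicit Defensive.

Import Order.TTheory GRing.Theory Num.Theory.
Import numFieldNormedType.Exports.

Local Open Scope classical_set_scope.
Local Open Scope ring_scope.

Section mixing.
Context {dd : measure_display} {Omega : measurableType dd} {R : realType}.
Variable P : probability Omega R.

Definition alpha_mixing (A B : set_system Omega) : \bar R :=
  ereal_sup [set `|P (E `&` F) - P E * P F|%E | E in A & F in B].

Variables (d : nat) (T : {fset 'rV[int]_d}) (X : T -> {RV P >-> R}).

Definition sigma_field (U : {set T}) : set_system Omega :=
  <<s \bigcup_(i in [set` U]) preimage_set_system setT (X i) measurable >>.

(* The norm on ['rV[int]_d] is the maximum norm; the distance to an empty set
   is [+oo], so that empty sets are allowed in [alpha_coef], where they only
   contribute the value 0. *)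
Definition set_dist (U1 U2 : {set T}) : \bar R :=
  \big[mine/+oo%E]_(i in U1) \big[mine/+oo%E]_(j in U2)
    (`|val i - val j|%:~R)%:E.

Definition alpha_coef (q l : nat) : \bar R :=
  maxe 0%E (ereal_sup [set a | exists U1 U2 : {set T},
    [/\ (#|U1| <= q)%N, (l%:R%:E <= set_dist U1 U2)%E &
        a = alpha_mixing (sigma_field U1) (sigma_field U2)]]).

Definition field_sum : {RV P >-> R} := \sum_(i : T) (X i : {mfun Omega >-> R}).

Definition field_sd : R := Num.sqrt (fine 'V_P[field_sum]).

(* Since [0^-1 = 0], this is the zero variable when [field_sd = 0]. *)
Definition normalized_sum : {RV P >-> R} :=
  scale_mfun field_sd^-1 field_sum.

End mixing.

Section wasserstein.
Context {R : realType}.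
Implicit Types nu mu : probability R R.

Definition coupling nu mu
    (g : probability (R * R)%type R) : Prop :=
  forall A : set R, measurable A ->
    g (A `*` setT) = nu A /\ g (setT `*` A) = mu A.

Definition wasserstein (p : nat) nu mu : \bar R :=
  ereal_inf [set ('N[g]_(p%:R%:E)[(fun xy => (xy.1 - xy.2)%:E)])%E
            | g in coupling nu mu].

(* [normal_prob] lives on [measurableTypeR R], whereas laws of real random
   variables live on [R] itself: the measurable sets are the same, but the two
   structures have different displays. *)
Definition std_normal : set R -> \bar R := normal_prob 0 1.

HB.instance Definition _ := isMeasure.Build _ R R std_normal
  (measure0 (normal_prob (0 : R) 1)) (measure_ge0 (normal_prob (0 : R) 1))
  (@measure_semi_sigma_additive _ _ _ (normal_prob (0 : R) 1)).

HB.instance Definition _ := Measure_isProbability.Build _ R R std_normal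
  (@probability_setT _ _ _ (normal_prob (0 : R) 1)).

End wasserstein.

(* Main.v *)
(** The random variables form a locally dependent field: a factor supported on
    at most p+1 sites is independent of everything outside a bounded
    neighbourhood.  With lam = 1/sigma_n = O(|T_n|^(-1/2)), Taylor
    expansion around the sum outside that neighbourhood expands E[W f(W)] in
    the E[f^(k)(W)] with error O(lam^q), for f with Lipschitz q-th derivative,
    q <= p.  Stein's equation turns this, by induction on q, into an Edgeworth
    expansion E h(W) = E[h(Z)(1 + Q(Z))] + O(lam^q) for Z standard normal, Q a
    combination of Hermite polynomials with coefficients O(lam), and h with
    Lipschitz (q-1)-st derivative.
    Clipping Q gives a probability density rho with respect to the normal law,
    bounded above and below.  Monotone maps a and b carry the normal law to the
    law of W and to rho times the normal law.  Comparing distribution functions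
    gives |b z - z| = O(lam (1 + |z| + |b z|)^m).  For |a - b|, take
    the (p-1)-st power of a smoothed distance to the complement of the open set
    of all intervals ]a z, b z[, minus the same for the intervals ]b z, a z[.
    The two sets are disjoint by monotonicity, so the primitive h satisfies
    |a z - b z|^p <= C (h (b z) - h (a z)) on a large interval, and its (p-1)-st
    derivative is Lipschitz.  Integrating over z and using the Edgeworth
    expansion of order p yields E|a - z|^p = O(lam^p). *)
Require Import Defs.
From HB Require Import structures.
From mathcomp Require Import all_boot all_order all_algebra.
From mathcomp Require Import finmap.
From mathcomp Require Import all_classical all_reals all_analysis.
From mathcomp Require Import measurable_realfun.
From mathcomp Require Import ring lra.

Set Implicit Arguments.
Unset Strict Implicit.
Unset Printing Implicit Defensive.

Import Order.TTheory GRing.Theory Num.Theory.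
Import numFieldNormedType.Exports.

Local Open Scope classical_set_scope.
Local Open Scope ring_scope.


(** * Derivatives and jets *)

Section calculus.
Variable R : realType.
Implicit Types (f df : R -> R) (g : nat -> R -> R) (x y : R).

(** In general [E h(W) - E h(Z)] is only [O(lam)], while for [p > 1] the target is an error
    [O(lam^p)] in the [p]-th power of the distance. A direct comparison with the normal law
    therefore cannot suffice; the intermediate density [rho] absorbs all corrections of lower order,
    so that a smooth test function separates [W] from it only at order [lam^p]. The test function is
    built from the law of [W], hence varies with [n]. For this reason each quantitative lemma
    produces its constant before the probability space, the field and the function are chosen, and
    the error of the expansions depends on the function only through the Lipschitz constant of its
    last derivative. This regularity also matches the moments: a function with Lipschitz [p]-th
    derivative grows at most like [|x|^(p+1)], so [W f(W)] uses [p + 2] moments, and the products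
    met on the way have at most [p + 1] factors, the order of the mixing coefficients. *)

Lemma is_derive_continuous f df : (forall x, is_derive x 1 f (df x)) ->
  continuous f.
Proof.
move=> fd x; apply/differentiable_continuous/derivable1_diffP.
exact: (@ex_derive _ _ _ _ _ _ _ (fd x)).
Qed.

Lemma is_derive_mvt f df a b : a <= b ->
  (forall x, is_derive x 1 f (df x)) ->
  exists c, a <= c <= b /\ f b - f a = df c * (b - a).
Proof.
move=> ab fd.
have fc : {within `[a, b], continuous f}.
  by apply: continuous_subspaceT; exact: is_derive_continuous fd.
have [c + h] := @MVT_segment R f df a b ab (fun x _ => fd x) fc.
by rewrite in_itv/= => cab; exists c.
Qed.

Lemma is_derive_mvt_norm f df (a b K : R) : (forall x, is_derive x 1 f (df x)) ->
  (forall x, Num.min a b <= x <= Num.max a b -> `|df x| <= K) ->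
  `|f b - f a| <= K * `|b - a|.
Proof.
move=> fd; wlog ab : a b / a <= b => [wl|].
  have /orP[/wl//|ba dfK] := le_total a b.
  rewrite distrC (distrC b); apply: (wl _ _ ba) => x xab.
  by apply: dfK; rewrite minC maxC.
move=> dfK; have [c [cab ->]] := is_derive_mvt ab fd.
by rewrite normrM ler_wpM2r// dfK// min_l// max_r.
Qed.

Lemma is_derive_bigsum n (h : 'I_n -> R -> R) (dh : 'I_n -> R) x :
  (forall i, is_derive x 1 (h i) (dh i)) ->
  is_derive x 1 (fun t => \sum_(i < n) h i t) (\sum_(i < n) dh i).
Proof.
move=> hd.
have -> : (fun t => \sum_(i < n) h i t) = \sum_(i < n) h i.
  by apply/funext => t; rewrite fct_sumE.
exact: is_derive_sum.
Qed.

Lemma is_derive_comp_shift f (df a x : R) :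
  is_derive (a + x) 1 f df -> is_derive x 1 (fun t => f (a + t)) df.
Proof.
move=> fd.
have sd : is_derive x 1 (fun t : R => a + t) 1.
  by apply: is_derive_eq (add0r _).
by have := @is_derive1_comp _ f (fun t : R => a + t) x df 1 fd sd; rewrite mulr1.
Qed.

Lemma is_derive_add (f1 f2 : R -> R) (d1 d2 x : R) :
  is_derive x 1 f1 d1 -> is_derive x 1 f2 d2 ->
  is_derive x 1 (fun t => f1 t + f2 t) (d1 + d2).
Proof. by move=> ? ?; exact: is_deriveD. Qed.

Lemma is_derive_sub (f1 f2 : R -> R) (d1 d2 x : R) :
  is_derive x 1 f1 d1 -> is_derive x 1 f2 d2 ->
  is_derive x 1 (fun t => f1 t - f2 t) (d1 - d2).
Proof. by move=> ? ?; exact: is_deriveB. Qed.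

Lemma is_derive_mul (f1 f2 : R -> R) (d1 d2 x : R) :
  is_derive x 1 f1 d1 -> is_derive x 1 f2 d2 ->
  is_derive x 1 (fun t => f1 t * f2 t) (d1 * f2 x + f1 x * d2).
Proof.
move=> ? ?; apply: is_derive_eq; rewrite /GRing.scale/=; ring.
Qed.

Lemma is_derive_scale (c : R) f (d x : R) :
  is_derive x 1 f d -> is_derive x 1 (fun t => c * f t) (c * d).
Proof. by move=> ?; exact: is_deriveZ. Qed.

Lemma is_derive_pow n (x : R) :
  is_derive x 1 (fun t : R => t ^+ n) (n%:R * x ^+ n.-1).
Proof.
case: n => [|n].
  by rewrite mul0r; under eq_fun do rewrite expr0; exact: is_derive_cst.
have -> : (fun t : R => t ^+ n.+1) = id ^+ n.+1.
  by apply/funext => t; rewrite exprfctE.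
by apply: is_derive_eq; rewrite /GRing.scale/= mulr1.
Qed.

(* [g] lists [g 0] together with its first [m] derivatives, the last of which
   is [L]-Lipschitz. *)
Definition jet (m : nat) (L : R) (g : nat -> R -> R) :=
  (forall k x, (k < m)%N -> is_derive x 1 (g k) (g k.+1 x)) /\
  (forall x y, `|g m x - g m y| <= L * `|x - y|).

Lemma jet_ge0 m L g : jet m L g -> 0 <= L.
Proof.
move=> [_ /(_ 1 0)]; rewrite subr0 normr1 mulr1; exact: le_trans.
Qed.

Lemma jet_shift m j L g : jet (j + m) L g -> jet m L (fun k => g (j + k)%N).
Proof.
move=> [g1 g2]; split => // k x km; rewrite addnS; apply: g1.
by rewrite ltn_add2l.
Qed.

Lemma lipschitz_continuous f L : (forall x y, `|f x - f y| <= L * `|x - y|) ->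
  continuous f.
Proof.
move=> fL x; apply/cvgrPdist_le => /= e e0.
have L0 : 0 <= L by have := fL 1 0; rewrite subr0 normr1 mulr1; exact: le_trans.
have L1 : 0 < L + 1 by rewrite ltr_wpDl.
near=> t; rewrite (le_trans (fL x t))//.
have : `|x - t| <= e / (L + 1).
  by near: t; apply: cvgr_dist_le => //; rewrite divr_gt0.
rewrite ler_pdivlMr// => h; rewrite (le_trans _ h)// mulrC ler_wpM2l//.
by rewrite lerDl.
Unshelve. all: by end_near. Qed.

Lemma jet_continuous m L g k : jet m L g -> (k <= m)%N -> continuous (g k).
Proof.
move=> [g1 g2]; rewrite leq_eqVlt => /predU1P[->|km].
  exact: lipschitz_continuous g2.
by apply: (@is_derive_continuous _ (g k.+1)) => x; exact: g1.
Qed.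

(** Induction on [m]: as a function of the increment, the error vanishes at 0 and its derivative is
    the error of one order less for the shifted jet. The mean value inequality loses the factorial,
    which only affects constants. *)
Lemma taylor m L g x y : jet m L g ->
  `|g 0%N (x + y) - \sum_(k < m.+1) g k x * (y ^+ k / k`!%:R)|
    <= L * `|y| ^+ m.+1.
Proof.
elim: m g y => [|m IH] g y gj.
  rewrite big_ord_recl big_ord0 fact0 expr0 divr1 mulr1 addr0 expr1.
  by rewrite (le_trans (gj.2 _ _))// addrAC subrr add0r.
pose D t := g 0%N (x + t) - \sum_(k < m.+2) g k x * (t ^+ k / k`!%:R).
pose dD t := g 1%N (x + t) - \sum_(k < m.+1) g k.+1 x * (t ^+ k / k`!%:R).
have Dd (t : R) : is_derive t 1 D (dD t).
  apply: is_deriveB.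
    by apply: is_derive_comp_shift; exact: gj.1.
  have -> : (fun t => \sum_(k < m.+2) g k x * (t ^+ k / k`!%:R)) =
            (fun t => g 0%N x + \sum_(k < m.+1) g k.+1 x * (t ^+ k.+1 / k.+1`!%:R)).
    apply/funext => s; rewrite big_ord_recl/= expr0 fact0 divr1 mulr1.
    by congr (_ + _); apply: eq_bigr => i _; rewrite /bump/= add1n.
  rewrite -[X in is_derive _ _ _ X]add0r; apply: is_deriveD.
  apply: is_derive_bigsum => i.
  have -> : (fun s => g i.+1 x * (s ^+ i.+1 / (i.+1)`!%:R)) =
            (fun s => (g i.+1 x / (i.+1)`!%:R) * s ^+ i.+1).
    by apply/funext => s; ring.
  apply: is_derive_eq (is_derive_scale _ (is_derive_pow _ _)) _ => /=.
  rewrite factS natrM invfM.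
  have : i.+1%:R != 0 :> R by rewrite pnatr_eq0.
  have : i`!%:R != 0 :> R by rewrite pnatr_eq0 -lt0n fact_gt0.
  by move=> ? ?; field; apply/andP.
have D0 : D 0 = 0.
  rewrite /D addr0 big_ord_recl/= expr0 fact0 divr1 mulr1 big1 ?addr0 ?subrr//.
  by move=> i _; rewrite /bump/= add1n expr0n/= mul0r mulr0.
have := @is_derive_mvt_norm D dD 0 y (L * `|y| ^+ m.+1) Dd.
rewrite D0 !subr0 -mulrA -exprSr; apply => t ty.
have gj1 : jet m L (fun k => g k.+1).
  by have := @jet_shift m 1 L g gj.
rewrite (le_trans (IH (fun k => g k.+1) t gj1))// ler_wpM2l ?(jet_ge0 gj)//.
rewrite lerXn2r ?nnegrE//.
move: ty; have [y0|y0] := leP 0 y; move=> /andP[t1 t2].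
  by rewrite !ger0_norm.
by rewrite !ler0_norm ?lerN2// ltW.
Qed.

End calculus.

(** * A priori bounds for Stein's equation *)

Section apriori.
Variable R : realType.
Implicit Types (f u : R -> R) (x y M : R).

(** Growth class for integration against the normal law: stable under sums and products, and
    containing all members of a jet. The exponent is existential; where moments are limited,
    [jet_growth] keeps track of it. *)
Definition polybd f := exists (C : R) (m : nat), 0 <= C /\ forall x, `|f x| <= C * (1 + `|x|) ^+ m.

Lemma is_derive_gt_right f (df x M : R) : is_derive x 1 f df -> M < df ->
  exists2 e, 0 < e & forall y, x < y < x + e -> M * (y - x) < f y - f x.
Proof.
move=> fd Mdf.
have /cvgrPdist_lt /(_ (df - M)) : h^-1 *: (f (h + x) - f x) @[h --> 0^'] --> df.
  have := @ex_derive _ _ _ _ _ _ _ fd.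
  rewrite /derivable => /cvgP; rewrite -[X in _ --> X]/('D_1 f x) derive_val.
  by under eq_fun do rewrite /= /GRing.scale/= mulr1.
rewrite subr_gt0 => /(_ Mdf).
rewrite near_withinE => -[e /= e0 He].
exists e => // y /andP[xy yxe].
have := He (y - x); rewrite /ball_/= sub0r normrN gtr0_norm ?subr_gt0//.
rewrite ltrBlDl => /(_ yxe); rewrite gt_eqF ?subr_gt0// => /(_ isT).
rewrite subrK /GRing.scale/= => h.
have {}h : M < (y - x)^-1 * (f y - f x).
  by have := ltr_normlW h; rewrite ltrD2l ltrN2 .
by rewrite mulrC -ltr_pdivlMl// subr_gt0.
Qed.

Let gauss x := expR (- (x ^+ 2 / 2)).

Lemma is_derive_reflect f (df x : R) :
  is_derive (- x) 1 f df -> is_derive x 1 (fun t => f (- t)) (- df).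
Proof.
move=> fd.
have nd : is_derive x 1 (fun t : R => - t) (- 1) by exact: is_deriveNid.
by have := @is_derive1_comp _ f (fun t : R => - t) x df _ fd nd; rewrite mulrN1.
Qed.

Lemma is_derive_gauss x : is_derive x 1 gauss (- x * gauss x).
Proof.
have d1 : is_derive x 1 (fun t : R => - (t ^+ 2 / 2)) (- x).
  have -> : (fun t : R => - (t ^+ 2 / 2)) = (fun t => - 2^-1 * t ^+ 2).
    by apply/funext => t; field.
  by apply: is_derive_eq (is_derive_scale _ (is_derive_pow 2 x)) _ => /=; field.
have := @is_derive1_comp _ expR _ x _ _ (is_derive_expR _) d1.
by rewrite mulrC.
Qed.

(** If [u x > A / x], then [u - A / x] times the Gaussian weight is nondecreasing to the right of
    [x], so [u - A / x] grows there at least like the reciprocal weight. This contradicts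
    boundedness; the value of [B] does not enter the conclusion. *)
Lemma first_order_ub u (r : R -> R) (A B x : R) :
  (forall x, is_derive x 1 u (x * u x + r x)) ->
  (forall x, `|r x| <= A) -> (forall x, `|u x| <= B) ->
  0 < x -> x * u x <= A.
Proof.
move=> ud rA uB x0; rewrite leNgt; apply/negP => Axu.
pose G t := (u t - A / x) * gauss t.
pose dG t := (r t + t * (A / x)) * gauss t.
have Gd (t : R) : is_derive t 1 G (dG t).
  apply: is_derive_eq (is_derive_mul (is_derive_sub (ud t) (is_derive_cst (A / x) t 1)) (is_derive_gauss t)) _.
  by rewrite /dG /=; ring.
have y0 : 0 < u x - A / x by rewrite subr_gt0 ltr_pdivrMr// mulrC.
have A0 : 0 <= A by exact: le_trans (rA 0).
have mono (s : R) : 0 <= s -> (u x - A / x) * (1 + x * s) <= u (x + s) - A / x.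
  move=> s0; have [|c [cab Gc]] := is_derive_mvt (a := x) (b := x + s) _ Gd.
    by rewrite lerDl.
  have : G x <= G (x + s).
    rewrite -subr_ge0 Gc addrAC subrr add0r mulr_ge0// /dG mulr_ge0 ?expR_ge0//.
    rewrite -lerBlDl sub0r (le_trans _ (_ : A <= _))//.
      by rewrite (le_trans (ler_norm _))// normrN.
    by rewrite mulrA ler_pdivlMr// mulrC ler_wpM2r//; case/andP: cab.
  rewrite /G -ler_pdivrMr ?expR_gt0// => h; apply: le_trans h.
  rewrite -mulrA ler_pM2l// -expRN -expRD.
  apply: le_trans (expR_ge1Dx _).
  by rewrite lerD2l; have := sqr_ge0 s; lra.
(* This increment turns the lower bound into [u x + B], which exceeds every value of [u - A / x]. *)
have s0 : 0 <= (B + A / x) / ((u x - A / x) * x).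
  have B0 : 0 <= B by exact: le_trans (uB 0).
  apply: divr_ge0; last by rewrite ltW// mulr_gt0.
  by apply: addr_ge0 => //; rewrite divr_ge0// ltW.
have := mono _ s0; apply/negP; rewrite -ltNge.
have -> : (u x - A / x) * (1 + x * ((B + A / x) / ((u x - A / x) * x))) =
   u x - A / x + (B + A / x).
  move: y0; set w := u x - A / x => y0.
  by field; rewrite !gt_eqF.
have := le_trans (ler_norm _) (uB (x + (B + A / x) / ((u x - A / x) * x))).
have : 0 <= A / x by rewrite divr_ge0// ltW.
lra.
Qed.

Lemma first_order_bound u (r : R -> R) (A B x : R) :
  (forall x, is_derive x 1 u (x * u x + r x)) ->
  (forall x, `|r x| <= A) -> (forall x, `|u x| <= B) -> `|x * u x| <= A.
Proof.
move=> ud rA uB.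
have Hp y : 0 < y -> `|y * u y| <= A.
  move=> y0; rewrite ler_norml; apply/andP; split.
    rewrite lerNl -mulrN.
    apply: (@first_order_ub (fun t => - u t) (fun t => - r t) A B) => // t.
    - by apply: is_derive_eq (is_deriveN (ud t)) _; ring.
    - by rewrite normrN.
    - by rewrite normrN.
  exact: first_order_ub ud rA uB y0.
have [x0|x0|<-] := ltgtP 0 x; first exact: Hp.
  have ud' (y : R) : is_derive y 1 (fun t => - u (- t)) (y * (- u (- y)) + r (- y)).
    by apply: is_derive_eq (is_deriveN (is_derive_reflect (ud (- y)))) _; ring.
  rewrite ler_norml; apply/andP; split.
    rewrite lerNl -mulrN.
    have ud2 (y : R) : is_derive y 1 (fun t => u (- t)) (y * u (- y) + - r (- y)).
      by apply: is_derive_eq (is_derive_reflect (ud (- y))) _; ring.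
    have := @first_order_ub (fun t => u (- t)) (fun t => - r (- t)) A B (- x) ud2.
    rewrite opprK mulNr mulrN; apply => //; rewrite ?oppr_gt0// => t.
    by rewrite normrN.
  have := @first_order_ub (fun t => - u (- t)) (fun t => r (- t)) A B (- x) ud'.
  rewrite opprK mulrNN; apply => //; rewrite ?oppr_gt0// => t.
  by rewrite normrN.
by rewrite mul0r normr0; exact: le_trans (rA 0).
Qed.
(** Constant term of the barrier [B x = x^(2m) + barrier m], chosen to make [B + x B' - B'']
    positive everywhere. *)
Let barrier (m : nat) : R := ((m.*2)%:R * (m.*2.-1)%:R) ^+ m + 1.

Lemma barrier_pos m x : (0 < m)%N ->
  (m.*2)%:R * (m.*2.-1)%:R * x ^+ m.*2.-2 < (1 + m.*2%:R) * x ^+ m.*2 + barrier m.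
Proof.
case: m => // m _; rewrite /barrier doubleS /=.
set K : R := m.*2.+2%:R * m.*2.+1%:R.
have K1 : 1 <= K by rewrite /K -natrM ler1n.
have E n : x ^+ n.*2 = (x ^+ 2) ^+ n by rewrite -muln2 mulnC exprM.
rewrite -doubleS !E; set z := x ^+ 2; rewrite (exprS z).
have z0 : 0 <= z by exact: sqr_ge0.
have zm : 0 <= z ^+ m by rewrite exprn_ge0.
have Km : 0 <= K ^+ m.+1 by rewrite exprn_ge0// (le_trans _ K1).
have n0 : 0 <= (m.+1).*2%:R * (z * z ^+ m) by rewrite mulr_ge0 ?ler0n// (mulr_ge0 z0 zm).
have [Kz|zK] := leP K z.
  have : K * z ^+ m <= z * z ^+ m by rewrite ler_wpM2r.
  by lra.
have : K * z ^+ m <= K ^+ m.+1.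
  by rewrite exprS ler_wpM2l ?(le_trans _ K1)// lerXn2r// ?nnegrE ?ltW// (le_lt_trans _ zK).
have : 0 <= z * z ^+ m by exact: mulr_ge0.
by lra.
Qed.

(* The q-th derivative of a solution of Stein's equation satisfies an equation
   of this form, with [k = q] and [S / k] the previous derivative.  Polynomial
   growth is the only information at infinity: it makes [u] lose against a
   barrier of higher even degree, so that an extremum exists. *)
Lemma max_principle_ub u (S r : R -> R) (M k x1 : R) : 0 <= k ->
  (forall x, is_derive x 1 u (x * u x + S x + r x)) ->
  (forall x, is_derive x 1 S (k * u x)) ->
  (forall x y, `|r x - r y| <= M * `|x - y|) -> polybd u -> u x1 <= M.
Proof.
move=> k0 ud Sd rL [C [m [C0 uC]]]; rewrite leNgt; apply/negP => Mu.
have M0 : 0 <= M by have := rL 1 0; rewrite subr0 normr1 mulr1; exact: le_trans.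
pose n := m.+1.
pose B x := x ^+ n.*2 + barrier n.
pose dB x := n.*2%:R * x ^+ n.*2.-1.
pose ddB x := n.*2%:R * (n.*2.-1)%:R * x ^+ n.*2.-2.
have B1 x : 1 <= B x.
  rewrite /B /barrier addrA lerDr.
  apply: addr_ge0; first by rewrite exprn_even_ge0// odd_double.
  by rewrite exprn_ge0// mulr_ge0.
have Bd x : is_derive x 1 B (dB x).
  apply: is_derive_eq (is_derive_add (is_derive_pow _ x) (is_derive_cst (barrier n) x 1)) _.
  by rewrite addr0.
have dBd x : is_derive x 1 dB (ddB x).
  by apply: is_derive_eq (is_derive_scale _ (is_derive_pow _ x)) _; rewrite /ddB mulrA.
(* Subtracting [d * B] costs half of the excess [u x1 - M] at [x1], so [v x1 > M] remains. *)
pose d := (u x1 - M) / (2 * B x1).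
have d0 : 0 < d by rewrite divr_gt0 ?subr_gt0// mulr_gt0// (lt_le_trans _ (B1 x1)).
pose v x := u x - d * B x.
pose dv x := x * u x + S x + r x - d * dB x.
have vd x : is_derive x 1 v (dv x).
  by apply: is_derive_sub (ud x) (is_derive_scale _ (Bd x)).
have vx1 : M < v x1.
  rewrite /v /d -subr_gt0.
  have -> : u x1 - (u x1 - M) / (2 * B x1) * B x1 - M = (u x1 - M) / 2.
    by field; rewrite gt_eqF// (lt_le_trans _ (B1 x1)).
  by rewrite divr_gt0// subr_gt0.
(* Beyond [T] the barrier, of degree [2m + 2], dominates the growth bound on [u]. *)
pose T := 1 + C * 2 ^+ m / d.
have T1 : 1 <= T by rewrite lerDl divr_ge0 ?(ltW d0)// mulr_ge0// exprn_ge0.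
have vT x : T <= `|x| -> v x <= 0.
  move=> Tx; rewrite /v subr_le0 (le_trans (ler_norm _))// (le_trans (uC x))//.
  have x1' : 1 <= `|x| by exact: le_trans Tx.
  apply: (@le_trans _ _ (C * (2 * `|x|) ^+ m)).
    by rewrite ler_wpM2l// lerXn2r ?nnegrE ?addr_ge0 ?mulr_ge0//; lra.
  apply: (@le_trans _ _ (d * `|x| ^+ m.+1)); last first.
    rewrite ler_wpM2l ?(ltW d0)// /B.
    apply: (@le_trans _ _ (x ^+ n.*2)).
      rewrite -[x ^+ n.*2]ger0_norm; last first.
        by rewrite exprn_even_ge0// odd_double.
      by rewrite normrX ler_weXn2l// -addnn leq_addr.
    by rewrite lerDl addr_ge0// exprn_ge0// mulr_ge0.
  rewrite exprMn exprS !mulrA ler_wpM2r ?exprn_ge0//.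
  rewrite mulrC -ler_pdivrMl//.
  by apply: le_trans Tx; rewrite /T; lra.
pose Z := T + `|x1| + 1.
have Z0 : 0 < Z by rewrite /Z; have := normr_ge0 x1; lra.
have vc : {within `[- Z, Z], continuous v}.
  by apply: continuous_subspaceT; exact: is_derive_continuous vd.
have [|x0 x0Z vmax] := @EVT_max R v (- Z) Z _ vc; first lra.
have x1Z : x1 \in `[- Z, Z]%R.
  by rewrite in_itv/= -ler_norml /Z; lra.
have vx0 : M < v x0 by exact: lt_le_trans (vmax _ x1Z).
have x0T : `|x0| < T.
  by rewrite ltNge; apply/negP => /vT; lra.
have dv0 : dv x0 = 0.
  have ZZ : - Z <= Z by lra.
  have H1 : forall t, t \in `]- Z, Z[%R -> derivable v t 1.
    by move=> t _; exact: (@ex_derive _ _ _ _ _ _ _ (vd t)).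
  have H2 : x0 \in `]- Z, Z[%R.
    by rewrite in_itv/= -ltr_norml /Z (lt_le_trans x0T)// -addrA lerDl addr_ge0.
  have H3 : forall t, t \in `]- Z, Z[%R -> v t <= v x0.
    by move=> t /subset_itv_oo_cc; exact: vmax.
  have h := derive1_at_max ZZ H1 H2 H3.
  by have := @derive_val _ _ _ _ _ _ _ h; rewrite (@derive_val _ _ _ _ _ _ _ (vd x0)).
(* Since [r] is only Lipschitz, [v] need not have a second derivative. Without [r], the formula for
   [v'] has slope [e > M] at [x0]; adding [r], which decreases at rate at most [M], leaves [v']
   positive just after the maximum. *)
pose D x := x * u x + S x - d * dB x.
pose e := u x0 + x0 * (d * dB x0) + k * u x0 - d * ddB x0.
have Dd : is_derive x0 1 D e.
  have h := is_derive_sub (is_derive_add (is_derive_mul (is_derive_id x0 1) (ud x0)) (Sd x0)) (is_derive_scale d (dBd x0)).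
  apply: is_derive_eq h _; rewrite /e.
  have -> : d * dB x0 = x0 * u x0 + S x0 + r x0 by move: dv0; rewrite /dv; lra.
  by rewrite mul1r.
have Me : M < e.
  have h := @barrier_pos n x0 isT.
  have E : x0 * dB x0 = n.*2%:R * x0 ^+ n.*2.
    by rewrite /dB /n doubleS /= [in RHS]exprS; ring.
  rewrite /e.
  have : 0 < d * (B x0 + x0 * dB x0 - ddB x0).
    by rewrite mulr_gt0// E /B /ddB; lra.
  have : 0 <= k * v x0 by rewrite mulr_ge0//; lra.
  have : 0 <= k * (d * B x0) by rewrite mulr_ge0// mulr_ge0 ?(ltW d0)// (le_trans _ (B1 x0)).
  by rewrite /v in vx0 *; lra.
have [eta eta0 He] := is_derive_gt_right Dd Me.
have etax : x0 < x0 + eta / 2 by rewrite ltrDl divr_gt0.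
have vc2 : {within `[x0, x0 + eta / 2], continuous v}.
  by apply: continuous_subspaceT; exact: is_derive_continuous vd.
have [c] := @MVT R v dv _ _ etax (fun x _ => vd x) vc2.
rewrite in_itv/= => /andP[x0c ce] vE.
(* [v] is nonpositive beyond [T], so [x0] is a global maximum and not only one on the interval. *)
have vy : v (x0 + eta / 2) <= v x0.
  have [yT|yT] := leP T `|x0 + eta / 2|; first by have := vT _ yT; lra.
  by apply: vmax; rewrite in_itv/= -ler_norml /Z; have := normr_ge0 x1; lra.
have dvc : 0 < dv c.
  have := He c; rewrite x0c/= => /(_ _)/wrap[]; first by lra.
  have := rL c x0; rewrite (gtr0_norm (_ : 0 < c - x0)) ?subr_gt0//.
  rewrite ler_norml => /andP[+ _].
  by move: dv0; rewrite /D /dv; lra.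
have : 0 < dv c * (x0 + eta / 2 - x0) by rewrite mulr_gt0// subr_gt0.
by rewrite -vE; lra.
Qed.

Lemma max_principle u (S r : R -> R) (M k : R) : 0 <= k ->
  (forall x, is_derive x 1 u (x * u x + S x + r x)) ->
  (forall x, is_derive x 1 S (k * u x)) ->
  (forall x y, `|r x - r y| <= M * `|x - y|) -> polybd u ->
  forall x, `|u x| <= M.
Proof.
move=> k0 ud Sd rL up x; rewrite ler_norml; apply/andP; split; last first.
  exact: max_principle_ub ud Sd rL up.
rewrite lerNl.
apply: (@max_principle_ub (fun t => - u t) (fun t => - S t) (fun t => - r t) M k x) => //.
- by move=> t; apply: is_derive_eq (is_deriveN (ud t)) _; ring.
- by move=> t; apply: is_derive_eq (is_deriveN (Sd t)) _; ring.
- by move=> s t; rewrite -opprD normrN.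
- case: up => C [m [C0 uC]]; exists C, m; split => // t.
  by rewrite normrN.
Qed.

(** The equation cannot be differentiated once more when [r] is merely Lipschitz, so a finite
    difference replaces the derivative: [g t = u (e + t) - u t] solves a first-order equation with
    source [O(|e|)], and [first_order_bound] controls [t * g t] by that source. The bound [2 * M] on
    [g] only serves to exclude exponential growth. *)
Lemma stein_derivative_lipschitz u (S r : R -> R) (M k : R) : 0 <= k ->
  (forall x, is_derive x 1 u (x * u x + S x + r x)) ->
  (forall x, is_derive x 1 S (k * u x)) ->
  (forall x y, `|r x - r y| <= M * `|x - y|) -> polybd u ->
  let du x := x * u x + S x + r x in
  forall x y, `|du x - du y| <= (2 * (k + 2) * M) * `|x - y|.
Proof.
move=> k0 ud Sd rL up du x y.
have uM := max_principle k0 ud Sd rL up.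
have M0 : 0 <= M by exact: le_trans (uM 0).
have SL s t : `|S s - S t| <= (k * M) * `|s - t|.
  apply: (is_derive_mvt_norm Sd) => z _.
  by rewrite normrM (ger0_norm k0) ler_wpM2l.
pose e := x - y.
pose g t := u (e + t) - u t.
pose rho t := e * u (e + t) + (S (e + t) - S t) + (r (e + t) - r t).
have gd (t : R) : is_derive t 1 g (t * g t + rho t).
  apply: is_derive_eq (is_derive_sub (is_derive_comp_shift (ud (e + t))) (ud t)) _.
  by rewrite /g /rho; ring.
have rhoA t : `|rho t| <= (k + 2) * M * `|e|.
  have h1 : `|e * u (e + t)| <= M * `|e| by rewrite normrM mulrC ler_wpM2r.
  have h2 := SL (e + t) t; have h3 := rL (e + t) t.
  have E : e + t - t = e by rewrite addrK.
  rewrite E in h2 h3.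
  apply: le_trans (ler_normD _ _) _; apply: le_trans (lerD (ler_normD _ _) (lexx _)) _.
  by lra.
have gB t : `|g t| <= 2 * M.
  by apply: le_trans (ler_normB _ _) _; have := uM (e + t); have := uM t; lra.
have xg := first_order_bound y gd rhoA gB.
have -> : du x - du y = y * g y + rho y.
  have ey : e + y = x by rewrite /e subrK.
  by rewrite /du /g /rho ey /e; ring.
apply: le_trans (ler_normD _ _) _.
by have := rhoA y; rewrite -/e; lra.
Qed.

Lemma polybd_add f g : polybd f -> polybd g -> polybd (fun x => f x + g x).
Proof.
move=> [C [m [C0 fC]]] [D [n [D0 gD]]]; exists (C + D), (m + n)%N.
split=> [|x]; first exact: addr_ge0.
have h : 1 <= 1 + `|x| by rewrite lerDl.
rewrite (le_trans (ler_normD _ _))// mulrDl lerD//.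
  by rewrite (le_trans (fC x))// ler_wpM2l// ler_weXn2l// leq_addr.
by rewrite (le_trans (gD x))// ler_wpM2l// ler_weXn2l// leq_addl.
Qed.

Lemma polybd_mul f g : polybd f -> polybd g -> polybd (fun x => f x * g x).
Proof.
move=> [C [m [C0 fC]]] [D [n [D0 gD]]]; exists (C * D), (m + n)%N.
split=> [|x]; first exact: mulr_ge0.
by rewrite exprD mulrACA normrM ler_pM.
Qed.

Lemma polybd_bound f C : (forall x, `|f x| <= C) -> polybd f.
Proof.
move=> fC; exists C, 0; split; first exact: le_trans (fC 0).
by move=> x; rewrite expr0 mulr1.
Qed.

Lemma polybd_cst (c : R) : polybd (fun=> c).
Proof. exact: (@polybd_bound _ `|c|). Qed.

Lemma polybd_id : polybd (fun x => x).
Proof. by exists 1, 1; split => // x; rewrite mul1r expr1 lerDr. Qed.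

Lemma polybd_scale c f : polybd f -> polybd (fun x => c * f x).
Proof. exact/polybd_mul/polybd_cst. Qed.

Lemma polybd_opp f : polybd f -> polybd (fun x => - f x).
Proof.
move=> [C [m [C0 fC]]]; exists C, m; split=> // x.
by rewrite normrN.
Qed.

Lemma polybd_sum (I : Type) (s : seq I) (F : I -> R -> R) :
  (forall i, polybd (F i)) -> polybd (fun x => \sum_(i <- s) F i x).
Proof.
move=> Fp; elim: s => [|i s IH].
  by under eq_fun do rewrite big_nil; exact: polybd_cst.
by under eq_fun do rewrite big_cons; exact: polybd_add.
Qed.

Lemma polybd_pow n : polybd (fun x => x ^+ n).
Proof.
exists 1, n; split=> // x.
by rewrite mul1r normrX lerXn2r// ?nnegrE// ?addr_ge0// lerDr.
Qed.

Lemma polybd_le f g : (forall x, `|f x| <= `|g x|) -> polybd g -> polybd f.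
Proof.
by move=> fg [C [m [C0 gC]]]; exists C, m; split=> // x; exact: le_trans (fg x) (gC x).
Qed.

Lemma polybd_norm f : polybd f -> polybd (fun x => `|f x|).
Proof. by apply: polybd_le => x; rewrite normr_id. Qed.

Lemma jet_polybd m L (g : nat -> R -> R) k : jet m L g -> (k <= m)%N ->
  polybd (g k).
Proof.
move=> gj km.
have {}gj : jet (m - k) L (fun j => g (k + j)%N).
  by apply: jet_shift; rewrite subnKC.
have h x : `|g k x| <= `|(\sum_(j < (m - k).+1) g (k + j)%N 0 * (x ^+ j / j`!%:R)) |
                       + L * `|x ^+ (m - k).+1|.
  have := taylor 0 x gj; rewrite add0r addn0 -normrX.
  set s := \sum_(_ < _) _ => h.
  by rewrite -[g k x](subrK s) addrC (le_trans (ler_normD _ _))// lerD2l.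
have h2 : polybd (fun x => `|(\sum_(j < (m - k).+1) g (k + j)%N 0 * (x ^+ j / j`!%:R)) |
                       + L * `|x ^+ (m - k).+1|).
  apply: polybd_add.
    apply: polybd_norm; apply: polybd_sum => j; apply: polybd_scale.
    by apply: polybd_mul; [exact: polybd_pow|exact: polybd_cst].
  by apply: polybd_scale; apply: polybd_norm; exact: polybd_pow.
apply: polybd_le h2 => x; rewrite (le_trans (h x))// ler_norm//.
Qed.

End apriori.

(** * Expectations and the normal density *)

Section density.
Variable R : realType.
Local Open Scope ereal_scope.
Import HBNNSimple.

(** Both sides agree on simple approximations of [f], and monotone convergence gives the rest. It
    serves for the normal law and for the law with density [rho]. *)
Lemma ge0_integral_density (nu : {measure set R -> \bar R}) (w : R -> R) :
  measurable_fun setT w -> (forall x, 0 <= w x)%R ->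
  (forall A, measurable A -> nu A = \int[lebesgue_measure]_(x in A) (w x)%:E) ->
  forall f : R -> \bar R, measurable_fun setT f -> (forall x, 0 <= f x) ->
  \int[nu]_x f x = \int[lebesgue_measure]_x (f x * (w x)%:E).
Proof.
move=> mw w0 nuE f mf f0.
pose f_ := nnsfun_approx measurableT mf.
have fcvg x : (EFin \o f_^~ x) n @[n --> \oo] --> f x.
  by apply: cvg_nnsfun_approx => //.
have fnd (x : R) m n : (m <= n)%N -> (f_ m x <= f_ n x)%R.
  by move=> mn; exact/lefP/nd_nnsfun_approx.
have mf' n : measurable_fun [set: measurableTypeR R] (f_ n : measurableTypeR R -> R).
  exact: (@measurable_funPT _ _ _ _ (f_ n)).
transitivity (limn (fun n => \int[nu]_x (f_ n x)%:E)).
  rewrite -monotone_convergence//.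
  - by apply: eq_integral => y _; apply/esym/cvg_lim => //; exact: fcvg.
  - by move=> n; exact/measurable_EFinP.
  - by move=> n y _; rewrite lee_fin.
  - by move=> y _ m n mn; rewrite lee_fin; exact/lefP/nd_nnsfun_approx.
rewrite [X in limn X](_ : _ =
    (fun n => \int[lebesgue_measure]_x ((f_ n x)%:E * (w x)%:E))).
  rewrite -monotone_convergence//.
  - apply: eq_integral => x _ /=; apply/cvg_lim => //.
    apply: cvgeZr => //. exact: fcvg.
  - move=> n; apply: emeasurable_funM; exact/measurable_EFinP.
  - by move=> n y _; rewrite -EFinM lee_fin mulr_ge0.
  - move=> y _ m n mn; rewrite -!EFinM lee_fin ler_wpM2r//.
    exact: fnd.
apply/funext => n.
rewrite integralT_nnsfun sintegralE.
transitivity (\sum_(r \in range (f_ n)) \int[lebesgue_measure]_x (r * \1_(f_ n @^-1` [set r]) x * w x)%:E).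
  apply: eq_fsbigr => r; rewrite inE => -[t _ <-].
  rewrite nuE//.
  under [RHS]eq_integral do rewrite -mulrA EFinM.
  rewrite ge0_integralZl//=; last first.
  - by rewrite lee_fin.
  - by move=> x _; rewrite lee_fin mulr_ge0.
  - apply/measurable_EFinP; apply: measurable_funM => //.
    by apply: measurable_indic; exact: (measurable_sfunP (f_ n)).
  rewrite integral_mkcond; congr (_ * _); apply: eq_integral => x _.
  rewrite patchE indicE; case: ifP => _; first by rewrite mul1r.
  by rewrite mul0r.
rewrite -ge0_integral_fsum//.
- apply: eq_integral => x _; rewrite [in RHS]fimfunE -fsumEFin//.
  rewrite ge0_mule_fsuml//.
  + by move=> r; rewrite nnfun_muleindic_ge0.
- move=> r; apply/measurable_EFinP; apply: measurable_funM => //.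
  by apply: measurable_funM => //; apply: measurable_indic; exact: (measurable_sfunP (f_ n)).
- move=> r x _; rewrite lee_fin; apply: mulr_ge0 => //.
  by have := nnfun_muleindic_ge0 (f_ n) r x; rewrite -EFinM lee_fin.
Qed.

End density.

Section expectation.
Context {d : measure_display} {T : measurableType d} {R : realType}.
Variable P : probability T R.
Implicit Types f g : T -> R.

Definition integ f := P.-integrable setT (EFin \o f).
Definition Ex f : R := \int[P]_x f x.

Lemma integ_measurable f : integ f -> measurable_fun setT f.
Proof. by move=> /measurable_int /measurable_EFinP. Qed.

Lemma integ_le f g : measurable_fun setT f -> (forall x, `|f x| <= g x) ->
  integ g -> integ f.
Proof.
move=> mf fg ig; apply: le_integrable ig => //; first exact/measurable_EFinP.
move=> x _ /=; rewrite lee_fin (le_trans (fg x))// ler_norm//.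
Qed.

Lemma integ_cst (c : R) : integ (fun=> c).
Proof. exact: finite_measure_integrable_cst. Qed.

Lemma integD f g : integ f -> integ g -> integ (fun x => f x + g x).
Proof. by move=> fi gi; apply: eq_integrable (integrableD _ fi gi). Qed.

Lemma integB f g : integ f -> integ g -> integ (fun x => f x - g x).
Proof. by move=> fi gi; apply: eq_integrable (integrableB _ fi gi). Qed.

Lemma integZ c f : integ f -> integ (fun x => c * f x).
Proof. by move=> fi; apply: eq_integrable (integrableZl _ c fi). Qed.

Lemma integ_norm f : integ f -> integ (fun x => `|f x|).
Proof. by move=> fi; apply: integrable_norm. Qed.

Lemma integ_sum (I : Type) (s : seq I) (F : I -> T -> R) :
  (forall i, integ (F i)) -> integ (fun x => \sum_(i <- s) F i x).
Proof.
move=> Fi; elim: s => [|i s IH].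
  by under eq_fun do rewrite big_nil; exact: integ_cst.
by under eq_fun do rewrite big_cons; exact: integD.
Qed.

Lemma ExD f g : integ f -> integ g -> Ex (fun x => f x + g x) = Ex f + Ex g.
Proof. by move=> *; exact: RintegralD. Qed.

Lemma ExB f g : integ f -> integ g -> Ex (fun x => f x - g x) = Ex f - Ex g.
Proof. by move=> *; exact: RintegralB. Qed.

Lemma ExZ c f : integ f -> Ex (fun x => c * f x) = c * Ex f.
Proof. by move=> *; exact: RintegralZl. Qed.

Lemma Ex_cst c : Ex (fun=> c) = c.
Proof.
rewrite /Ex Rintegral_cst//.
rewrite -[RHS]mulr1; congr (_ * _).
exact: (congr1 fine (@probability_setT _ _ _ P)).
Qed.

Lemma Ex_sum (I : Type) (s : seq I) (F : I -> T -> R) :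
  (forall i, integ (F i)) -> Ex (fun x => \sum_(i <- s) F i x) = \sum_(i <- s) Ex (F i).
Proof.
move=> Fi; elim: s => [|i s IH].
  by rewrite big_nil; under [X in Ex X]eq_fun do rewrite big_nil; rewrite Ex_cst.
rewrite big_cons -IH -ExD//; last exact: integ_sum.
by congr Ex; apply/funext => x; rewrite big_cons.
Qed.

Lemma Ex_le f g : integ f -> integ g -> (forall x, f x <= g x) -> Ex f <= Ex g.
Proof. by move=> fi gi fg; apply: le_Rintegral. Qed.

Lemma Ex_ge0 f : (forall x, 0 <= f x) -> 0 <= Ex f.
Proof. by move=> f0; apply: Rintegral_ge0. Qed.

Lemma Ex_norm_le f g : measurable_fun setT f -> integ g ->
  (forall x, `|f x| <= g x) -> `|Ex f| <= Ex g.
Proof.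
move=> mf ig fg.
have fi : integ f by exact: integ_le ig.
apply: le_trans (le_normr_Rintegral _ fi) _ => //.
by apply: Ex_le => //; exact: integ_norm.
Qed.

End expectation.

Section gaussian.
Variable R : realType.
Local Notation gam := (@std_normal R).
Local Notation lam := (@lebesgue_measure R).
Implicit Types x : R.

Definition npdf (x : R) : R := normal_pdf 0 1 x.

Lemma npdfE x : npdf x = npdf 0 * expR (- (x ^+ 2 / 2)).
Proof.
rewrite /npdf normal_pdfE ?oner_eq0//= /normal_fun !subr0.
rewrite expr0n /= oppr0 mul0r expR0 mulr1; congr (_ * expR _).
by field.
Qed.

Lemma npdf_gt0 x : 0 < npdf x.
Proof.
rewrite /npdf normal_pdfE ?oner_eq0// mulr_gt0// ?expR_gt0//.
exact/normal_peak_gt0/oner_neq0.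
Qed.

Lemma npdf_ge0 x : 0 <= npdf x. Proof. exact/ltW/npdf_gt0. Qed.

Lemma is_derive_npdf x : is_derive x 1 npdf (- x * npdf x).
Proof.
have -> : npdf = (fun x => npdf 0 * expR (- (x ^+ 2 / 2))).
  by apply/funext => y; exact: npdfE.
apply: is_derive_eq (is_derive_scale _ (is_derive_gauss x)) _.
by rewrite mulrCA.
Qed.

Lemma is_derive_npdfV x : is_derive x 1 (fun t => (npdf t)^-1) (x * (npdf x)^-1).
Proof.
have -> : (fun t => (npdf t)^-1) = (fun t => (npdf 0)^-1 * expR (t ^+ 2 / 2)).
  by apply/funext => t; rewrite npdfE invfM -expRN opprK.
have d1 : is_derive x 1 (fun t : R => t ^+ 2 / 2) x.
  have -> : (fun t : R => t ^+ 2 / 2) = (fun t => 2^-1 * t ^+ 2).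
    by apply/funext => t; field.
  by apply: is_derive_eq (is_derive_scale _ (is_derive_pow 2 x)) _ => /=; field.
apply: is_derive_eq (is_derive_scale _ (@is_derive1_comp _ expR _ x _ _ (is_derive_expR _) d1)) _.
by rewrite (npdfE x) invfM -expRN opprK /GRing.scale/=; ring.
Qed.

Lemma continuous_npdf : continuous npdf.
Proof. exact/continuous_normal_pdf/oner_neq0. Qed.

Lemma npdf_even x : npdf (- x) = npdf x.
Proof. by rewrite npdfE [RHS]npdfE sqrrN. Qed.

Lemma npdf_decr x y : `|x| <= `|y| -> npdf y <= npdf x.
Proof.
move=> xy; rewrite npdfE [leRHS]npdfE ler_pM2l ?npdf_gt0// ler_expR lerN2.
rewrite ler_pM2r//.
by rewrite -real_normK ?num_real// -[leRHS]real_normK ?num_real// lerXn2r ?nnegrE.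
Qed.

Lemma pow_le_expR m (t : R) : 0 <= t -> t ^+ m <= m`!%:R * expR t.
Proof.
case: m => [t0|m t0]; first by rewrite expr0 fact0 mul1r -expR0 ler_expR.
rewrite -ler_pdivrMl ?ltr0n ?fact_gt0// mulrC.
by apply: le_trans (expR_ge1Dxn m t0); rewrite lerDr.
Qed.

(** A polynomial factor is paid for by widening the normal density to standard deviation 2. The
    polynomial is first bounded by [m! e^(1 + |x|)]. *)
Lemma polybd_npdf m : exists C : R, 0 < C /\
  forall x, (1 + `|x|) ^+ m * npdf x <= C * normal_pdf 0 2 x.
Proof.
pose c := npdf 0 / @normal_peak R 2.
have c0 : 0 < c.
  by rewrite divr_gt0 ?npdf_gt0 ?normal_peak_gt0// pnatr_eq0.
exists (m`!%:R * expR 2 * c); split.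
  by rewrite mulr_gt0// mulr_gt0 ?expR_gt0 ?ltr0n ?fact_gt0.
move=> x.
have n2 : (2 : R) != 0 by rewrite pnatr_eq0.
rewrite normal_pdfE//= npdfE.
have -> : m`!%:R * expR 2 * c * (normal_peak 2 * normal_fun 0 2 x) =
  m`!%:R * (expR 2 * normal_fun 0 2 x) * npdf 0.
  by rewrite /c; field; rewrite gt_eqF// normal_peak_gt0.
rewrite (mulrC (npdf 0)) [leLHS]mulrA ler_pM2r ?npdf_gt0// /normal_fun subr0 -expRD.
have /(pow_le_expR m) h : 0 <= 1 + `|x| by rewrite addr_ge0.
apply: le_trans (ler_wpM2r (expR_ge0 _) h) _.
rewrite -mulrA -expRD ler_pM2l ?ltr0n ?fact_gt0// ler_expR.
rewrite -[x ^+ 2]real_normK ?num_real//; set y := `|x|.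
(* Completing the square in [1 + y - y^2/2 <= 2 - y^2/8]; this is where the factor [expR 2] comes
   from. *)
have : 0 <= (y - 4/3) ^+ 2 by exact: sqr_ge0.
by lra.
Qed.

Lemma npdf_ub m : exists C : R, 0 < C /\
  forall x, (1 + `|x|) ^+ m * npdf x <= C.
Proof.
have [C [C0 HC]] := polybd_npdf m.
have n2 : (2 : R) != 0 by rewrite pnatr_eq0.
exists (C * normal_peak 2); split; first by rewrite mulr_gt0// normal_peak_gt0.
by move=> x; rewrite (le_trans (HC x))// ler_pM2l// normal_pdf_ub.
Qed.

Lemma measurable_npdf : measurable_fun setT npdf.
Proof. exact: measurable_normal_pdf. Qed.

Lemma ge0_integral_gauss (f : R -> \bar R) : measurable_fun setT f ->
  (forall x, 0 <= f x)%E ->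
  (\int[gam]_x f x = \int[lam]_x (f x * (npdf x)%:E))%E.
Proof.
move=> mf f0; apply: ge0_integral_density => //.
  exact: measurable_npdf.
by move=> x; exact: npdf_ge0.
Qed.

Lemma gauss_integ_pow m : integ gam (fun x => (1 + `|x|) ^+ m).
Proof.
have mp : measurable_fun setT (fun x : R => (1 + `|x|) ^+ m).
  by apply: measurable_funX; apply: measurable_funD => //; exact: measurableT_comp.
have p0 (x : R) : 0 <= (1 + `|x|) ^+ m by rewrite exprn_ge0// addr_ge0.
apply/integrableP; split; first exact/measurable_EFinP.
have [C [C0 HC]] := polybd_npdf m.
rewrite (eq_integral (fun x => ((1 + `|x|) ^+ m)%:E)); last first.
  by move=> x _ /=; rewrite ger0_norm.
rewrite ge0_integral_gauss//; last exact/measurable_EFinP.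
apply: (@le_lt_trans _ _ (\int[lam]_x (C%:E * (normal_pdf 0 2 x)%:E))%E).
  apply: ge0_le_integral => //.
  - by move=> x _; rewrite -EFinM lee_fin mulr_ge0// npdf_ge0.
  - apply: emeasurable_funM; apply/measurable_EFinP => //; exact: measurable_npdf.
  - apply: emeasurable_funM => //; apply/measurable_EFinP; exact: measurable_normal_pdf.
  - by move=> x _; rewrite -!EFinM lee_fin.
rewrite ge0_integralZl//=; last 3 first.
- by apply/measurable_EFinP; exact: measurable_normal_pdf.
- by move=> x _; rewrite lee_fin normal_pdf_ge0.
- by rewrite lee_fin ltW.
by rewrite integral_normal_pdf mule1 ltry.
Qed.

Lemma gauss_integ f : measurable_fun setT f -> polybd f -> integ gam f.
Proof.
move=> mf [C [m [C0 fC]]]; apply: integ_le fC _ => //.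
exact/integZ/gauss_integ_pow.
Qed.

Lemma integral_gauss (f : R -> R) (A : set R) : measurable A ->
  integ gam f ->
  (\int[gam]_(x in A) f x = \int[lam]_(x in A) (f x * npdf x)) /\
  lam.-integrable A (fun x => (f x * npdf x)%:E).
Proof.
move=> mA fi.
have mf := integ_measurable fi.
have mfA : measurable_fun setT (f \_ A).
  apply/(measurable_restrictT _ mA); exact: measurable_funTS.
have fpM (g : R -> R) : ((EFin \o (fun x => (g x * npdf x)%R))^\+ = (fun x => (EFin \o g)^\+ x * (npdf x)%:E))%E.
  apply/funext => x; rewrite !funeposE /= -!EFin_max -EFinM; congr EFin.
  by rewrite maxr_pMl ?npdf_ge0// mul0r.
have fnM (g : R -> R) : ((EFin \o (fun x => (g x * npdf x)%R))^\- = (fun x => (EFin \o g)^\- x * (npdf x)%:E))%E.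
  apply/funext => x; rewrite !funenegE /= -!EFin_max -EFinM; congr EFin.
  by rewrite maxr_pMl ?npdf_ge0// mul0r mulNr.
have E (g : R -> R) : measurable_fun setT g ->
    (\int[gam]_x (g x)%:E = \int[lam]_x (g x * npdf x)%:E)%E.
  move=> mg; rewrite integralE [RHS]integralE fpM fnM -!ge0_integral_gauss//.
  - by apply: measurable_funeneg; exact/measurable_EFinP.
  - by apply: measurable_funepos; exact/measurable_EFinP.
have lamT : lam.-integrable setT (fun x => (f x * npdf x)%:E).
  apply/integrableP; split.
    apply/measurable_EFinP; apply: measurable_funM => //; exact: measurable_npdf.
  case/integrableP: fi => _; rewrite (eq_integral (fun x => (`|f x|)%:E))//.
  rewrite E; last by apply: measurableT_comp.
  under eq_integral do rewrite -[X in _ * X](ger0_norm (npdf_ge0 _)) -normrM.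
  by [].
split; last by apply: integrableS lamT.
rewrite Rintegral_mkcond [RHS]Rintegral_mkcond /Rintegral E//.
congr fine; apply: eq_integral => x _; rewrite !patchE; case: ifP => //.
by rewrite mul0r.
Qed.

End gaussian.

Lemma integ_restrict {d : measure_display} {T : measurableType d} {R : realType}
    (P : probability T R) (f : T -> R) (A : set T) : measurable A ->
  integ P f -> integ P (f \_ A).
Proof.
move=> mA fi; apply: integ_le (integ_norm fi).
  apply/(measurable_restrictT _ mA); apply: measurable_funTS.
  exact: integ_measurable fi.
by move=> x; rewrite patchE; case: ifP => // _; rewrite normr0.
Qed.

(** * Tail integrals of the normal law *)

Section gaussian_tail.
Variable R : realType.
Local Notation gam := (@std_normal R).
Local Notation lam := (@lebesgue_measure R).
Implicit Types (f w : R -> R) (x y : R).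

Lemma continuous_measurable f : continuous f -> measurable_fun setT f.
Proof. exact: continuous_measurable_fun. Qed.

(** For [w] continuous, of polynomial growth and of mean zero, [lint w x / npdf x] is a polynomially
    bounded solution of [u' - x u = w]. *)
Definition lint w x := \int[gam]_(y in `]-oo, x]) w y.

Lemma is_derive_lint w x : continuous w -> polybd w ->
  is_derive x 1 (lint w) (w x * npdf x).
Proof.
move=> wc wp.
have wi := gauss_integ (continuous_measurable wc) wp.
have -> : lint w = (fun x => \int[lam]_(y in [set` Interval -oo%O (BRight x)]) (w y * npdf y)).
  by apply/funext => y; rewrite /lint (integral_gauss _ wi).1.
have xx : x < x + 1 by rewrite ltrDl.
have li : lam.-integrable [set` Interval -oo%O (BRight (x + 1))]
    (EFin \o (fun y => w y * npdf y)).
  by apply: (integral_gauss _ wi).2.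
have wpc : {for x, continuous (fun y => w y * npdf y)}.
  by apply: cvgM; [exact: wc|exact: continuous_npdf].
have [dF eF] := @continuous_FTC1 R _ -oo%O x _ xx li (ltNyr _) wpc.
apply: DeriveDef; first exact: dF.
by rewrite -derive1E; exact: eF.
Qed.

Definition rint w x := \int[gam]_(y in `]x, +oo[) w y.

Lemma lint_rint w x : integ gam w -> lint w x + rint w x = Ex gam w.
Proof.
move=> wi; rewrite /lint /rint /Ex -Rintegral_setU//.
- by congr Rintegral; rewrite -setCitvl setUv.
- by apply: (integrableS measurableT _ _ wi) => //; exact: measurableU.
- apply/disj_setPS => y [/=]; rewrite !in_itv/= andbT => yx.
  by rewrite ltNge yx.
Qed.

(** A Mills ratio estimate. For [x >= m + 1] the integrand is dominated by the exact derivative of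
    [- (1 + y)^m npdf y]; for smaller [x] the whole integral is compared with the density at
    [m + 1]. *)
Lemma rint_le_tail m : exists C : R, 0 < C /\ forall x, 0 <= x ->
  \int[gam]_(y in `[x, +oo[) ((1 + `|y|) ^+ m) <= C * (1 + x) ^+ m * npdf x.
Proof.
have ip := gauss_integ_pow R m.
have ipA (A : set R) : measurable A -> (gam : {measure set R -> \bar R}).-integrable A (EFin \o (fun y => (1 + `|y|) ^+ m)).
  by move=> mA; apply: integrableS ip.
pose K := Ex gam (fun y => (1 + `|y|) ^+ m).
have K0 : 0 <= K by apply: Ex_ge0 => y; rewrite exprn_ge0// addr_ge0.
(* From [m + 1] on, [(y - 1) (1 + y) >= m], which is what [gle] needs. *)
pose y0 : R := m.+1%:R.
exists (1 + K / npdf y0); split.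
  by rewrite ltr_pwDl// divr_ge0// npdf_ge0.
move=> x x0.
have x1 : 1 <= 1 + x by rewrite lerDl.
have [xy0|y0x] := ltP x y0.
  apply: (@le_trans _ _ K).
    rewrite Rintegral_mkcond; apply: Ex_le => //.
      exact: integ_restrict.
    move=> y; rewrite patchE; case: ifP => // _.
    by rewrite exprn_ge0// addr_ge0.
  apply: (@le_trans _ _ (K / npdf y0 * npdf x)).
    rewrite mulrAC ler_pdivlMr ?npdf_gt0// ler_wpM2l//.
    by apply: npdf_decr; rewrite !ger0_norm// ltW.
  have k0 : 0 <= K / npdf y0 by rewrite divr_ge0// npdf_ge0.
  rewrite ler_wpM2r ?npdf_ge0//.
  have : 1 <= (1 + x) ^+ m by exact: exprn_ege1.
  by move: k0; set k := K / npdf y0; set z := (1 + x) ^+ m => k0 z1; nra.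
have yx0 : 0 < x by rewrite (lt_le_trans _ y0x)// ltr0n.
pose g y := y * (1 + y) ^+ m - m%:R * (1 + y) ^+ m.-1.
pose F y := - ((1 + y) ^+ m * npdf y).
have dp (y : R) : is_derive y 1 (fun t => (1 + t) ^+ m) (m%:R * (1 + y) ^+ m.-1).
  exact: is_derive_comp_shift (is_derive_pow m (1 + y)).
have dF (y : R) : is_derive y 1 F (g y * npdf y).
  apply: is_derive_eq (is_deriveN (is_derive_mul (dp y) (is_derive_npdf y))) _.
  by rewrite /g; ring.
have gc : continuous g.
  move=> y; apply: cvgB; apply: cvgM => //; try exact: cvg_cst.
    by apply: (is_derive_continuous dp).
  apply: (@is_derive_continuous _ (fun t => (1 + t) ^+ m.-1) (fun y => (m.-1)%:R * (1 + y) ^+ m.-1.-1)) => z.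
  exact: is_derive_comp_shift (is_derive_pow m.-1 (1 + z)).
have gi : integ gam g.
  apply: gauss_integ; first exact: continuous_measurable.
  have p1 : polybd (fun y : R => 1 + y) by apply: polybd_add; [exact: polybd_cst|exact: polybd_id].
  have pn n : polybd (fun y : R => (1 + y) ^+ n).
    elim: n => [|n IH]; first by under eq_fun do rewrite expr0; exact: polybd_cst.
    by under eq_fun do rewrite exprS; exact: polybd_mul.
  apply: polybd_add; first exact/polybd_mul/pn/polybd_id.
  apply/polybd_opp/polybd_scale/pn.
have gle y : x <= y -> (1 + `|y|) ^+ m <= g y.
  move=> xy; have y_ge0 : 0 <= y by exact: le_trans xy.
  rewrite ger0_norm// /g.
  have [->|m0] := posnP m.
    rewrite !expr0 mul0r subr0 mulr1 (le_trans _ xy)// (le_trans _ y0x)//.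
    by rewrite ler1n.
  rewrite -(prednK m0) exprS /=; set z := (1 + y) ^+ m.-1.
  have z0 : 0 <= z by rewrite exprn_ge0// addr_ge0.
  have my : m%:R + 1 <= y by rewrite (le_trans _ xy)// (le_trans _ y0x)// /y0 -natr1.
  rewrite prednK//; rewrite -subr_ge0.
  have -> : y * ((1 + y) * z) - m%:R * z - (1 + y) * z = ((y - 1) * (1 + y) - m%:R) * z by ring.
  rewrite mulr_ge0//.
  have m1 : 0 <= m%:R :> R by [].
  have : 0 <= (y - 1 - m%:R) * (1 + y) by rewrite mulr_ge0; lra.
  have : 0 <= m%:R * y by rewrite mulr_ge0.
  by lra.
apply: (@le_trans _ _ (\int[gam]_(y in `[x, +oo[) g y)).
  apply: le_Rintegral => //.
  - exact: ipA.
  - by apply: integrableS gi.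
  - by move=> y /=; rewrite in_itv/= andbT; exact: gle.
rewrite (integral_gauss _ gi).1//.
have Fl : F y @[y --> +oo] --> (0 : R).
  have [D [D0 HD]] := npdf_ub R m.+1.
  apply/cvgrPdist_le => /= e e0.
  near=> y; rewrite sub0r normrN /F normrN.
  have y1 : 0 < y by near: y; exact: nbhs_pinfty_gt.
  rewrite ger0_norm; last by rewrite mulr_ge0 ?npdf_ge0// exprn_ge0// addr_ge0// ltW.
  have y2 : 0 < 1 + y by rewrite addr_gt0.
  have h := HD y; rewrite (ger0_norm (ltW y1)) exprS -mulrA -ler_pdivlMl// in h.
  rewrite (le_trans h)// mulrC ler_pdivrMr//.
  have : D / e <= y by near: y; apply: nbhs_pinfty_ge; exact: num_real.
  by rewrite ler_pdivrMr// => /le_trans; apply; rewrite mulrC ler_pM2l// lerDr.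
rewrite (@Rintegral_ge0_continuous_FTC2y R (fun y => g y * npdf y) F x 0)//.
- rewrite sub0r /F opprK ler_wpM2r ?npdf_ge0// ler_peMl//.
    by rewrite exprn_ge0// (le_trans _ x1).
  by rewrite lerDl divr_ge0// npdf_ge0.
- by move=> y xy; rewrite mulr_ge0 ?npdf_ge0// (le_trans _ (gle y xy)).
- apply: continuous_subspaceT => y; apply: cvgM; first exact: gc.
  exact: continuous_npdf.
- apply: cvg_at_right_filter; exact: (is_derive_continuous dF).
- by move=> y _; rewrite derive1E (@derive_val _ _ _ _ _ _ _ (dF y)).
Unshelve. all: by end_near. Qed.

Lemma lint_le_tail m x : 
  \int[gam]_(y in `]-oo, (- x)%R]) ((1 + `|y|) ^+ m) =
  \int[gam]_(y in `[x, +oo[) ((1 + `|y|) ^+ m).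
Proof.
have ip := gauss_integ_pow R m.
rewrite !(integral_gauss _ ip).1// /Rintegral ge0_integration_by_substitutionNy.
- apply: (congr1 fine); apply: eq_integral => y _.
  by rewrite fctE normrN npdf_even.
- apply: continuous_subspaceT => y; apply: cvgM; last exact: continuous_npdf.
  apply: (@continuous_comp _ _ _ (fun y => 1 + `|y|) (fun z : R => z ^+ m)).
    by apply: cvgD; [exact: cvg_cst|exact: norm_continuous].
  exact: exprn_continuous.
- by move=> y _; rewrite mulr_ge0 ?npdf_ge0// exprn_ge0// addr_ge0.
Qed.

Lemma lint_rint_tail m : exists C : R, 0 < C /\ forall w (A : R),
  measurable_fun setT w -> (forall y, `|w y| <= A * (1 + `|y|) ^+ m) ->
  forall x, 0 <= x -> `|rint w x| <= C * A * (1 + x) ^+ m * npdf x /\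
                     `|lint w (- x)| <= C * A * (1 + x) ^+ m * npdf x.
Proof.
have [C [C0 HC]] := rint_le_tail m.
exists C; split=> // w A mw wA x x0.
have wi : integ gam w by apply: integ_le wA (integZ _ (gauss_integ_pow R m)).
have A0 : 0 <= A by have := le_trans (normr_ge0 _) (wA 0); rewrite normr0 addr0 expr1n mulr1.
have ip := gauss_integ_pow R m.
have bnd (B : set R) : measurable B -> `|\int[gam]_(y in B) w y| <= A * \int[gam]_(y in B) ((1 + `|y|) ^+ m).
  move=> mB; apply: le_trans (le_normr_Rintegral _ _) _ => //; first exact: integrableS wi.
  rewrite -RintegralZl//; last exact: integrableS ip.
  apply: le_Rintegral => //.
  - by apply: integrableS (integ_norm wi).
  - by apply: integrableS (integZ A ip).
have -> : C * A * (1 + x) ^+ m * npdf x = A * (C * (1 + x) ^+ m * npdf x) by ring.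
split; rewrite (le_trans (bnd _ _))// ler_wpM2l//; last by rewrite lint_le_tail HC.
rewrite (le_trans _ (HC x x0))//.
rewrite !(integral_gauss _ ip).1// Rintegral_itv_obnd_cbnd//.
exact: (integral_gauss _ ip).2.
Qed.

(** Vanishing mean makes the left and right integrals opposite, so on each side of the origin the
    integral over the nearer tail can be used. *)
Lemma lint_bound m : exists C : R, 0 < C /\ forall w (A : R), measurable_fun setT w ->
  (forall y, `|w y| <= A * (1 + `|y|) ^+ m) -> Ex gam w = 0 ->
  forall x, `|lint w x| <= C * A * (1 + `|x|) ^+ m * npdf x.
Proof.
have [C [C0 HC]] := lint_rint_tail m.
exists C; split=> // w A mw wA Ew x.
have wi : integ gam w by apply: integ_le wA (integZ _ (gauss_integ_pow R m)).
have [x0|x0] := leP 0 x.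
  have -> : lint w x = - rint w x.
    by apply/eqP; rewrite -addr_eq0 lint_rint// Ew.
  by rewrite normrN (ger0_norm x0) (HC w A mw wA x x0).1.
rewrite (ltr0_norm x0).
by have := (HC w A mw wA (- x)); rewrite oppr_ge0 opprK npdf_even => /(_ (ltW x0)) [].
Qed.

End gaussian_tail.

(** * Stein's equation and Hermite polynomials *)

Section stein_equation.
Variable R : realType.
Local Notation gam := (@std_normal R).
Implicit Types (f u : R -> R) (x y : R).

Lemma polybd_lint_div w : continuous w -> polybd w -> Ex gam w = 0 ->
  polybd (fun x => lint w x / npdf x).
Proof.
move=> wc [A [m [A0 wA]]] Ew.
have [C [C0 HC]] := lint_bound R m.
exists (C * A), m; split; first by rewrite mulr_ge0// ltW.
move=> x; rewrite normrM normfV (gtr0_norm (npdf_gt0 x)).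
rewrite ler_pdivrMr ?npdf_gt0//.
exact: HC (continuous_measurable wc) wA Ew x.
Qed.

Lemma lt_all_inv_eq0 (c K : R) : (forall x, 0 <= x -> `|c| * (1 + x) <= K) -> c = 0.
Proof.
move=> H; apply/eqP/negPn/negP => c0.
have {}c0 : 0 < `|c| by rewrite normr_gt0.
have K0 : 0 <= K.
  by have := H 0 (lexx _); rewrite addr0 mulr1; exact: le_trans.
have := H (K / `|c|) (divr_ge0 K0 (ltW c0)).
by rewrite mulrDr mulr1 mulrCA divff ?gt_eqF// mulr1; lra.
Qed.

(** [lint (du - x u) - u npdf] has zero derivative, hence is constant. It tends to 0 at minus
    infinity, and at plus infinity to the difference of the two expectations. Both limits are
    obtained from decay bounds with one spare factor [1 + x]. *)
Lemma gauss_ibp u (du : R -> R) : (forall x, is_derive x 1 u (du x)) ->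
  continuous du -> polybd u -> polybd du ->
  Ex gam du = Ex gam (fun x => x * u x).
Proof.
move=> ud duc up dup.
have uc := is_derive_continuous ud.
pose w x := du x - x * u x.
have wc : continuous w.
  by move=> x; apply: cvgB; [exact: duc|apply: cvgM; [exact: cvg_id|exact: uc]].
have xup : polybd (fun x => x * u x) by apply: polybd_mul => //; exact: polybd_id.
have wp : polybd w by apply: polybd_add => //; exact: polybd_opp.
have xuc : continuous (fun x => x * u x).
  by move=> x; apply: cvgM; [exact: cvg_id|exact: uc].
have iw := gauss_integ (continuous_measurable wc) wp.
apply/eqP; rewrite -subr_eq0 -ExB; last 2 first.
- exact: gauss_integ (continuous_measurable duc) dup.
- exact: gauss_integ (continuous_measurable xuc) xup.
rewrite -[X in Ex _ X]/w; set e := Ex _ _.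
pose G x := lint w x - u x * npdf x.
have Gd x : is_derive x 1 G 0.
  apply: is_derive_eq (is_derive_sub (is_derive_lint x wc wp) (is_derive_mul (ud x) (is_derive_npdf x))) _.
  by rewrite /w; ring.
have Gc x : G x = G 0.
  have := @is_derive_mvt_norm _ G (fun=> 0) 0 x 0 (fun x => Gd x).
  rewrite normr0 mul0r => /(_ (fun _ _ => lexx _)).
  by rewrite normr_le0 subr_eq0 => /eqP.
have [A [m [A0 wA]]] := wp; have [B [n [B0 uB]]] := up.
have [C [C0 HC]] := lint_rint_tail R m.
have [D [D0 HD]] := npdf_ub R m.+1.
have [E [E0 HE]] := npdf_ub R n.+1.
have HT x : 0 <= x -> (1 + x) * (C * A * (1 + x) ^+ m * npdf x) <= C * A * D.
  move=> x0; have := HD x; rewrite ger0_norm// exprS.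
  have -> : (1 + x) * (C * A * (1 + x) ^+ m * npdf x) = C * A * ((1 + x) * (1 + x) ^+ m * npdf x) by ring.
  by apply: ler_wpM2l; rewrite mulr_ge0// ltW.
have HU x : 0 <= x -> (1 + x) * `|u x * npdf x| <= B * E /\ (1 + x) * `|u (- x) * npdf x| <= B * E.
  move=> x0; have := HE x; rewrite ger0_norm// exprS => h.
  have x1 : 0 <= 1 + x by rewrite addr_ge0.
  have aux (z : R) : `|z| <= B * (1 + x) ^+ n -> (1 + x) * `|z * npdf x| <= B * E.
    move=> zB; rewrite normrM (gtr0_norm (npdf_gt0 x)).
    apply: (@le_trans _ _ ((1 + x) * (B * (1 + x) ^+ n * npdf x))).
      by rewrite ler_wpM2l// ler_wpM2r// npdf_ge0.
    have -> : (1 + x) * (B * (1 + x) ^+ n * npdf x) = B * ((1 + x) * (1 + x) ^+ n * npdf x) by ring.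
    exact: ler_wpM2l.
  split; apply: aux; first by have := uB x; rewrite (ger0_norm x0).
  by have := uB (- x); rewrite normrN (ger0_norm x0).
have G0 : G 0 = 0.
  apply: (@lt_all_inv_eq0 _ (C * A * D + B * E)) => x x0.
  rewrite -(Gc (- x)) /G npdf_even.
  have [_ h1] := HC w A (continuous_measurable wc) wA x x0.
  have [_ h2] := HU x x0; have h3 := HT x x0.
  have x1 : 0 <= 1 + x by rewrite addr_ge0.
  rewrite mulrC (le_trans (ler_wpM2l x1 (ler_normB _ _)))// mulrDr lerD//.
  by rewrite (le_trans _ h3)// ler_wpM2l.
apply/eqP/(@lt_all_inv_eq0 _ (C * A * D + B * E)) => x x0.
have -> : e = rint w x + u x * npdf x.
  have := Gc x; rewrite G0 /G /e -(lint_rint x iw) => /eqP; rewrite subr_eq0 => /eqP ->.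
  by rewrite addrC.
have [h1 _] := HC w A (continuous_measurable wc) wA x x0.
have [h2 _] := HU x x0; have h3 := HT x x0.
have x1 : 0 <= 1 + x by rewrite addr_ge0.
rewrite mulrC (le_trans (ler_wpM2l x1 (ler_normD _ _)))// mulrDr lerD//.
by rewrite (le_trans _ h3)// ler_wpM2l.
Qed.

(** The pair at [k] holds the derivatives of orders [k] and [k + 1] of the Stein solution. Repeated
    differentiation of [f' = x f + w] gives a two-term recursion, which defines the candidates
    before any differentiability is known. *)
Fixpoint stein_pair (w : R -> R) (h : nat -> R -> R) k : (R -> R) * (R -> R) :=
  match k with
  | 0 => (fun x => lint w x / npdf x, fun x => x * (lint w x / npdf x) + w x)
  | k'.+1 => let f := stein_pair w h k' in
    (f.2, fun x => x * f.2 x + k'.+1%:R * f.1 x + h k'.+1 x)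
  end.

(** One derivative is gained: the derivative of order [q] solves the equation of
    [stein_derivative_lipschitz] with [k = q] and [S] equal to [q] times the previous derivative,
    whence the Lipschitz constant of the derivative of order [q + 1]. *)
Lemma stein_solution q (M : R) (h : nat -> R -> R) : jet q M h ->
  exists f : nat -> R -> R, jet q.+1 (2 * q.+2%:R * M) f /\
    forall x, f 1%N x - x * f 0%N x = h 0%N x - Ex gam (h 0%N).
Proof.
move=> hj; pose w x := h 0%N x - Ex gam (h 0%N).
have hc k : (k <= q)%N -> continuous (h k) by exact: jet_continuous hj.
have hp k : (k <= q)%N -> polybd (h k) by exact: jet_polybd hj.
have wc : continuous w by move=> x; apply: cvgB; [exact: hc|exact: cvg_cst].
have wp : polybd w by apply: polybd_add; [exact: hp|exact: polybd_cst].
have Ew : Ex gam w = 0.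
  rewrite ExB ?Ex_cst ?subrr//; last exact: integ_cst.
  by apply: gauss_integ; [apply: continuous_measurable; exact: hc|exact: hp].
pose f k := (stein_pair w h k).1.
have f2 k x : f k.+2 x = x * f k.+1 x + k.+1%:R * f k x + h k.+1 x by [].
have f1 x : f 1%N x = x * f 0%N x + w x by [].
have fd k x : (k <= q)%N -> is_derive x 1 (f k) (f k.+1 x).
  elim/ltn_ind: k x => -[|[|k]] IH x kq.
  - apply: is_derive_eq (is_derive_mul (is_derive_lint x wc wp) (is_derive_npdfV x)) _.
    by rewrite f1 /f/=; field; rewrite gt_eqF// npdf_gt0.
  - have -> : f 1%N = (fun x => x * f 0%N x + w x) by apply/funext => y.
    have d0 := IH 0%N isT x (ltnW kq).
    have dh : is_derive x 1 w (h 1%N x).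
      apply: is_derive_eq (is_derive_sub (hj.1 0%N x kq) (is_derive_cst _ x 1)) _.
      by rewrite subr0.
    apply: is_derive_eq (is_derive_add (is_derive_mul (is_derive_id x 1) d0) dh) _.
    by rewrite f2; ring.
  - have -> : f k.+2 = (fun x => x * f k.+1 x + k.+1%:R * f k x + h k.+1 x) by apply/funext => y.
    have d0 := IH k (ltnW (ltnSn _)) x (ltnW (ltnW kq)).
    have d1 := IH k.+1 (ltnSn _) x (ltnW kq).
    apply: is_derive_eq (is_derive_add (is_derive_add (is_derive_mul (is_derive_id x 1) d1) (is_derive_scale k.+1%:R d0)) (hj.1 k.+1 x kq)) _.
    by rewrite (f2 k.+1) -[k.+2%:R]natr1; ring.
have fp k : (k <= q.+1)%N -> polybd (f k).
  elim/ltn_ind: k => -[|[|k]] IH kq.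
  - exact: polybd_lint_div.
  - have -> : f 1%N = (fun x => x * f 0%N x + w x) by apply/funext => y.
    by apply: polybd_add => //; apply: polybd_mul; [exact: polybd_id|exact: IH].
  - have -> : f k.+2 = (fun x => x * f k.+1 x + k.+1%:R * f k x + h k.+1 x) by apply/funext => y.
    apply: polybd_add; last exact: hp.
    apply: polybd_add.
      by apply: polybd_mul; [exact: polybd_id|apply: IH => //; exact: ltnW].
    by apply: polybd_scale; apply: IH => //; exact: (leq_trans (leqnSn _) (ltnW kq)).
exists f; split; last first.
  by move=> x; rewrite f1 addrAC subrr add0r.
split=> [k x kq|]; first exact: fd.
have -> : 2 * q.+2%:R * M = 2 * (q%:R + 2) * M by rewrite -[q.+2]addn2 natrD.
(* For [q = 0] there is no previous derivative, and [S] is zero. *)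
case: q => [|q] in hj hc hp fd fp *.
  have wL x y : `|w x - w y| <= M * `|x - y|.
    have -> : w x - w y = h 0%N x - h 0%N y by rewrite /w; ring.
    exact: hj.2.
  have ud (x : R) : is_derive x 1 (f 0%N) (x * f 0%N x + cst 0 x + w x).
    by apply: is_derive_eq (fd 0%N x isT) _; rewrite f1 /= addr0.
  have Sd (x : R) : is_derive x 1 (cst 0 : R -> R) (0%:R * f 0%N x).
    by rewrite mul0r; exact: is_derive_cst.
  have := stein_derivative_lipschitz (lexx _) ud Sd wL (fp 0%N isT).
  by move=> /= H x y; rewrite !f1; have := H x y; rewrite !addr0.
have ud (x : R) : is_derive x 1 (f q.+1) (x * f q.+1 x + (fun x => q.+1%:R * f q x) x + h q.+1 x).
  exact: fd.
have Sd (x : R) : is_derive x 1 (fun x => q.+1%:R * f q x) (q.+1%:R * f q.+1 x).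
  by apply: is_derive_scale; apply: fd.
have := stein_derivative_lipschitz _ ud Sd hj.2 (fp q.+1 (leqnSn _)).
by apply.
Qed.

Fixpoint hermite_pair k : (R -> R) * (R -> R) :=
  match k with
  | 0 => (cst 1, id)
  | k'.+1 => let f := hermite_pair k' in
    (f.2, fun x => x * f.2 x - k'.+1%:R * f.1 x)
  end.

Definition hermite k := (hermite_pair k).1.

Lemma hermiteSS k x : hermite k.+2 x = x * hermite k.+1 x - k.+1%:R * hermite k x.
Proof. by []. Qed.

Lemma is_derive_hermite k x : is_derive x 1 (hermite k) (k%:R * hermite k.-1 x).
Proof.
elim/ltn_ind: k x => -[|[|k]] IH x.
- by rewrite mul0r; exact: is_derive_cst.
- by rewrite mul1r; exact: is_derive_id.
- have -> : hermite k.+2 = (fun x => x * hermite k.+1 x - k.+1%:R * hermite k x).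
    by apply/funext => y.
  apply: is_derive_eq (is_derive_sub (is_derive_mul (is_derive_id x 1) (IH k.+1 (ltnSn _) x)) (is_derive_scale k.+1%:R (IH k (ltnW (ltnSn _)) x))) _.
  case: k IH => [|k] IH /=; first by rewrite /hermite/=; ring.
  by rewrite (hermiteSS k) -[k.+3%:R]natr1 -[k.+2%:R]natr1; ring.
Qed.

Lemma hermiteS k x : hermite k.+1 x = x * hermite k x - k%:R * hermite k.-1 x.
Proof. by case: k => [|k] //; rewrite /hermite/=; ring. Qed.

Lemma polybd_hermite k : polybd (hermite k).
Proof.
elim/ltn_ind: k => -[|[|k]] IH.
- exact: polybd_cst.
- exact: polybd_id.
- apply: (@polybd_add _ (fun x => x * hermite k.+1 x) (fun x => - (k.+1%:R * hermite k x))).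
    by apply: polybd_mul; [exact: polybd_id|exact: IH].
  by apply/polybd_opp/polybd_scale/IH/ltnW.
Qed.

Lemma continuous_hermite k : continuous (hermite k).
Proof. exact: is_derive_continuous (is_derive_hermite k). Qed.

(** Integration by parts for [u * hermite k], combined with [H_(k+1) = x H_k - H_k']. *)
Lemma gauss_ibp_hermite u (du : R -> R) k : (forall x, is_derive x 1 u (du x)) ->
  continuous du -> polybd u -> polybd du ->
  Ex gam (fun x => du x * hermite k x) = Ex gam (fun x => u x * hermite k.+1 x).
Proof.
move=> ud duc up dup.
have uc := is_derive_continuous ud.
pose v x := du x * hermite k x + u x * (k%:R * hermite k.-1 x).
have hc := continuous_hermite.
have c1 : continuous (fun x => du x * hermite k x).
  by move=> x; apply: cvgM; [exact: duc|exact: hc].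
have c2 : continuous (fun x => u x * (k%:R * hermite k.-1 x)).
  move=> x; apply: cvgM; first exact: uc.
  by apply: cvgM; [exact: cvg_cst|exact: hc].
have p1 : polybd (fun x => du x * hermite k x) by apply: polybd_mul => //; exact: polybd_hermite.
have p2 : polybd (fun x => u x * (k%:R * hermite k.-1 x)).
  by apply: polybd_mul => //; apply: polybd_scale; exact: polybd_hermite.
have p3 : polybd (fun x => u x * hermite k x) by apply: polybd_mul => //; exact: polybd_hermite.
have c3 : continuous (fun x => u x * hermite k x).
  by move=> x; apply: cvgM; [exact: uc|exact: hc].
have i1 := gauss_integ (continuous_measurable c1) p1.
have i2 := gauss_integ (continuous_measurable c2) p2.
have c4 : continuous (fun x => x * (u x * hermite k x)).
  by move=> x; apply: cvgM; [exact: cvg_id|exact: c3].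
have p4 : polybd (fun x => x * (u x * hermite k x)) by apply: polybd_mul => //; exact: polybd_id.
have i4 := gauss_integ (continuous_measurable c4) p4.
have vc : continuous v by move=> x; apply: cvgD; [exact: c1|exact: c2].
have vp : polybd v by exact: polybd_add.
have := gauss_ibp (fun x => is_derive_mul (ud x) (is_derive_hermite k x)) vc p3 vp.
rewrite /v ExD// => E.
have -> : (fun x => u x * hermite k.+1 x) =
    (fun x => x * (u x * hermite k x) - u x * (k%:R * hermite k.-1 x)).
  by apply/funext => x; rewrite hermiteS; ring.
by rewrite ExB// -E addrK.
Qed.

Lemma Ex_hermite k : Ex gam (hermite k.+1) = 0.
Proof.
have := @gauss_ibp_hermite (cst 1) (cst 0) k.
rewrite (_ : (fun x => cst 1 x * hermite k.+1 x) = hermite k.+1); last first.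
  by apply/funext => x; rewrite mul1r.
move=> <-; last 3 first.
- exact: cst_continuous.
- exact: polybd_cst.
- exact: polybd_cst.
by under [X in Ex _ X]eq_fun do rewrite mul0r; rewrite Ex_cst.
Qed.

(** Substitute [h = f1 - x f0 + E h], move the derivative off [f1] and apply the three-term
    recurrence. Expectations of the Stein solution can thus be traded for expectations of [h]
    itself. *)
Lemma stein_hermite f0 f1 h k : (forall x, is_derive x 1 f0 (f1 x)) ->
  continuous f1 -> polybd f0 -> polybd f1 -> continuous h -> polybd h ->
  (forall x, f1 x - x * f0 x = h x - Ex gam h) ->
  Ex gam (fun x => h x * hermite k.+1 x) =
  - (k.+1%:R * Ex gam (fun x => f0 x * hermite k x)).
Proof.
move=> fd f1c f0p f1p hc hp fE.
have f0c := is_derive_continuous fd.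
have hi k' (u : R -> R) : continuous u -> polybd u -> integ gam (fun x => u x * hermite k' x).
  move=> uc up; apply: gauss_integ; last by apply: polybd_mul => //; exact: polybd_hermite.
  by apply: continuous_measurable => x; apply: cvgM; [exact: uc|exact: continuous_hermite].
have -> : (fun x => h x * hermite k.+1 x) =
    (fun x => f1 x * hermite k.+1 x - (f0 x * hermite k.+2 x + k.+1%:R * (f0 x * hermite k x))
      + Ex gam h * hermite k.+1 x).
  apply/funext => x; have -> : h x = f1 x - x * f0 x + Ex gam h by rewrite fE subrK.
  by rewrite hermiteSS; ring.
have ih : integ gam (hermite k.+1).
  exact: gauss_integ (continuous_measurable (@continuous_hermite _)) (polybd_hermite _).
rewrite ExD; last 2 first.
- by apply: integB; [exact: hi|apply: integD; [exact: hi|apply: integZ; exact: hi]].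
- exact: integZ.
rewrite ExZ// Ex_hermite mulr0 addr0 ExB; last 2 first.
- exact: hi.
- by apply: integD; [exact: hi|apply: integZ; exact: hi].
rewrite ExD; [|exact: hi|by apply: integZ; exact: hi].
rewrite ExZ; last exact: hi.
by rewrite (gauss_ibp_hermite k.+1 fd f1c f0p f1p) opprD addNKr.
Qed.

End stein_equation.

(** * Expansions under local dependence *)

Section jet_growth.
Variable R : realType.

(** The exponent is explicit, in contrast to [polybd]: it is counted against the available moments
    of order [p + 2]. *)
Lemma jet_growth m L (g : nat -> R -> R) k : jet m L g -> (k <= m)%N ->
  exists2 C : R, 0 <= C & forall x, `|g k x| <= C * (1 + `|x|) ^+ (m - k).+1.
Proof.
move=> gj km.
have {}gj : jet (m - k) L (fun j => g (k + j)%N).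
  by apply: jet_shift; rewrite subnKC.
pose D := \sum_(j < (m - k).+1) `|g (k + j)%N 0 / j`!%:R|.
exists (D + L).
  by rewrite addr_ge0 ?(jet_ge0 gj)// sumr_ge0.
move=> x; have := taylor 0 x gj; rewrite add0r addn0.
set s := \sum_(_ < _) _ => h.
rewrite -[g k x](subrK s) addrC (le_trans (ler_normD _ _))// mulrDl lerD//; last first.
  rewrite (le_trans h)// ler_wpM2l ?(jet_ge0 gj)// lerXn2r ?nnegrE ?addr_ge0// lerDr//.
rewrite (le_trans (ler_norm_sum _ _ _))// mulr_suml ler_sum// => j _.
rewrite mulrCA mulrC normrM ler_wpM2l// normrX.
apply: (@le_trans _ _ ((1 + `|x|) ^+ j)).
  by rewrite lerXn2r ?nnegrE ?addr_ge0// lerDr.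
by rewrite ler_weXn2l ?lerDl// ltnW.
Qed.

End jet_growth.

Section local_dependence.
Variable R : realType.

Section monomials.
Context {d : measure_display} {Om : measurableType d} {I : finType}.
Variable Y : I -> Om -> R.

Definition Prod (s : seq I) w : R := \prod_(i <- s) Y i w.
Definition SumY (N : {set I}) w : R := \sum_(j in N) Y j w.
Definition Nbh (nb : I -> {set I}) (s : seq I) : {set I} := \bigcup_(i <- s) nb i.

End monomials.

(** What is retained of the random field. In the application [Y i] is the summand divided by the
    standard deviation and [lam] is the inverse of that deviation. [ld_indep] expresses independence
    through expectations, the form in which the Taylor argument uses it. *)
Record local_dep d (Om : measurableType d) (P : probability Om R) (I : finType)
    (Y : I -> Om -> R) (nb : I -> {set I}) (p B : nat) (K lam : R) : Prop := LocalDep {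
  ld_meas : forall i, measurable_fun setT (Y i);
  ld_int : forall i r, (r <= p.+2)%N -> integ P (fun w => `|Y i w| ^+ r);
  ld_mom : forall i r, (r <= p.+2)%N -> Ex P (fun w => `|Y i w| ^+ r) <= K * lam ^+ r;
  ld_lam : 0 <= lam;
  ld_K : 1 <= K;
  ld_self : forall i, i \in nb i;
  ld_card : forall i, (#|nb i| <= B)%N;
  ld_indep : forall (s : seq I) (g : R -> R), (size s <= p.+1)%N -> continuous g ->
    integ P (Prod Y s) -> integ P (fun w => g (SumY Y (~: Nbh nb s) w)) ->
    Ex P (fun w => Prod Y s w * g (SumY Y (~: Nbh nb s) w)) =
    Ex P (Prod Y s) * Ex P (fun w => g (SumY Y (~: Nbh nb s) w)) }.

(** Every summand is at most the largest one, whose power is again a summand. The term [(r == 0)%:R]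
    covers the empty [N], where [0 ^+ 0 = 1]. *)
Lemma sum_pow_le (I : finType) (N : {set I}) (y : I -> R) r :
  (forall i, 0 <= y i) ->
  (\sum_(j in N) y j) ^+ r <= (r == 0)%:R + #|N|%:R ^+ r * \sum_(j in N) y j ^+ r.
Proof.
move=> y0; have [->|r0] := eqVneq r 0.
  by rewrite expr0 lerDl mulr_ge0// sumr_ge0// => j _; rewrite expr0.
rewrite add0r; have [->|[j0 j0N]] := set_0Vmem N.
  by rewrite !big_set0 expr0n (negbTE r0) mulr0.
case: (@Order.TotalTheory.arg_maxP _ _ I j0 (mem N) y j0N) => jm jmN ymax.
apply: (@le_trans _ _ ((#|N|%:R * y jm) ^+ r)).
  rewrite lerXn2r ?nnegrE ?sumr_ge0 ?mulr_ge0//.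
  rewrite mulr_natl -sumr_const.
  by apply: ler_sum => j jN; exact: ymax.
rewrite exprMn ler_wpM2l ?exprn_ge0// (bigD1 jm)//= lerDl sumr_ge0// => j _.
by rewrite exprn_ge0.
Qed.

Section context.
Context d (Om : measurableType d) (P : probability Om R) (I : finType).
Variables (Y : I -> Om -> R) (nb : I -> {set I}) (p B : nat) (K lam : R).
Hypothesis H : local_dep P Y nb p B K lam.

Local Notation W := (SumY Y (finset.setTfor I)).
Local Notation E := (Ex P).

Let Ymeas i := ld_meas H i.

Lemma measurable_SumY N : measurable_fun setT (SumY Y N).
Proof.
rewrite /SumY (_ : (fun w => _) = fun w => \sum_(j <- enum N) Y j w).
  exact: measurable_sum.
by apply/funext => w; rewrite big_enum.
Qed.

Lemma measurable_Prod s : measurable_fun setT (Prod Y s).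
Proof. exact: measurable_prod. Qed.

(** One dominating variable with [p + 2] moments for all monomials below. It serves integrability
    only; bounds uniform in the size of [I] come from [moment_le] on bounded sets [N]. *)
Definition dom w : R := 1 + \sum_i `|Y i w|.

Lemma dom_ge1 w : 1 <= dom w.
Proof. by rewrite lerDl sumr_ge0. Qed.

Lemma measurable_dom : measurable_fun setT dom.
Proof.
apply: measurable_funD => //; apply: measurable_sum => i.
exact: measurableT_comp.
Qed.

Lemma integ_dom r : (r <= p.+2)%N -> integ P (fun w => dom w ^+ r).
Proof.
move=> rp; pose G w : R := 2 ^+ r * (1 + ((r == 0)%:R + #|finset.setTfor I|%:R ^+ r * \sum_(j <- enum I) `|Y j w| ^+ r)).
apply: (@integ_le _ _ _ _ _ G).
- exact/measurable_funX/measurable_dom.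
- move=> w; rewrite ger0_norm; last by rewrite exprn_ge0// (le_trans _ (dom_ge1 w)).
  have := @sum_pow_le I (finset.setTfor I) (fun i => `|Y i w|) r (fun i => normr_ge0 _).
  rewrite (eq_bigl predT) => [|i]; last by rewrite inE.
  rewrite [X in _ * X](eq_bigl predT) => [|i]; last by rewrite inE.
  rewrite /dom /G big_enum/=; set x := \sum_i `|Y i w| => h.
  have x0 : 0 <= x by exact: sumr_ge0.
  apply: (@le_trans _ _ (2 ^+ r * (1 + x ^+ r))); last by rewrite ler_wpM2l ?exprn_ge0// lerD2l.
  have xr : 0 <= x ^+ r by rewrite exprn_ge0.
  have [x1|x1] := leP x 1.
    apply: (@le_trans _ _ (2 ^+ r * 1)); last by rewrite ler_wpM2l ?exprn_ge0// lerDl.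
    by rewrite mulr1 lerXn2r ?nnegrE ?addr_ge0//; lra.
  apply: (@le_trans _ _ (2 ^+ r * x ^+ r)); last by rewrite ler_wpM2l ?exprn_ge0// lerDr.
  by rewrite -exprMn lerXn2r ?nnegrE ?mulr_ge0 ?addr_ge0//; lra.
- apply: integZ; apply: integD; first exact: integ_cst.
  apply: integD; first exact: integ_cst.
  by apply: integZ; apply: integ_sum => i; exact: (ld_int H).
Qed.

Lemma Prod_le_dom s w : `|Prod Y s w| <= dom w ^+ size s.
Proof.
rewrite /Prod; elim: s => [|i s IH]; first by rewrite big_nil normr1.
rewrite big_cons normrM exprS ler_pM//.
by rewrite /dom (bigD1 i)//= addrCA lerDl addr_ge0// sumr_ge0.
Qed.

Lemma SumY_le_dom N w : 1 + `|SumY Y N w| <= dom w.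
Proof.
rewrite lerD2l (le_trans (ler_norm_sum _ _ _))//.
by rewrite [leRHS](bigID (mem N))/= lerDl sumr_ge0.
Qed.

Lemma integ_monomial m M g s N N' k j : jet m M g -> (j <= m)%N ->
  (size s + k + (m - j).+1 <= p.+2)%N ->
  integ P (fun w => Prod Y s w * SumY Y N w ^+ k * g j (SumY Y N' w)).
Proof.
move=> gj jm le; have [C C0 gC] := jet_growth gj jm.
apply: (@integ_le _ _ _ _ _ (fun w => C * dom w ^+ (size s + k + (m - j).+1))).
- apply: measurable_funM.
    apply: measurable_funM; first exact: measurable_Prod.
    exact/measurable_funX/measurable_SumY.
  apply: measurableT_comp; last exact: measurable_SumY.
  by apply: continuous_measurable; exact: jet_continuous gj jm.
- move=> w; rewrite !normrM !exprD normrX.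
  have d0 : 0 <= dom w by rewrite (le_trans _ (dom_ge1 w)).
  have -> : C * (dom w ^+ size s * dom w ^+ k * dom w ^+ (m - j).+1) =
    dom w ^+ size s * dom w ^+ k * (C * dom w ^+ (m - j).+1) by ring.
  have h0 NN : `|SumY Y NN w| <= dom w.
    by rewrite (le_trans _ (SumY_le_dom NN w))// lerDr.
  apply: ler_pM => //.
  - apply: ler_pM; rewrite ?exprn_ge0//; first exact: Prod_le_dom.
    by rewrite lerXn2r// ?nnegrE.
  - rewrite (le_trans (gC _))// ler_wpM2l// lerXn2r// ?nnegrE ?addr_ge0//.
    exact: SumY_le_dom.
- exact/integZ/integ_dom.
Qed.

Lemma integ_Prod s : (size s <= p.+2)%N -> integ P (Prod Y s).
Proof.
move=> sp; apply: integ_le (@integ_dom _ sp); first exact: measurable_Prod.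
exact: Prod_le_dom.
Qed.

Lemma integ_comp_SumY m M g N : jet m M g -> (m.+1 <= p.+2)%N ->
  integ P (fun w => g 0%N (SumY Y N w)).
Proof.
move=> gj mp; have := @integ_monomial m M g [::] N N 0 0 gj isT.
rewrite /= addn0 subn0 => /(_ mp).
by congr integ; apply/funext => w; rewrite /Prod big_nil expr0 !mul1r.
Qed.

Lemma card_Nbh s : (#|Nbh nb s| <= size s * B)%N.
Proof.
rewrite /Nbh; elim: s => [|i s IH]; first by rewrite big_nil cards0.
rewrite big_cons mulSn (leq_trans (leq_card_setU _ _).1)// leq_add//.
exact: ld_card H i.
Qed.

Lemma sub_Nbh s i : i \in s -> i \in Nbh nb s.
Proof.
elim: s => [//|j s IH]; rewrite in_cons /Nbh big_cons inE => /orP[/eqP ->|/IH ->].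
  by rewrite (ld_self H).
by rewrite orbT.
Qed.

Lemma Prod_le_sum s (N : {set I}) w : {subset s <= N} ->
  `|Prod Y s w| <= (\sum_(j in N) `|Y j w|) ^+ size s.
Proof.
rewrite /Prod; elim: s => [|i s IH] sN; first by rewrite big_nil normr1.
rewrite big_cons normrM exprS ler_pM//.
  by rewrite (bigD1 i) ?sN ?mem_head//= lerDl sumr_ge0.
by apply: IH => j js; rewrite sN// in_cons js orbT.
Qed.

Lemma integ_moment s k N : (size s + k <= p.+2)%N ->
  integ P (fun w => `|Prod Y s w| * `|SumY Y N w| ^+ k).
Proof.
move=> skp; apply: integ_le (integ_dom skp).
  apply: measurable_funM; first by apply: measurableT_comp => //; exact: measurable_Prod.
  apply: measurable_funX; apply: measurableT_comp => //; exact: measurable_SumY.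
move=> w; rewrite normrM normrX !normr_id exprD ler_pM// ?exprn_ge0 ?Prod_le_dom//.
have h : `|SumY Y N w| <= dom w by rewrite (le_trans _ (SumY_le_dom N w))// lerDr.
by rewrite lerXn2r ?nnegrE// (le_trans _ h).
Qed.

(** All factors are dominated by the sum of [|Y j|] over [N], so only a power of a single variable
    is integrated and no Hölder inequality enters. The summand 1 covers total order zero. *)
Lemma moment_le s k (N : {set I}) (b : R) : (size s + k <= p.+2)%N -> {subset s <= N} ->
  #|N|%:R <= b -> 1 <= b ->
  Ex P (fun w => `|Prod Y s w| * `|SumY Y N w| ^+ k) <=
  (1 + b ^+ p.+3 * K) * lam ^+ (size s + k).
Proof.
set r := (size s + k)%N => rp sN Nb b1.
pose G w : R := (r == 0)%:R + #|N|%:R ^+ r * \sum_(j <- enum N) `|Y j w| ^+ r.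
have iG : integ P G.
  apply: integD; first exact: integ_cst.
  by apply: integZ; apply: integ_sum => i; exact: (ld_int H).
have le w : `|Prod Y s w| * `|SumY Y N w| ^+ k <= G w.
  have := @sum_pow_le I N (fun i => `|Y i w|) r (fun i => normr_ge0 _).
  rewrite /G big_enum /=; apply: le_trans.
  rewrite /r exprD; apply: ler_pM => //.
    exact: Prod_le_sum.
  rewrite lerXn2r ?nnegrE ?sumr_ge0//; exact: ler_norm_sum.
apply: (@le_trans _ _ (E G)).
  by apply: Ex_le => //; exact: integ_moment.
have i1 : integ P (fun w => \sum_(j <- enum N) `|Y j w| ^+ r).
  by apply: integ_sum => i; exact: (ld_int H).
rewrite /G ExD; [|exact: integ_cst|exact: integZ].
rewrite Ex_cst ExZ// Ex_sum; last by move=> i; exact: (ld_int H).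
have K0 : 0 <= K by rewrite (le_trans _ (ld_K H)).
have lamr : 0 <= lam ^+ r by rewrite exprn_ge0// (ld_lam H).
rewrite mulrDl lerD//.
  by case: (eqVneq r 0) => [->|_]; rewrite ?expr0 ?mulr1// mul1r.
have b0 : 0 <= b by rewrite (le_trans _ b1).
apply: (@le_trans _ _ (#|N|%:R ^+ r * (#|N|%:R * (K * lam ^+ r)))).
  rewrite ler_wpM2l ?exprn_ge0//.
  apply: (@le_trans _ _ (\sum_(j <- enum N) (K * lam ^+ r))).
    by apply: ler_sum => j _; exact: (ld_mom H).
  by rewrite big_enum sumr_const mulr_natl.
rewrite !mulrA -exprSr ler_wpM2r// ler_wpM2r//.
apply: (@le_trans _ _ (b ^+ r.+1)); first by rewrite lerXn2r ?nnegrE.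
by rewrite ler_weXn2l.
Qed.

(* [L] behaves like [g |-> E (Z g(W))] for a product [Z] of [a] of the [Y i]. *)
Definition expansion (L : (nat -> R -> R) -> R) (a m : nat) (C : R) :=
  exists b : nat -> R, (forall k, (k <= m)%N -> `|b k| <= C * lam ^+ (a + k)) /\
  forall M g, jet m M g ->
    `|L g - \sum_(k < m.+1) b k * E (fun w => g k (W w))| <= C * M * lam ^+ (a + m).+1.

Implicit Types (L : (nat -> R -> R) -> R) (a m k : nat) (C D M : R).

Lemma expansion_ext L1 L2 a m C : (forall M g, jet m M g -> L1 g = L2 g) ->
  expansion L1 a m C -> expansion L2 a m C.
Proof.
move=> L12 [b [b1 b2]]; exists b; split=> // M g gj.
by rewrite -(L12 M g gj); exact: b2.
Qed.

Lemma expansion_weaken L a m C C' : C <= C' -> expansion L a m C -> expansion L a m C'.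
Proof.
move=> CC [b [b1 b2]]; have lam0 := ld_lam H; exists b; split=> [k km|M g gj].
  by rewrite (le_trans (b1 k km))// ler_wpM2r ?exprn_ge0.
rewrite (le_trans (b2 M g gj))// ler_wpM2r ?exprn_ge0// ler_wpM2r//.
exact: jet_ge0 gj.
Qed.

Lemma expansion_add L1 L2 a m C1 C2 : expansion L1 a m C1 -> expansion L2 a m C2 ->
  expansion (fun g => L1 g + L2 g) a m (C1 + C2).
Proof.
move=> [b [b1 b2]] [c [c1 c2]]; exists (fun k => b k + c k); split=> [k km|M g gj].
  by rewrite mulrDl (le_trans (ler_normD _ _))// lerD ?b1 ?c1.
under eq_bigr do rewrite mulrDl.
rewrite big_split/= opprD addrACA !mulrDl (le_trans (ler_normD _ _))//.
by rewrite lerD ?b2 ?c2.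
Qed.

Lemma expansion_scale L a m C c D e : 0 <= D -> `|c| <= D * lam ^+ e ->
  expansion L a m C -> expansion (fun g => c * L g) (e + a) m (D * C).
Proof.
move=> D0 cD [b [b1 b2]]; exists (fun k => c * b k); split=> [k km|M g gj].
  rewrite normrM -addnA exprD mulrACA.
  by rewrite ler_pM// b1.
under eq_bigr do rewrite -mulrA.
rewrite -mulr_sumr -mulrBr normrM -addnA -addnS exprD.
have -> : D * C * M * (lam ^+ e * lam ^+ (a + m).+1) =
  (D * lam ^+ e) * (C * M * lam ^+ (a + m).+1) by ring.
by rewrite ler_pM// b2.
Qed.

Lemma expansion_zero a m C : 0 <= C -> expansion (fun=> 0) a m C.
Proof.
move=> C0; have lam0 := ld_lam H; exists (fun=> 0); split=> [k km|M g gj].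
  by rewrite normr0 mulr_ge0 ?exprn_ge0.
rewrite big1 ?subrr ?normr0; last by move=> k _; rewrite mul0r.
by rewrite !mulr_ge0 ?exprn_ge0// (jet_ge0 gj).
Qed.

Lemma expansion_sum (T : Type) (s : seq T) (L : T -> (nat -> R -> R) -> R) a m C :
  0 <= C -> (forall i, expansion (L i) a m C) ->
  expansion (fun g => \sum_(i <- s) L i g) a m ((size s)%:R * C).
Proof.
move=> C0 HL; elim: s => [|i s IH].
  apply: expansion_ext (expansion_zero _ _ _); last by rewrite mul0r.
  by move=> M g _; rewrite big_nil.
rewrite /= -natr1 addrC mulrDl mul1r.
apply: expansion_ext (expansion_add (HL i) IH).
by move=> M g _; rewrite big_cons.
Qed.

(** Derivatives are exchanged for powers of [lam]: acting on the [j]-th derivative costs [j] orders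
    of the expansion, which the size [lam^(a + j)] of the functional gives back. *)
Lemma expansion_shift L a m C j : (j <= m)%N -> 0 <= C ->
  expansion L (a + j) (m - j) C ->
  expansion (fun g => L (fun k => g (j + k)%N)) a m C.
Proof.
move=> jm C0 [b [b1 b2]]; have lam0 := ld_lam H.
exists (fun k => if (k < j)%N then 0 else b (k - j)%N); split=> [k km|M g gj].
  case: ltnP => kj; first by rewrite normr0 mulr_ge0 ?exprn_ge0.
  by rewrite (le_trans (b1 _ (leq_sub2r j km)))// -addnA subnKC.
have gj' : jet (m - j) M (fun k => g (j + k)%N).
  by apply: jet_shift; rewrite subnKC.
have := b2 M _ gj'; rewrite -addnA (subnKC jm).
congr (`| _ - _ | <= _).
rewrite -(big_mkord predT (fun k => b k * E (fun w => g (j + k)%N (W w)))).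
rewrite -(big_mkord predT (fun k => (if (k < j)%N then 0 else b (k - j)%N) * E (fun w => g k (W w)))).
rewrite [RHS](@big_cat_nat _ _ _ j)/= ?leqW//.
rewrite [X in _ = X + _](_ : _ = 0) ?add0r; last first.
  rewrite big_nat_cond big1// => k /andP[/andP[_ kj] _].
  by rewrite kj mul0r.
rewrite -[X in _ = \sum_(X <= _ < _) _](add0n j) big_addn subSn//.
apply: eq_bigr => k _; rewrite ltnNge leq_addl /= addnK addnC//.
Qed.

Lemma expansion_rem L a m C : 0 <= C ->
  (forall M g, jet m M g -> `|L g| <= C * M * lam ^+ (a + m).+1) ->
  expansion L a m C.
Proof.
move=> C0 HL; have lam0 := ld_lam H; exists (fun=> 0); split=> [k km|M g gj].
  by rewrite normr0 mulr_ge0 ?exprn_ge0.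
by rewrite big1 ?subr0 ?HL// => k _; rewrite mul0r.
Qed.

Lemma expansion_id m : expansion (fun g => E (fun w => g 0%N (W w))) 0 m 1.
Proof.
have lam0 := ld_lam H; exists (fun k => (k == 0)%:R); split=> [k km|M g gj].
  case: (eqVneq k 0) => [->|k0] /=; first by rewrite normr1 addn0 expr0 mulr1.
  by rewrite normr0 mulr_ge0 ?exprn_ge0.
rewrite big_ord_recl /= !mul1r big1 ?addr0 ?subrr ?normr0.
  by rewrite mulr_ge0 ?exprn_ge0// (jet_ge0 gj).
by move=> k _; rewrite mul0r.
Qed.

Definition Lam s (N : {set I}) k (g : nat -> R -> R) :=
  E (fun w => Prod Y s w * SumY Y N w ^+ k * g 0%N (W w)).

(** Opening the [k]-th power of the local sum yields at most [b^k] products of [size s + k] factors,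
    each covered by the hypothesis. *)
Lemma expansion_sum_pow s (N : {set I}) k m (C b : R) : (size s + k + m.+1 <= p.+2)%N ->
  0 <= C -> 1 <= b -> #|N|%:R <= b ->
  (forall s', size s' = (size s + k)%N -> expansion (Lam s' (finset.setTfor I) 0) (size s + k) m C) ->
  expansion (Lam s N k) (size s + k) m (b ^+ k * C).
Proof.
move=> + C0 b1 Nb; elim: k s => [|k IH] s le Hs.
  rewrite expr0 mul1r; apply: expansion_ext (Hs s _); last by rewrite addn0.
  by move=> M g gj; rewrite /Lam; congr Ex; apply/funext => w; rewrite !expr0.
have Hj j : expansion (Lam (j :: s) N k) (size s + k.+1) m (b ^+ k * C).
  have := IH (j :: s); rewrite /= addSnnS; apply => //.
apply: (@expansion_weaken _ _ _ (#|N|%:R * (b ^+ k * C))).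
  by rewrite exprS -mulrA ler_wpM2r// mulr_ge0// exprn_ge0// (le_trans _ b1).
have := @expansion_sum _ (enum N) (fun j => Lam (j :: s) N k) (size s + k.+1) m (b ^+ k * C).
rewrite -cardE => /(_ _ Hj)/wrap[].
  by rewrite mulr_ge0// exprn_ge0// (le_trans _ b1).
apply: expansion_ext => M g gj; rewrite /Lam -Ex_sum; last first.
  move=> j; have := @integ_monomial m M g (j :: s) N (finset.setTfor I) k 0 gj isT.
  by rewrite /= subn0 addSnnS; apply.
congr Ex; apply/funext => w.
rewrite exprS [X in _ * (X * _)](_ : _ = \sum_(j <- enum N) Y j w); last by rewrite big_enum.
rewrite mulr_suml mulr_sumr mulr_suml.
by apply: eq_bigr => j _; rewrite /Prod big_cons; ring.
Qed.

Lemma SumY_setC N w : W w = SumY Y (~: N) w + SumY Y N w.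
Proof.
rewrite /SumY addrC (bigID (mem N))/=; congr (_ + _); apply: eq_bigl => i.
  by rewrite inE.
by rewrite inE/= inE.
Qed.

Let sgn k : R := (-1) ^+ k / k`!%:R.

(** Write [Y_s] for the product, [S_N] for the sum over its neighbourhood and [V = W - S_N], so that
    [E[Y_s g(V)] = E[Y_s] E[g(V)]]. Both sides are evaluated by Taylor's formula with base point
    [W], so that every term is again a functional of [W]. The terms of index 0 are [E[Y_s g(W)]] and
    [E[Y_s] E[g(W)]]; a term of index [k >= 1] has [k] more factors and [k] fewer derivatives, which
    the induction hypothesis handles. *)
Lemma expansion_step m s (C b : R) : (size s + m.+1 <= p.+2)%N -> 0 <= C ->
  1 <= b -> (size s * B)%:R <= b ->
  (forall m' s', (m' < m)%N -> (size s' + m'.+1 <= p.+2)%N ->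
     expansion (Lam s' (finset.setTfor I) 0) (size s') m' C) ->
  let D := 1 + b ^+ p.+3 * K in
  expansion (Lam s (finset.setTfor I) 0) (size s) m
    (D + (m%:R * (b ^+ m * C + D * (b ^+ m * C)) + (D + D * D))).
Proof.
move=> le C0 b1 sb IH D; set N := Nbh nb s.
have lam0 := ld_lam H.
have K0 : 0 <= K by rewrite (le_trans _ (ld_K H)).
have b0 : 0 <= b by rewrite (le_trans _ b1).
have D0 : 0 <= D by rewrite /D addr_ge0// mulr_ge0// exprn_ge0.
have Nb : #|N|%:R <= b by rewrite (le_trans _ sb)// ler_nat (card_Nbh s).
have sp : (size s <= p.+2)%N by rewrite (leq_trans _ le)// leq_addr.
have iPi : integ P (Prod Y s) by exact: integ_Prod.
pose EP := E (Prod Y s).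
have EPD : `|EP| <= D * lam ^+ size s.
  have := @moment_le s 0 N b; rewrite addn0 => /(_ sp (@sub_Nbh s) Nb b1); apply: le_trans.
  apply: Ex_norm_le; first exact: measurable_Prod.
    apply: eq_integrable (integ_norm iPi) => // w _ /=; rewrite expr0 mulr1//.
  by move=> w; rewrite expr0 mulr1.
have bC k : (k <= m)%N -> b ^+ k * C <= b ^+ m * C.
  by move=> km; rewrite ler_wpM2r// ler_weXn2l.
have bC0 : 0 <= b ^+ m * C by rewrite mulr_ge0// exprn_ge0.
have exp1 k : (0 < k <= m)%N ->
    expansion (fun g => Lam s N k (fun j => g (k + j)%N)) (size s) m (b ^+ m * C).
  move=> /andP[k0 km].
  apply: expansion_shift => //; apply: (expansion_weaken (bC k km)).
  apply: expansion_sum_pow => //.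
    by rewrite -addnA addnS subnKC// le.
  move=> s' s'E; rewrite -s'E; apply: IH.
    by rewrite ltn_subrL k0 (leq_trans k0 km).
  by rewrite s'E -addnA addnS subnKC.
have exp2 k : (0 < k <= m)%N ->
    expansion (fun g => Lam [::] N k (fun j => g (k + j)%N)) 0 m (b ^+ m * C).
  move=> /andP[k0 km].
  apply: expansion_shift => //; apply: (expansion_weaken (bC k km)).
  have le' : (k + (m - k).+1 <= p.+2)%N.
    by rewrite addnS subnKC// (leq_trans _ le)// leq_addl.
  apply: (@expansion_sum_pow [::] N k (m - k) C b) => //.
  move=> s' s'E; rewrite -s'E; apply: IH.
    by rewrite ltn_subrL k0 (leq_trans k0 km).
  by rewrite s'E.
have sgn1 k : `|sgn k| <= 1.
  rewrite normrM normrX normrN1 expr1n mul1r ger0_norm ?invr_ge0//.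
  by rewrite invf_le1 ?ltr0n ?fact_gt0// ler1n fact_gt0.
(* Taylor term of index [i + 1] of the rearranged identity: the first part comes from [E[Y_s g(V)]],
   the second from [E[Y_s] E[g(V)]]. *)
pose T1 (i : 'I_m) (g : nat -> R -> R) := - sgn i.+1 * Lam s N i.+1 (fun j => g (i.+1 + j)%N)
  + (sgn i.+1 * EP) * Lam [::] N i.+1 (fun j => g (i.+1 + j)%N).
have expT (i : 'I_m) : expansion (T1 i) (size s) m (b ^+ m * C + D * (b ^+ m * C)).
  apply: expansion_add.
    rewrite -[X in expansion _ _ _ X]mul1r -[X in expansion _ X](add0n (size s)).
    by apply: expansion_scale; [|rewrite expr0 mulr1 normrN|apply: exp1; rewrite ltn_ord].
  rewrite -[X in expansion _ X](addn0 (size s)).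
  apply: expansion_scale => //; last by apply: exp2; rewrite ltn_ord.
  by rewrite normrM -[leRHS]mul1r ler_pM.
have expS := expansion_sum (enum 'I_m) (addr_ge0 bC0 (mulr_ge0 D0 bC0)) expT.
rewrite size_enum_ord in expS.
pose A0 (g : nat -> R -> R) := EP * E (fun w => g 0%N (W w)).
have expA : expansion A0 (size s) m D.
  rewrite -[D]mulr1 -[X in expansion _ X](addn0 (size s)).
  by apply: expansion_scale => //; exact: expansion_id.
(* Defined by subtraction, then identified with [E[Y_s] E[tau] - E[Y_s tau]] for the Taylor error
   [tau]; both products have total order [size s + m + 1] in [lam]. *)
pose Rem g := Lam s (finset.setTfor I) 0 g - A0 g - \sum_(i <- enum 'I_m) T1 i g.
have expR : expansion Rem (size s) m (D + D * D).
  apply: expansion_rem; first by rewrite addr_ge0// mulr_ge0.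
  move=> M g gj; have M0 := jet_ge0 gj.
  pose tau w := g 0%N (SumY Y (~: N) w) -
     \sum_(k <- index_enum 'I_m.+1) g k (W w) * ((- SumY Y N w) ^+ k / k`!%:R).
  have tauM w : `|tau w| <= M * `|SumY Y N w| ^+ m.+1.
    have := taylor (W w) (- SumY Y N w) gj; rewrite normrN; apply: le_trans.
    by have -> : W w - SumY Y N w = SumY Y (~: N) w by rewrite (SumY_setC N w) addrK.
  have tauE w : tau w = g 0%N (SumY Y (~: N) w) -
     \sum_(k <- index_enum 'I_m.+1) sgn k * (SumY Y N w ^+ k * g k (W w)).
    congr (_ - _); apply: eq_bigr => k _.
    by rewrite (exprNn (SumY Y N w)) /sgn; ring.
  have iM s' k : (size s' <= size s)%N -> (k <= m)%N ->
      integ P (fun w => Prod Y s' w * SumY Y N w ^+ k * g k (W w)).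
    move=> ss km; have le2 : (size s' + k + (m - k).+1 <= p.+2)%N.
      by rewrite -addnA addnS subnKC// (leq_trans _ le)// leq_add2r.
    exact: (integ_monomial _ _ gj km le2).
  have iPV : integ P (fun w => Prod Y s w * g 0%N (SumY Y (~: N) w)).
    have := @integ_monomial m M g s N (~: N) 0 0 gj isT.
    rewrite addn0 subn0 => /(_ le).
    by congr integ; apply/funext => w; rewrite expr0 mulr1.
  have iV : integ P (fun w => g 0%N (SumY Y (~: N) w)).
    by apply: integ_comp_SumY gj _; rewrite (leq_trans _ le)// leq_addl.
  have mlt (k : 'I_m.+1) : (k <= m)%N by rewrite -ltnS.
  have iSk s' : (size s' <= size s)%N -> forall k : 'I_m.+1,
      integ P (fun w => sgn k * (Prod Y s' w * SumY Y N w ^+ k * g k (W w))).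
    by move=> ss k; apply: integZ; exact: iM.
  have Etau s' : (size s' <= size s)%N -> integ P (fun w => Prod Y s' w * g 0%N (SumY Y (~: N) w)) ->
    E (fun w => Prod Y s' w * tau w) = E (fun w => Prod Y s' w * g 0%N (SumY Y (~: N) w)) -
      \sum_(k <- index_enum 'I_m.+1) sgn k * Lam s' N k (fun j => g (k + j)%N).
    move=> ss i0.
    rewrite (_ : (fun w => Prod Y s' w * tau w) = (fun w => Prod Y s' w * g 0%N (SumY Y (~: N) w) -
       \sum_(k <- index_enum 'I_m.+1) sgn k * (Prod Y s' w * SumY Y N w ^+ k * g k (W w)))); last first.
      apply/funext => w; rewrite tauE mulrBr mulr_sumr; congr (_ - _).
      by apply: eq_bigr => k _; ring.
    rewrite ExB//; last by apply: integ_sum; exact: iSk.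
    rewrite Ex_sum; last exact: iSk.
    congr (_ - _); apply: eq_bigr => k _.
    by rewrite ExZ ?/Lam ?addn0//; exact: iM.
  have E1 := Etau s (leqnn _) iPV.
  have E0 := Etau [::] isT.
  have P0 : Prod Y [::] = cst 1 by apply/funext => w; rewrite /Prod big_nil.
  rewrite P0 in E0.
  have mul1f (f : Om -> R) : (fun w => cst 1 w * f w) = f by apply/funext => w; rewrite mul1r.
  rewrite !mul1f in E0.
  have {}E0 := E0 iV.
  have HI := ld_indep H (_ : (size s <= p.+1)%N) (jet_continuous gj (leq0n _)) iPi iV.
  rewrite HI in E1; last by rewrite -ltnS (leq_trans _ le)// addnS ltnS leq_addr.
  have -> : Rem g = EP * E tau - E (fun w => Prod Y s w * tau w).
    rewrite E1 E0 /Rem /A0 -/EP.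
    rewrite !big_ord_recl big_enum/=.
    rewrite /sgn !expr0 fact0 divr1 !mul1r.
    have -> : Lam s N 0 (fun j => g (0 + j)%N) = Lam s (finset.setTfor I) 0 g.
      by congr Ex; apply/funext => w; rewrite !expr0.
    have -> : Lam [::] N 0 (fun j => g (0 + j)%N) = E (fun w => g 0%N (W w)).
      by congr Ex; apply/funext => w; rewrite expr0 P0 !mul1r.
    rewrite /T1 big_split/= -!/(sgn _).
    have -> : \sum_(i < m) - sgn i.+1 * Lam s N i.+1 (fun j => g (i.+1 + j)%N) =
      - \sum_(i < m) sgn (lift ord0 i) * Lam s N (lift ord0 i) (fun j => g (lift ord0 i + j)%N).
      by rewrite -sumrN; apply: eq_bigr => i _; rewrite mulNr.
    have -> : \sum_(i < m) sgn i.+1 * EP * Lam [::] N i.+1 (fun j => g (i.+1 + j)%N) =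
      EP * \sum_(i < m) sgn (lift ord0 i) * Lam [::] N (lift ord0 i) (fun j => g (lift ord0 i + j)%N).
      by rewrite mulr_sumr; apply: eq_bigr => i _; rewrite mulrCA mulrA.
    ring.
  have mtau : measurable_fun setT tau.
    apply: measurable_funB.
      apply: measurableT_comp; last exact: measurable_SumY.
      by apply: continuous_measurable; exact: jet_continuous gj _.
    apply: measurable_sum => k; apply: measurable_funM.
      apply: measurableT_comp; last exact: measurable_SumY.
      by apply: continuous_measurable; exact: jet_continuous gj (mlt k).
    apply: measurable_funM => //; apply: measurable_funX.
    by apply: measurableT_comp => //; exact: measurable_SumY.
  have bnd s' : (size s' <= size s)%N -> {subset s' <= N} ->
      `|E (fun w => Prod Y s' w * tau w)| <= D * M * lam ^+ (size s' + m).+1.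
    move=> ss s'N.
    have le' : (size s' + m.+1 <= p.+2)%N by rewrite (leq_trans _ le)// leq_add2r.
    have im := integ_moment N le'.
    apply: (@le_trans _ _ (E (fun w => M * (`|Prod Y s' w| * `|SumY Y N w| ^+ m.+1)))).
      apply: Ex_norm_le.
      - apply: measurable_funM => //; exact: measurable_Prod.
      - exact: integZ.
      - by move=> w; rewrite normrM mulrCA ler_wpM2l.
    rewrite ExZ// mulrAC (mulrC M) ler_wpM2r// -addnS.
    exact: moment_le.
  have B1 := bnd s (leqnn _) (@sub_Nbh s).
  have nilN : {subset ([::] : seq I) <= N} by [].
  have B0 := bnd [::] isT nilN.
  rewrite P0 mul1f in B0.
  apply: le_trans (ler_normB _ _) _.
  rewrite addrC 2!mulrDl lerD// normrM.
  apply: le_trans (ler_pM _ _ EPD B0) _ => //.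
  by rewrite add0n -addnS exprD; lra.
have := expansion_add expA (expansion_add expS expR).
by apply: expansion_ext => M g gj; rewrite /Rem; ring.
Qed.

End context.
End local_dependence.

(** * Expansion of [E[W f(W)]] with uniform constants *)

Section stein_expansion.
Variable R : realType.

(** Strong induction on the number of derivatives. The constant precedes the probability space and
    the field, so it will not depend on [n]. *)
Lemma expansion_uniform (p B : nat) (K : R) m : exists2 C : R, 0 <= C &
  forall d (Om : measurableType d) (P : probability Om R) (I : finType)
    (Y : I -> Om -> R) (nb : I -> {set I}) (lam : R),
  local_dep P Y nb p B K lam ->
  forall m' s, (m' < m)%N -> (size s + m'.+1 <= p.+2)%N ->
  expansion P Y lam (Lam P Y s (finset.setTfor I) 0) (size s) m' C.
Proof.
elim: m => [|m [C C0 IH]]; first by exists 0.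
pose b : R := 1 + (p.+2 * B)%:R.
pose D := 1 + b ^+ p.+3 * K.
pose C' := D + (m%:R * (b ^+ m * C + D * (b ^+ m * C)) + (D + D * D)).
exists (C + `|C'|); first by rewrite addr_ge0.
move=> d Om P I Y nb lam H m' s; rewrite ltnS leq_eqVlt => /predU1P[->|mm] le; last first.
  apply: (expansion_weaken H) (IH _ _ _ _ _ _ _ H _ _ mm le).
  by rewrite lerDl.
have b1 : 1 <= b by rewrite /b lerDl.
have sb : (size s * B)%:R <= b.
  rewrite /b (le_trans (_ : _ <= (p.+2 * B)%:R)) ?lerDr// ler_nat leq_mul2r.
  by rewrite (leq_trans _ le) ?leq_addr// orbT.
have := expansion_step H le C0 b1 sb (IH _ _ _ _ _ _ _ H).
apply: (expansion_weaken H).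
by apply: le_trans (ler_norm _) _; rewrite -/D -/C' lerDr.
Qed.

(* What the proof of the Edgeworth expansion needs to know about [W]; the
   coefficients [c] play the role of rescaled cumulants. *)
Record stein_approx d (Om : measurableType d) (P : probability Om R)
    (W : Om -> R) (p : nat) (C lam : R) : Prop := SteinApprox {
  sa_meas : measurable_fun setT W;
  sa_C : 0 <= C;
  sa_lam : 0 <= lam <= 1;
  sa_int : forall m M g, jet m M g -> (m <= p)%N -> integ P (fun w => g 0%N (W w));
  sa_intM : forall m M g, jet m M g -> (m <= p)%N -> integ P (fun w => W w * g 0%N (W w));
  sa_exp : forall q, (0 < q <= p)%N -> exists c : nat -> R,
    [/\ c 0%N = 0, c 1%N = 1, (forall k, (0 < k <= q)%N -> `|c k| <= C * lam ^+ k.-1) &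
    forall M f, jet q M f ->
      `|Ex P (fun w => W w * f 0%N (W w)) - \sum_(k < q.+1) c k * Ex P (fun w => f k (W w))|
      <= C * M * lam ^+ q] }.

Lemma stein_approx_local_dep (p B : nat) (K A : R) : 0 <= A -> exists2 C : R, 0 <= C &
  forall d (Om : measurableType d) (P : probability Om R) (I : finType)
    (Y : I -> Om -> R) (nb : I -> {set I}) (lam : R),
  local_dep P Y nb p B K lam -> (0 < lam)%R -> lam <= 1 -> #|I|%:R * lam ^+ 2 <= A ->
  Ex P (SumY Y (finset.setTfor I)) = 0 ->
  Ex P (fun w => SumY Y (finset.setTfor I) w ^+ 2) = 1 ->
  stein_approx P (SumY Y (finset.setTfor I)) p C lam.
Proof.
move=> A0; have [C C0 HC] := expansion_uniform p B K p.+1.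
exists (C * A) => [|d Om P I Y nb lam H lam0 lam1 IA E1 E2]; first exact: mulr_ge0.
set W := SumY Y _.
have cont := jet_continuous.
have i1 m M g : jet m M g -> (m <= p)%N -> integ P (fun w => g 0%N (W w)).
  by move=> gj mp; apply: (integ_comp_SumY H _ gj); rewrite !ltnS leqW.
have iL m M g i : jet m M g -> (m <= p)%N -> integ P (fun w => Y i w * g 0%N (W w)).
  move=> gj mp; have := @integ_monomial R _ _ _ _ _ _ _ _ _ _ H m M g [:: i] (finset.setTfor I) (finset.setTfor I) 0 0 gj isT.
  rewrite /= addn0 subn0 add1n !ltnS => /(_ mp).
  by congr integ; apply/funext => w; rewrite /Prod big_seq1 expr0 mulr1.
have WE (w : Om) (x : R) : W w * x = \sum_(i <- index_enum I) Y i w * x.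
  by rewrite /W /SumY mulr_suml; apply: eq_bigl => i; rewrite inE.
have i2 m M g : jet m M g -> (m <= p)%N -> integ P (fun w => W w * g 0%N (W w)).
  move=> gj mp; under eq_fun do rewrite WE.
  by apply: integ_sum => i; exact: iL gj mp.
split => //.
- exact: (measurable_SumY H).
- exact: mulr_ge0.
- by rewrite lam1 (ltW lam0).
move=> q /andP[q0 qp].
(* A single site contributes a coefficient [O(lam^(k+1))] at order [k]; summed over [O(lam^-2)]
   sites this becomes [O(lam^(k-1))] for [k >= 1]. *)
have expS : expansion P Y lam (fun g => \sum_(i <- enum I) Lam P Y [:: i] (finset.setTfor I) 0 g) 1 q (#|I|%:R * C).
  rewrite cardE; apply: (expansion_sum H) => // i.
  by apply: (HC _ _ _ _ _ _ _ H q [:: i]); rewrite /= ?add1n !ltnS.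
have LE M f : jet q M f -> \sum_(i <- enum I) Lam P Y [:: i] (finset.setTfor I) 0 f =
    Ex P (fun w => W w * f 0%N (W w)).
  move=> fj; rewrite /Lam -Ex_sum; last first.
    move=> i; have := iL q M f i fj qp.
    by congr integ; apply/funext => w; rewrite /Prod big_seq1 expr0 mulr1.
  congr Ex; apply/funext => w; rewrite WE big_enum; apply: eq_bigr => i _.
  by rewrite /Prod big_seq1 expr0 mulr1.
have [c [c1 c2]] := expS; exists c.
have c3 M f : jet q M f ->
    `|Ex P (fun w => W w * f 0%N (W w)) - \sum_(k < q.+1) c k * Ex P (fun w => f k (W w))|
      <= #|I|%:R * C * M * lam ^+ q.+2.
  by move=> fj; rewrite -(LE M f fj); exact: c2.
have Af k : #|I|%:R * C * lam ^+ k.+2 <= C * A * lam ^+ k.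
  have -> : #|I|%:R * C * lam ^+ k.+2 = (#|I|%:R * lam ^+ 2) * (C * lam ^+ k).
    by rewrite -addn2 exprD; ring.
  have Ck : 0 <= C * lam ^+ k by rewrite mulr_ge0// exprn_ge0// ltW.
  rewrite (_ : C * A * lam ^+ k = A * (C * lam ^+ k)); last by ring.
  exact: ler_wpM2r.
have c00 : c 0%N = 0.
  (* The constant function 1 is a jet with Lipschitz constant 0, so the remainder vanishes and [c 0]
     is the mean of [W]. *)
  pose f : nat -> R -> R := fun k => if k is 0 then cst 1 else cst 0.
  have fj : jet q 0 f.
    split=> [[|k] x _|x y]; [exact: is_derive_cst|exact: is_derive_cst|].
    by case: q {q0 qp expS LE c1 c2 c3} => [|q]; rewrite subrr normr0 mul0r.
  have := c3 0 f fj; rewrite mulr0 mul0r normr_le0 big_ord_recl /= big1; last first.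
    by move=> i _; rewrite Ex_cst mulr0.
  rewrite Ex_cst mulr1 addr0; under [X in Ex _ X]eq_fun do rewrite mulr1.
  by rewrite E1 sub0r oppr_eq0 => /eqP.
split=> //.
(* The identity likewise has no remainder as soon as [q >= 1], and identifies [c 1] with the second
   moment. *)
- pose f : nat -> R -> R := fun k => match k with 0 => id | 1 => cst 1 | _ => cst 0 end.
  have fj : jet q 0 f.
    split=> [[|[|k]] x _|x y]; [exact: is_derive_id|exact: is_derive_cst|exact: is_derive_cst|].
    by case: q q0 {qp expS LE c1 c2 c3} => [//|[|q]] _; rewrite subrr normr0 mul0r.
  have := c3 0 f fj; rewrite mulr0 mul0r normr_le0 big_ord_recl c00 mul0r add0r.
  case: q q0 {qp expS LE c1 c2 c3 fj} => [//|q] _; rewrite big_ord_recl /= big1; last first.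
    by move=> i _; rewrite Ex_cst mulr0.
  rewrite Ex_cst mulr1 addr0.
  have -> : (fun w => W w * W w) = (fun w => W w ^+ 2) by apply/funext => w; rewrite expr2.
  by rewrite E2 subr_eq0 => /eqP.
- move=> k /andP[k0 kq]; rewrite (le_trans (c1 k kq))//.
  by rewrite -(prednK k0) add1n; exact: Af.
- move=> M f fj; rewrite (le_trans (c3 M f fj))// mulrAC [leRHS]mulrAC ler_wpM2r//.
  exact: jet_ge0 fj.
Qed.

End stein_expansion.

(** * Edgeworth expansion *)

Section edgeworth.
Variable R : realType.
Local Notation gam := (@std_normal R).

(** The sum starts at index 1, so that [1 + Q] always has Gaussian mean 1. Only the size of the
    coefficients is recorded, because only its order in [lam] matters. *)
Definition hermite_comb (N : nat) (A : R) (Q : R -> R) := exists e : nat -> R,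
  (forall j, `|e j| <= A) /\ Q = (fun x => \sum_(j < N) e j * hermite j.+1 x).

Lemma hermite_comb_widen N N' A A' Q : (N <= N')%N -> 0 <= A <= A' ->
  hermite_comb N A Q -> hermite_comb N' A' Q.
Proof.
move=> NN /andP[A0 AA] [e [e1 ->]]; exists (fun j => if (j < N)%N then e j else 0); split.
  by move=> j; case: ifP => _; rewrite ?normr0 ?(le_trans (e1 j))// (le_trans A0).
apply/funext => x.
rewrite (big_ord_widen N' (fun j => e j * hermite j.+1 x))// big_mkcond.
by apply: eq_bigr => j _; case: ifP => // _; rewrite mul0r.
Qed.

Lemma hermite_comb_add N A1 A2 Q1 Q2 : hermite_comb N A1 Q1 -> hermite_comb N A2 Q2 ->
  hermite_comb N (A1 + A2) (fun x => Q1 x + Q2 x).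
Proof.
move=> [e [e1 ->]] [f [f1 ->]]; exists (fun j => e j + f j); split.
  by move=> j; rewrite (le_trans (ler_normD _ _))// lerD.
apply/funext => x; rewrite -big_split/=.
by apply: eq_bigr => j _; rewrite mulrDl.
Qed.

Lemma hermite_comb_scale N A c Q : hermite_comb N A Q ->
  hermite_comb N (`|c| * A) (fun x => c * Q x).
Proof.
move=> [e [e1 ->]]; exists (fun j => c * e j); split.
  by move=> j; rewrite normrM ler_wpM2l.
by apply/funext => x; rewrite mulr_sumr; apply: eq_bigr => j _; rewrite mulrA.
Qed.

Lemma hermite_comb0 N A : 0 <= A -> hermite_comb N A (fun=> 0).
Proof.
move=> A0; exists (fun=> 0); split; first by move=> j; rewrite normr0.
by apply/funext => x; rewrite big1// => j _; rewrite mul0r.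
Qed.

Lemma hermite_comb1 N j : (j < N)%N -> hermite_comb N 1 (@hermite R j.+1).
Proof.
move=> jN; exists (fun k => (k == j)%:R); split.
  by move=> k; case: eqP => _ /=; rewrite ?normr1 ?normr0.
apply/funext => x; rewrite (bigD1 (Ordinal jN))//= eqxx mul1r big1 ?addr0//.
by move=> k kj; rewrite (_ : (k == j :> nat) = false) ?mul0r//; apply/negbTE.
Qed.

Lemma hermite_comb_sum n N A (F : 'I_n -> R -> R) : 0 <= A ->
  (forall i, hermite_comb N A (F i)) ->
  hermite_comb N (n%:R * A) (fun x => \sum_(i < n) F i x).
Proof.
move=> A0; elim: n F => [|n IH] F HF.
  by under eq_fun do rewrite big_ord0; rewrite mul0r; exact: hermite_comb0.
under eq_fun do rewrite big_ord_recr.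
rewrite -natr1 mulrDl mul1r; apply: hermite_comb_add; last exact: HF.
exact: IH.
Qed.

Lemma continuous_hermite_comb N A Q : hermite_comb N A Q -> continuous Q.
Proof.
move=> [e [_ ->]]; apply: (@is_derive_continuous _ _ (fun x => \sum_(j < N) e j * (j.+1%:R * hermite j x))) => x.
by apply: is_derive_bigsum => j; apply: is_derive_scale; exact: is_derive_hermite.
Qed.

Lemma hermite_comb_bound N : exists (C : R) (m : nat), 0 <= C /\ forall A Q, hermite_comb N A Q ->
  forall x, `|Q x| <= C * A * (1 + `|x|) ^+ m.
Proof.
have : polybd (fun x : R => \sum_(j < N) `|hermite j.+1 x|).
  by apply: polybd_sum => j; apply: polybd_norm; exact: polybd_hermite.
move=> [C [m [C0 HC]]]; exists C, m; split=> // A Q [e [e1 ->]] x.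
have A0 : 0 <= A by exact: le_trans (e1 0%N).
rewrite mulrAC -mulrC (le_trans (ler_norm_sum _ _ _))//.
apply: (@le_trans _ _ (A * \sum_(j < N) `|hermite j.+1 x|)).
  by rewrite mulr_sumr ler_sum// => j _; rewrite normrM ler_wpM2r.
by rewrite ler_wpM2l// (le_trans (ler_norm _)).
Qed.

Lemma polybd_hermite_comb N A Q : hermite_comb N A Q -> polybd Q.
Proof.
move=> HQ; have [C [m [C0 HC]]] := hermite_comb_bound N.
have A0 : 0 <= A by case: HQ => e [e1 _]; exact: le_trans (e1 0%N).
by exists (C * A), m; split; [exact: mulr_ge0|exact: HC HQ].
Qed.

Lemma Ex_hermite_comb N A Q : hermite_comb N A Q -> Ex gam Q = 0.
Proof.
move=> [e [_ ->]]; rewrite Ex_sum.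
  by rewrite big1// => j _; rewrite ExZ ?Ex_hermite ?mulr0//;
    exact: gauss_integ (continuous_measurable (@continuous_hermite _ _)) (polybd_hermite _ _).
by move=> j; apply: integZ;
  exact: gauss_integ (continuous_measurable (@continuous_hermite _ _)) (polybd_hermite _ _).
Qed.

Lemma gauss_jet_integ (g u : R -> R) : continuous g -> polybd g -> continuous u -> polybd u ->
  integ gam (fun x => g x * u x).
Proof.
move=> gc gp uc up; apply: gauss_integ; last exact: polybd_mul.
by apply: continuous_measurable => x; apply: cvgM; [exact: gc|exact: uc].
Qed.

Lemma gauss_jet_hermite q M f k m : jet q M f -> (k <= q)%N ->
  Ex gam (fun x => f k x * hermite m x) = Ex gam (fun x => f 0%N x * hermite (m + k) x).
Proof.
move=> fj; elim: k m => [|k IH] m kq; first by rewrite addn0.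
have fd (x : R) : is_derive x 1 (f k) (f k.+1 x) by exact: fj.1.
rewrite (gauss_ibp_hermite m fd (jet_continuous fj kq) (jet_polybd fj (ltnW kq)) (jet_polybd fj kq)).
by rewrite IH ?(ltnW kq)// addSnnS.
Qed.

(** [E[f^(k) H_m] = E[f H_(m+k)] = - E[h H_(m+k+1)] / (m+k+1)], by integration by parts and
    [stein_hermite]. Nothing on the right involves [f], so [Q'] depends on [k] and [Q] only. *)
Lemma stein_correction q k N (A : R) Q : (0 < k <= q.+1)%N -> 0 <= A ->
  hermite_comb N A Q ->
  exists Q', hermite_comb (N + q.+3) (1 + N%:R * A) Q' /\
    forall M M' f h, jet q.+1 M f -> jet q M' h ->
    (forall x, f 1%N x - x * f 0%N x = h 0%N x - Ex gam (h 0%N)) ->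
    Ex gam (fun x => f k x * (1 + Q x)) = - Ex gam (fun x => h 0%N x * Q' x).
Proof.
move=> /andP[k0 kq] A0 [e [e1 QE]].
pose Q' x := k.+1%:R^-1 * hermite k.+1 x +
  \sum_(j < N) (e j * (j.+1 + k).+1%:R^-1) * hermite (j.+1 + k).+1 x.
have inv1 n : `|(n.+1%:R : R)^-1| <= 1.
  by rewrite ger0_norm ?invr_ge0// invf_le1// ler1n.
exists Q'; split.
  apply: hermite_comb_add.
    have kN : (k < N + q.+3)%N by rewrite ltn_addl// ltnS ltnW.
    apply: (@hermite_comb_widen (N + q.+3) _ (`|k.+1%:R^-1| * 1)) => //; last exact/hermite_comb_scale/hermite_comb1.
    by rewrite mulr1 normr_ge0 inv1.
  apply: hermite_comb_sum => // j.
  have jN : (j.+1 + k < N + q.+3)%N.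
    by rewrite -addnS; apply: leq_add => //; rewrite ltnS ltnW.
  apply: (@hermite_comb_widen (N + q.+3) _ (`|e j * (j.+1 + k).+1%:R^-1| * 1)) => //; last exact/hermite_comb_scale/hermite_comb1.
  by rewrite mulr1 normr_ge0 normrM -[A]mulr1 ler_pM.
move=> M M' f h fj hj fE.
have fc j : (j <= q.+1)%N -> continuous (f j) by exact: jet_continuous fj.
have fp j : (j <= q.+1)%N -> polybd (f j) by exact: jet_polybd fj.
have hc := jet_continuous hj (leq0n _); have hp := jet_polybd hj (leq0n _).
have Hc := @continuous_hermite R; have Hp := @polybd_hermite R.
have key m : Ex gam (fun x => f k x * hermite m x) =
    - ((m + k).+1%:R^-1 * Ex gam (fun x => h 0%N x * hermite (m + k).+1 x)).
  rewrite (gauss_jet_hermite _ fj kq).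
  have fd (x : R) : is_derive x 1 (f 0%N) (f 1%N x) by exact: fj.1.
  rewrite (stein_hermite (m + k) fd (fc 1%N isT) (fp 0%N isT) (fp 1%N isT) hc hp fE).
  by rewrite mulrN opprK mulrA mulVf ?mul1r// pnatr_eq0.
have -> : (fun x => f k x * (1 + Q x)) = (fun x => f k x * hermite 0%N x +
    \sum_(j < N) e j * (f k x * hermite j.+1 x)).
  apply/funext => x; rewrite mulrDr QE mulr_sumr; congr (_ + _).
  by apply: eq_bigr => j _; rewrite mulrCA.
have iH g m : continuous g -> polybd g -> integ gam (fun x => g x * hermite m x).
  by move=> gc gp; exact: gauss_jet_integ.
rewrite ExD; [|exact: iH (fc k kq) (fp k kq)|]; last first.
  by apply: integ_sum => j; apply: integZ; exact: iH (fc k kq) (fp k kq).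
rewrite Ex_sum; last by move=> j; apply: integZ; exact: iH (fc k kq) (fp k kq).
have -> : (fun x => h 0%N x * Q' x) = (fun x => k.+1%:R^-1 * (h 0%N x * hermite k.+1 x) +
    \sum_(j < N) (e j * (j.+1 + k).+1%:R^-1) * (h 0%N x * hermite (j.+1 + k).+1 x)).
  apply/funext => x; rewrite /Q' mulrDr mulr_sumr mulrCA; congr (_ + _).
  by apply: eq_bigr => j _; rewrite mulrCA.
rewrite ExD; [|by apply: integZ; exact: iH|]; last first.
  by apply: integ_sum => j; apply: integZ; exact: iH.
rewrite Ex_sum; last by move=> j; apply: integZ; exact: iH.
rewrite opprD key add0n ExZ; last exact: iH.
congr (_ + _); rewrite -sumrN; apply: eq_bigr => j _.
rewrite !ExZ; [|exact: iH|exact: iH (fc k kq) (fp k kq)].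
by rewrite key mulrN mulrA.
Qed.

(* For [f] the Stein solution for [h], the terms [E f^(k)(W)], [k >= 2], carry a
   factor [lam^(k-1)] and are expanded at order [q - k + 1] by induction;
   [stein_correction] rewrites the resulting normal expectations in terms of
   [h].  Hence [Q] does not depend on [h]. *)
Lemma edgeworth (p : nat) (C : R) q : 0 <= C -> exists (N : nat) (C' : R), 0 <= C' /\
  forall d (Om : measurableType d) (P : probability Om R) (W : Om -> R) (lam : R),
  stein_approx P W p C lam -> forall q', (0 < q' <= q)%N -> (q' <= p)%N ->
  exists Q, hermite_comb N (C' * lam) Q /\ forall M h, jet q'.-1 M h ->
    `|Ex P (fun w => h 0%N (W w)) - Ex gam (fun x => h 0%N x * (1 + Q x))| <= C' * M * lam ^+ q'.
Proof.
move=> C0; elim: q => [|q [N [C' [C'0 IH]]]].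
  by exists 0%N, 0; split => // d Om P W lam _ q'; case: q'.
pose Cq : R := 2 * q.+2%:R.
have Cq0 : 0 <= Cq by rewrite mulr_ge0.
pose B1 := q%:R * (C * (1 + N%:R * C')).
have B10 : 0 <= B1 by rewrite !mulr_ge0// addr_ge0// mulr_ge0.
pose B2 := C * Cq + q%:R * (C * C' * Cq).
have B20 : 0 <= B2 by rewrite addr_ge0// !mulr_ge0.
exists (N + q.+3)%N, (C' + B1 + B2); split; first by rewrite addr_ge0// addr_ge0.
move=> d Om P W lam H q' /andP[q'0]; rewrite leq_eqVlt ltnS => /predU1P[-> {q' q'0}|q'q] qp; last first.
  have /andP[lam0 _] := sa_lam H.
  have [|Q [HQ HE]] := IH _ _ _ _ _ H q' _ qp; first by rewrite q'0.
  exists Q; split.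
    apply: hermite_comb_widen HQ; first by rewrite leq_addr.
    by rewrite mulr_ge0// ler_wpM2r// -addrA lerDl addr_ge0.
  move=> M h hj; rewrite (le_trans (HE M h hj))// ler_wpM2r ?exprn_ge0//.
  by rewrite ler_wpM2r ?(jet_ge0 hj)// -addrA lerDl addr_ge0.
have /andP[lam0 lam1] := sa_lam H.
have [|c [c0 c1 cC cE]] := sa_exp H (q := q.+1); first by rewrite qp.
have HQ (i : 'I_q) : exists Q, hermite_comb N (C' * lam) Q /\ forall M h, jet (q - i).-1 M h ->
    `|Ex P (fun w => h 0%N (W w)) - Ex gam (fun x => h 0%N x * (1 + Q x))| <= C' * M * lam ^+ (q - i).
  apply: (IH _ _ _ _ _ H); first by rewrite subn_gt0 ltn_ord leq_subr.
  by rewrite (leq_trans _ qp)// leqW// leq_subr.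
have [Q0 HQ0] := fin_all_exists HQ.
have HQ' (i : 'I_q) : exists Q', hermite_comb (N + q.+3) (1 + N%:R * C') Q' /\
    forall M M' f h, jet q.+1 M f -> jet q M' h ->
    (forall x, f 1%N x - x * f 0%N x = h 0%N x - Ex gam (h 0%N)) ->
    Ex gam (fun x => f i.+2 x * (1 + Q0 i x)) = - Ex gam (fun x => h 0%N x * Q' x).
  have HC' : hermite_comb N C' (Q0 i).
    apply: hermite_comb_widen (HQ0 i).1 => //.
    by rewrite mulr_ge0//= ler_piMr.
  by apply: (@stein_correction q i.+2 N C' (Q0 i) _ C'0 HC'); rewrite /= !ltnS.
have [Q1 HQ1] := fin_all_exists HQ'.
have cl (i : 'I_q) : `|c i.+2| <= C * lam ^+ i.+1.
  by apply: cC; rewrite /= !ltnS.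
exists (fun x => \sum_(i < q) c i.+2 * Q1 i x); split.
  apply: (@hermite_comb_widen (N + q.+3) _ (q%:R * (C * lam * (1 + N%:R * C')))) => //.
    rewrite !mulr_ge0 ?addr_ge0 ?mulr_ge0//=.
    rewrite (_ : q%:R * _ = B1 * lam); last by rewrite /B1; ring.
    by rewrite ler_wpM2r// addrAC lerDr addr_ge0.
  apply: hermite_comb_sum; first by rewrite !mulr_ge0 ?addr_ge0 ?mulr_ge0.
  move=> i; apply: hermite_comb_widen (hermite_comb_scale _ (HQ1 i).1) => //.
  rewrite mulr_ge0 ?addr_ge0 ?mulr_ge0//= ler_wpM2r ?addr_ge0 ?mulr_ge0//.
  rewrite (le_trans (cl i))// ler_wpM2l// exprS ler_piMr// exprn_ile1//.
move=> M h hj.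
have [f [fj fE]] := stein_solution hj.
have M0 := jet_ge0 hj.
rewrite -/Cq in fj.
have hi : integ gam (h 0%N).
  exact: gauss_integ (continuous_measurable (jet_continuous hj (leq0n _))) (jet_polybd hj (leq0n _)).
have hc := jet_continuous hj (leq0n _); have hp := jet_polybd hj (leq0n _).
have Q1i i : integ gam (fun x => h 0%N x * Q1 i x).
  apply: gauss_jet_integ => //; first exact: continuous_hermite_comb (HQ1 i).1.
  exact: polybd_hermite_comb (HQ1 i).1.
have E1 : Ex P (fun w => h 0%N (W w)) = Ex P (fun w => f 1%N (W w)) - Ex P (fun w => W w * f 0%N (W w)) + Ex gam (h 0%N).
  have i1 : integ P (fun w => f 1%N (W w)).
    by apply: (sa_int H (jet_shift (j := 1) (m := q) fj)); exact: ltnW.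
  have i2 := sa_intM H fj qp.
  rewrite -ExB// -[X in _ + X](Ex_cst P) -ExD; [|exact: integB|exact: integ_cst].
  by congr Ex; apply/funext => w; rewrite fE subrK.
have E2 : Ex gam (fun x => h 0%N x * (1 + \sum_(i < q) c i.+2 * Q1 i x)) =
    Ex gam (h 0%N) + \sum_(i < q) c i.+2 * Ex gam (fun x => h 0%N x * Q1 i x).
  have -> : (fun x => h 0%N x * (1 + \sum_(i < q) c i.+2 * Q1 i x)) =
      (fun x => h 0%N x + \sum_(i < q) c i.+2 * (h 0%N x * Q1 i x)).
    apply/funext => x; rewrite mulrDr mulr1 mulr_sumr; congr (_ + _).
    by apply: eq_bigr => i _; rewrite mulrCA.
  rewrite ExD//; last by apply: integ_sum => i; exact: integZ.
  rewrite Ex_sum; last by move=> i; exact: integZ.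
  by congr (_ + _); apply: eq_bigr => i _; rewrite ExZ.
pose T := Ex P (fun w => W w * f 0%N (W w)) - \sum_(k < q.+2) c k * Ex P (fun w => f k (W w)).
have TB : `|T| <= C * (Cq * M) * lam ^+ q.+1 by exact: cE.
pose S (i : 'I_q) := c i.+2 * (Ex P (fun w => f i.+2 (W w)) - Ex gam (fun x => f i.+2 x * (1 + Q0 i x))).
(* As [c 0 = 0] and [c 1 = 1], the expansion of [E[W f(W)]] cancels [E f'(W)] in Stein's equation,
   and only derivatives from the second on are left. *)
have -> : Ex P (fun w => h 0%N (W w)) - Ex gam (fun x => h 0%N x * (1 + \sum_(i < q) c i.+2 * Q1 i x)) =
    - T - \sum_(i < q) S i.
  rewrite E1 E2 /T 2!big_ord_recl /= c0 c1 mul0r mul1r add0r.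
  under [\sum_(i < q) S i]eq_bigr do rewrite /S ((HQ1 _).2 _ _ f h fj hj fE) opprK mulrDr.
  by rewrite big_split/=; ring.
apply: le_trans (ler_normB _ _) _; rewrite normrN.
have SB : `|\sum_(i < q) S i| <= q%:R * (C * C' * Cq) * M * lam ^+ q.+1.
  apply: le_trans (ler_norm_sum _ _ _) _.
  apply: (@le_trans _ _ (\sum_(i < q) (C * C' * Cq * M * lam ^+ q.+1))); last first.
    by rewrite sumr_const card_ord -[leLHS]mulr_natl le_eqVlt; apply/orP; left; apply/eqP; ring.
  apply: ler_sum => i _; rewrite /S normrM.
  have fj' : jet (q - i).-1 (Cq * M) (fun j => f (i.+2 + j)%N).
    apply: jet_shift; rewrite -subnS addSnnS -addSnnS addSn.
    by rewrite subnKC.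
  have := (HQ0 i).2 _ _ fj'; rewrite addn0 => h1.
  apply: le_trans (ler_pM _ _ (cl i) h1) _ => //.
  have -> : lam ^+ q.+1 = lam ^+ i.+1 * lam ^+ (q - i).
    by rewrite -exprD addSn subnKC// ltnW.
  by rewrite le_eqVlt; apply/orP; left; apply/eqP; ring.
have B0 : 0 <= (C' + B1) * M * lam ^+ q.+1.
  by rewrite !mulr_ge0 ?addr_ge0 ?exprn_ge0.
by rewrite /B2; lra.
Qed.

End edgeworth.

(** * Test functions adapted to an open set *)

Section bump.
Variable R : realType.

Lemma is_derive_horner (q : {poly R}) (x : R) :
  is_derive x 1 (fun t : R => q.[t]) (q^`()).[x].
Proof.
elim/poly_ind: q => [|q c IH].
  have -> : (fun t : R => (0 : {poly R}).[t]) = cst 0 by apply/funext => t; rewrite horner0.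
  by rewrite deriv0 horner0; exact: is_derive_cst.
have -> : (fun t : R => (q * 'X + c%:P).[t]) = (fun t => q.[t] * t + c).
  by apply/funext => t; rewrite !hornerE.
have := is_derive_add (is_derive_mul IH (is_derive_id x 1)) (is_derive_cst c x 1).
by rewrite derivD derivC derivM derivX !hornerE.
Qed.

Lemma horner_bound01 (q : {poly R}) : exists2 C : R, 0 <= C &
  forall t : R, 0 <= t <= 1 -> `|q.[t]| <= C.
Proof.
exists (\sum_(i < size q) `|q`_i|); first by rewrite sumr_ge0.
move=> t /andP[t0 t1]; rewrite horner_coef (le_trans (ler_norm_sum _ _ _))//.
apply: ler_sum => i _; rewrite normrM normrX (ger0_norm t0) ler_piMr// exprn_ile1//.
Qed.

(* [bumpP n j] is the [j]-th derivative of [(X (1 - X))^n], with the power of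
   [X (1 - X)] that survives in it factored out. *)
Fixpoint bumpE (n j : nat) : {poly R} :=
  if j is j'.+1 then ((n - j')%:R *: ('X * (1 - 'X))^`()) * bumpE n j'
    + 'X * (1 - 'X) * (bumpE n j')^`()
  else 1.

Definition bumpP n j : {poly R} := ('X * (1 - 'X)) ^+ (n - j) * bumpE n j.

Lemma bumpP_deriv n j : (j < n)%N -> (bumpP n j)^`() = bumpP n j.+1.
Proof.
move=> jn; rewrite /bumpP derivM deriv_exp /=.
have -> : (n - j)%N = (n - j.+1).+1 by rewrite -subSn.
set D := 'X * (1 - 'X); set m := (n - j.+1)%N; set E := bumpE n j.
rewrite [m.+1.-1]/= -scaler_nat -mulr_algl exprS -[m.+1%:R *: D^`()]mulr_algl.
ring.
Qed.

(** [be 0] is the [n]-th power of [(s-l)(r-s)/(r-l)], half the harmonic mean of the distances to the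
    two ends, which lies between half the smaller distance and the smaller distance. Rescaling one
    polynomial on [[0, 1]] makes [C] independent of the interval. *)
Lemma bump (n : nat) : exists (C : R) (be : nat -> R -> R -> R -> R), [/\ 0 <= C,
  (forall (j : nat) (l r s : R), (j < n)%N -> l < r -> is_derive s 1 (be j l r) (be j.+1 l r s)),
  (forall j (l r s : R), (j <= n)%N -> l < s < r ->
    `|be j l r s| <= C * (s - l) ^+ (n - j) /\ `|be j l r s| <= C * (r - s) ^+ (n - j)),
  (forall l r s e, 0 <= e -> l < s < r -> e <= s - l -> e <= r - s ->
     (e / 2) ^+ n <= be 0%N l r s) &
  (n = 0%N -> forall l r s, be 0%N l r s = 1)].
Proof.
have [C C0 HC] : exists2 C : R, 0 <= C & forall j, (j <= n)%N -> forall t : R,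
    0 <= t <= 1 -> `|((bumpE n j : {poly R})).[t]| <= C.
  have /choice[c Hc] : forall j, exists c : R, 0 <= c /\
      forall t : R, 0 <= t <= 1 -> `|((bumpE n j : {poly R})).[t]| <= c.
    by move=> j; have [c ? ?] := horner_bound01 (bumpE n j : {poly R}); exists c.
  exists (\sum_(j < n.+1) c j); first by rewrite sumr_ge0// => j _; case: (Hc j).
  move=> j jn t t01; rewrite (le_trans ((Hc j).2 t t01))//.
  have jn' : (j < n.+1)%N by [].
  rewrite (bigD1 (Ordinal jn'))//= lerDl sumr_ge0// => k _; exact: (Hc k).1.
pose be j l r s : R := (r - l) ^+ (n - j) * (bumpP n j : {poly R}).[(s - l) / (r - l)].
have beE j l r s : l < s < r -> be j l r s =
    ((s - l) * (r - s) / (r - l)) ^+ (n - j) * (bumpE n j).[(s - l) / (r - l)].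
  move=> /andP[ls sr]; have rl0 : r - l != 0 by rewrite gt_eqF// subr_gt0 (lt_trans ls).
  rewrite /be /bumpP hornerM horner_exp mulrA -exprMn; congr (_ ^+ _ * _).
  rewrite hornerM hornerD hornerN hornerX -polyC1 hornerC.
  by field.
exists C, be; split => //.
- move=> j l r s jn lr; have rl0 : r - l != 0 by rewrite subr_eq0 gt_eqF.
  have i1 : is_derive s 1 (fun s : R => (s - l) / (r - l)) (r - l)^-1.
    have -> : (fun s : R => (s - l) / (r - l)) = (fun s => (r - l)^-1 * (s - l)).
      by apply/funext => t; rewrite mulrC.
    have := is_derive_scale (r - l)^-1 (is_derive_sub (is_derive_id s 1) (is_derive_cst l s 1)).
    by rewrite subr0 mulr1.
  have i2 := is_derive_horner (bumpP n j : {poly R}) ((s - l) / (r - l)).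
  have i3 : is_derive s 1 (fun s : R => (bumpP n j : {poly R}).[(s - l) / (r - l)])
      ((bumpP n j)^`().[(s - l) / (r - l)] * (r - l)^-1).
    exact: (@is_derive1_comp _ (fun t => (bumpP n j : {poly R}).[t])
       (fun s : R => (s - l) / (r - l)) _ _ _ i2 i1).
  have := is_derive_scale ((r - l) ^+ (n - j)) i3.
  rewrite bumpP_deriv// /be.
  have -> : (n - j)%N = (n - j.+1).+1 by rewrite -subSn.
  congr is_derive; rewrite exprS.
  by field.
- move=> j l r s jn /andP[ls sr].
  have rl : 0 < r - l by rewrite subr_gt0 (lt_trans ls).
  have sl0 : 0 <= s - l by rewrite subr_ge0 ltW.
  have rs0 : 0 <= r - s by rewrite subr_ge0 ltW.
  have t01 : 0 <= (s - l) / (r - l) <= 1.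
    by rewrite divr_ge0 ?(ltW rl)//= ler_pdivrMr// mul1r lerD2r ltW.
  have u0 : 0 <= (s - l) * (r - s) / (r - l) by rewrite divr_ge0 ?mulr_ge0// ltW.
  have bB : `|be j l r s| <= C * ((s - l) * (r - s) / (r - l)) ^+ (n - j).
    rewrite beE ?ls// normrM normrX (ger0_norm u0) mulrC ler_wpM2r ?exprn_ge0//.
    exact: HC.
  have uE m (x : R) : (s - l) * (r - s) / (r - l) <= x ->
      C * ((s - l) * (r - s) / (r - l)) ^+ m <= C * x ^+ m.
    by move=> ux; rewrite ler_wpM2l// lerXn2r// nnegrE// (le_trans u0).
  split; apply: (le_trans bB); apply: uE; rewrite ler_pdivrMr//.
    by rewrite ler_wpM2l// lerD2l lerN2 ltW.
  by rewrite mulrC ler_wpM2l// lerD2r ltW.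
- move=> l r s e e0 /andP[ls sr] el er.
  have rl : 0 < r - l by rewrite subr_gt0 (lt_trans ls).
  rewrite beE ?ls// subn0 [bumpE n 0]/= hornerC mulr1.
  have u0 : 0 <= (s - l) * (r - s) / (r - l).
    by rewrite divr_ge0 ?mulr_ge0 ?(ltW rl)// subr_ge0 ltW.
  rewrite lerXn2r ?nnegrE//; first exact: divr_ge0.
  rewrite ler_pdivlMr//.
  have h1 : e * (r - s) <= (s - l) * (r - s) by rewrite ler_wpM2r// subr_ge0 ltW.
  have h2 : (s - l) * e <= (s - l) * (r - s) by rewrite ler_wpM2l// subr_ge0 ltW.
  by lra.
- by move=> n0 l r s; rewrite /be n0 subn0 expr0 mul1r /bumpP subn0 expr0 mul1r hornerC.
Qed.

End bump.

(** Needed at points off the open set, where the pieces of the density have to join with vanishing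
    derivative. *)
Lemma is_derive0_quadratic (R : realType) (f : R -> R) (x C : R) :
  (forall t, `|t - x| <= 1 -> `|f t| <= C * `|t - x| ^+ 2) -> is_derive x 1 f 0.
Proof.
move=> fC; have C0 : 0 <= C.
  have := fC (x + 1); rewrite addrAC subrr add0r normr1 lexx expr1n mulr1 => /(_ isT).
  exact: le_trans.
have fx : f x = 0.
  by apply/eqP; rewrite -normr_le0; have := fC x; rewrite subrr normr0 expr0n mulr0; apply.
have fl : h^-1 *: (f (h *: 1 + x) - f x) @[h --> 0^'] --> (0 : R).
  apply/cvgrPdist_le => /= e e0; near=> h.
  rewrite fx subr0 sub0r normrN /GRing.scale/= mulr1.
  have h0 : h != 0 by near: h; exact: nbhs_dnbhs_neq.
  have h1 : `|h| <= 1 by near: h; apply: dnbhs0_le.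
  have he : `|h| <= e / (C + 1).
    by near: h; apply: dnbhs0_le; rewrite divr_gt0// ltr_pwDr.
  rewrite normrM normfV ler_pdivrMl ?normr_gt0//.
  have := fC (h + x); rewrite addrK => /(_ h1)/le_trans; apply.
  rewrite expr2 mulrCA ler_wpM2l//.
  move: he; rewrite ler_pdivlMr ?ltr_pwDr// => /(le_trans _); apply.
  by rewrite mulrC ler_wpM2l// lerDl.
apply: DeriveDef; first exact: (cvgP _ fl).
exact: cvg_lim fl.
Unshelve. all: by end_near. Qed.

(** * Components of a bounded open set of reals *)

Section components.
Variables (R : realType) (O : set R).
Hypothesis Oopen : open O.

(** The ends are the supremum of the complement to the left of [s] and its infimum to the right;
    openness keeps both out of [O], boundedness makes them finite. *)
Lemma component_exists (M s : R) : O `<=` [set x | `|x| < M] -> O s ->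
  exists l r, [/\ l < s < r, ~ O l, ~ O r & forall x, l < x < r -> O x].
Proof.
move=> OM Os.
have ball_in x : O x -> exists2 e : R, 0 < e & forall y, `|x - y| < e -> O y.
  move=> Ox; have /nbhs_ballP[e /= e0 He] := open_nbhs_nbhs (conj Oopen Ox).
  by exists e.
have Mout x : M <= `|x| -> ~ O x by move=> Mx /OM /=; rewrite ltNge Mx.
have /= sM := OM _ Os.
have [l [ls Ol Hl]] : exists l, [/\ l < s, ~ O l & forall x, l < x <= s -> O x].
  pose E := [set x | x <= s /\ ~ O x].
  have Es : has_sup E.
    split; last by exists s => x [].
    exists (- M); split; last by apply: Mout; rewrite normrN ler_norm.
    by move: sM; rewrite ltr_norml => /andP[/ltW].
  have sups : sup E <= s by apply: ge_sup; [exact: Es.1|move=> x []].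
  have nO : ~ O (sup E).
    move=> Osup; have [e e0 He] := ball_in _ Osup.
    have [x xE xe] := sup_adherent e0 Es.
    apply: xE.2; apply: He; rewrite ger0_norm ?subr_ge0; last exact: ub_le_sup Es.2 _ xE.
    by rewrite ltrBlDr addrC -ltrBlDr.
  exists (sup E); split => //.
    by rewrite lt_neqAle sups andbT; apply/eqP => Es'; rewrite Es' in nO.
  move=> x /andP[sx xs]; apply: contrapT => Ox.
  by move: sx; rewrite ltNge => /negP; apply; exact: ub_le_sup Es.2 _ (conj xs Ox).
have [r [sr Or Hr]] : exists r, [/\ s < r, ~ O r & forall x, s <= x < r -> O x].
  pose E := [set x | s <= x /\ ~ O x].
  have Es : has_inf E.
    split; last by exists s => x [].
    exists M; split; last by apply: Mout; rewrite ler_norm.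
    by rewrite ltW// (le_lt_trans (ler_norm _)).
  have sinf : s <= inf E by apply: lb_le_inf; [exact: Es.1|move=> x []].
  have nO : ~ O (inf E).
    move=> Oinf; have [e e0 He] := ball_in _ Oinf.
    have [x xE xe] := inf_adherent e0 Es.
    apply: xE.2; apply: He; rewrite ler0_norm ?subr_le0; last exact: ge_inf Es.2 _ xE.
    by rewrite opprB ltrBlDl.
  exists (inf E); split => //.
    by rewrite lt_neqAle sinf andbT; apply/eqP => Es'; rewrite -Es' in nO.
  move=> x /andP[sx xs]; apply: contrapT => Ox.
  by move: xs; rewrite ltNge => /negP; apply; exact: ge_inf Es.2 _ (conj sx Ox).
exists l, r; split => //; first by rewrite ls sr.
move=> x /andP[lx xr]; have [xs|/ltW sx] := leP x s; first by apply: Hl; rewrite lx.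
by apply: Hr; rewrite sx.
Qed.

Lemma component_uniq (l r l' r' s : R) : l < s < r -> l' < s < r' ->
  ~ O l -> ~ O r -> ~ O l' -> ~ O r' ->
  (forall x, l < x < r -> O x) -> (forall x, l' < x < r' -> O x) -> l = l' /\ r = r'.
Proof.
move=> /andP[ls sr] /andP[ls' sr'] Ol Or Ol' Or' H H'; split; apply/eqP; rewrite eq_le; apply/andP; split; rewrite leNgt; apply/negP => lt.
- by apply: Ol; apply: H'; rewrite lt (lt_trans ls).
- by apply: Ol'; apply: H; rewrite lt (lt_trans ls').
- by apply: Or'; apply: H; rewrite lt (lt_trans _ sr')// (lt_trans ls).
- by apply: Or; apply: H'; rewrite lt (lt_trans _ sr)// (lt_trans ls').
Qed.

End components.

(** * Primitives of bounded functions with bounded support *)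

Section primitive.
Variable R : realType.
Local Notation lam := (@lebesgue_measure R).

Definition prim (k : R -> R) (x : R) := \int[lam]_(t in `]-oo, x]) k t.

Variables (k : R -> R) (M A : R).
Hypotheses (mk : measurable_fun setT k) (kA : forall x, 0 <= k x <= A)
  (kM : forall x, M <= `|x| -> k x = 0).

Let A0 : 0 <= A. Proof. by have /andP[/le_trans] := kA 0; exact. Qed.

Let cst_int b1 b2 x y c :
  lam.-integrable [set` Interval (BSide b1 x) (BSide b2 y)] (EFin \o cst c).
Proof.
apply: measurable_bounded_integrable => //; last exact: bounded_cst.
by rewrite /= lebesgue_measure_itv/=; case: ifP => _; rewrite ?ltry// -EFinB ltry.
Qed.

Let k_int : lam.-integrable setT (EFin \o k).
Proof.
have mkE : measurable_fun setT (EFin \o k) by exact/measurable_EFinP.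
have : lam.-integrable `[- M, M] (EFin \o k).
  apply: (le_integrable _ _ _ (cst_int true false (- M) M A)) => //.
  - exact: measurable_funTS.
  - move=> x _ /=; have /andP[k0 kx] := kA x.
    by rewrite lee_fin (ger0_norm k0) (ger0_norm A0).
rewrite integrable_mkcond//; congr (integrable _ _ _).
apply/funext => x /=; rewrite patchE; case: ifPn => //.
rewrite notin_setE/= in_itv/= => xM; rewrite kM//.
by rewrite leNgt; apply/negP => /ltW; rewrite ler_norml.
Qed.

Lemma prim_diff x y : x <= y -> prim k y - prim k x = \int[lam]_(t in `]x, y]) k t.
Proof.
move=> xy; rewrite /prim Rintegral_itvB//.
exact: integrableS k_int.
Qed.

Lemma prim_bounds x y : x <= y -> 0 <= prim k y - prim k x <= A * (y - x).
Proof.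
move=> xy; rewrite prim_diff//; apply/andP; split.
  by apply: Rintegral_ge0 => // t _; case/andP: (kA t).
have ci : lam.-integrable `]x, y] (EFin \o cst A). exact: cst_int.
apply: (@le_trans _ _ (\int[lam]_(t in `]x, y]) (cst A t))).
  apply: le_Rintegral => //; first exact: integrableS k_int.
  by move=> t _; case/andP: (kA t).
rewrite Rintegral_cst//= lebesgue_measure_itv/= lte_fin.
by case: ifPn => //= /negbTE; rewrite lt_neqAle xy andbT => /negbFE/eqP->; rewrite subrr.
Qed.

Lemma prim_const x y : x <= y -> (forall t, x < t <= y -> k t = 0) -> prim k y = prim k x.
Proof.
move=> xy k0; apply/eqP; rewrite -subr_eq0 prim_diff//; apply/eqP.
rewrite (@eq_Rintegral _ _ _ lam _ (cst 0)); first by rewrite Rintegral_cst// mul0r.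
by move=> t; rewrite inE/= in_itv/= => /k0.
Qed.

Lemma prim_lower x y c : x <= y -> (forall t, x < t <= y -> c <= k t) ->
  c * (y - x) <= prim k y - prim k x.
Proof.
move=> xy kc; rewrite prim_diff//.
have ci : lam.-integrable `]x, y] (EFin \o cst c). exact: cst_int.
apply: (@le_trans _ _ (\int[lam]_(t in `]x, y]) (cst c t))); last first.
  apply: le_Rintegral => //; first exact: integrableS k_int.
rewrite Rintegral_cst//= lebesgue_measure_itv/= lte_fin.
by case: ifPn => //= /negbTE; rewrite lt_neqAle xy andbT => /negbFE/eqP->; rewrite subrr.
Qed.

Lemma is_derive_prim (x : R) : continuous k -> is_derive x 1 (prim k) (k x).
Proof.
move=> kc; have xx : x < x + 1 by rewrite ltrDl.
have li : lam.-integrable [set` Interval -oo%O (BRight (x + 1))] (EFin \o k).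
  exact: integrableS k_int.
have [dF eF] := @continuous_FTC1 R _ -oo%O x _ xx li (ltNyr _) (kc x).
apply: DeriveDef; first exact: dF.
by rewrite -derive1E; exact: eF.
Qed.

End primitive.

Section whitney.
Variable R : realType.

(* On a component ]l, r[ of [O] the derivative of [h] is [((s-l)(r-s)/(r-l))^n],
   and it vanishes off [O]. The derivatives of order [j] of this density are
   [O(dist(s, ~O)^(n-j))], whatever the length of the component, so the pieces
   fit together at the boundary of [O]. *)
Lemma whitney (n : nat) : exists2 C : R, 0 <= C & forall (O : set R) (M : R),
  open O -> 0 < M -> O `<=` [set x | `|x| < M] -> exists h : nat -> R -> R,
  [/\ jet n C h,
    (forall x y, x <= y -> 0 <= h 0%N y - h 0%N x <= C * M ^+ n * (y - x)),
    (forall x y, x <= y -> (forall t, x < t < y -> ~ O t) -> h 0%N x = h 0%N y) &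
    (forall x y, x <= y -> (forall t, x < t < y -> O t) -> (y - x) ^+ n.+1 <= C * (h 0%N y - h 0%N x))].
Proof.
have [C0 [be [C00 bed beB beL be1]]] := @bump R n.
pose C := 8 ^+ n * 2 + C0 + C0 * 2.
have C0C : C0 <= C by rewrite /C -addrA addrCA lerDl addr_ge0// mulr_ge0.
have cC : 8 ^+ n * 2 <= C by rewrite /C -addrA lerDl addr_ge0// mulr_ge0.
have C2 : C0 * 2 <= C by rewrite /C lerDr addr_ge0// mulr_ge0.
have Cge0 : 0 <= C by rewrite (le_trans C00).
exists C => // O M oO M0 OM.
have /choice[lr Hlr] : forall s, exists lr : R * R, O s -> [/\ lr.1 < s < lr.2, ~ O lr.1, ~ O lr.2 &
    forall x, lr.1 < x < lr.2 -> O x].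
  move=> s; have [Os|Os] := pselect (O s); last by exists (0, 0).
  by have [l [r H]] := component_exists oO OM Os; exists (l, r).
pose k j s := if `[< O s >] then be j (lr s).1 (lr s).2 s else 0.
have kO j s : O s -> k j s = be j (lr s).1 (lr s).2 s by move=> Os; rewrite /k asboolT.
have knO j s : ~ O s -> k j s = 0 by move=> Os; rewrite /k asboolF.
(* A point [z] off [O] lies at or beyond an end of the component of [s], so a bound by the distance
   to that end is also one by [|s - z|]. *)
have K1 j s z : (j <= n)%N -> ~ O z -> `|k j s| <= C0 * `|s - z| ^+ (n - j).
  move=> jn Oz; have [Os|Os] := pselect (O s); last first.
    by rewrite knO// normr0 mulr_ge0// exprn_ge0.
  have [ls Ol Or HO] := Hlr s Os; have [B1 B2] := beB _ _ _ _ jn ls.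
  rewrite kO//; have /andP[ls1 sr1] := ls.
  have [zs|sz] := leP z s.
    have zl : z <= (lr s).1.
      by rewrite leNgt; apply/negP => lz; apply: Oz; apply: HO; rewrite lz (le_lt_trans zs).
    apply: (le_trans B1); rewrite ger0_norm ?subr_ge0// ler_wpM2l// lerXn2r ?nnegrE ?subr_ge0// ?(ltW ls1)//.
    by rewrite lerD2l lerN2.
  have zr : (lr s).2 <= z.
    by rewrite leNgt; apply/negP => lz; apply: Oz; apply: HO; rewrite lz (lt_trans ls1).
  apply: (le_trans B2); rewrite distrC ger0_norm ?subr_ge0 ?(ltW sz)// ler_wpM2l// lerXn2r ?nnegrE ?subr_ge0// ?(ltW sr1) ?(ltW sz)//.
  by rewrite lerD2r.
have Kcomp j s t : O s -> (lr s).1 < t < (lr s).2 -> k j t = be j (lr s).1 (lr s).2 t.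
  move=> Os ts; have [ls Ol Or HO] := Hlr s Os; have Ot := HO _ ts.
  have [lt Olt Ort HOt] := Hlr t Ot.
  by have [e1 e2] := component_uniq ts lt Ol Or Olt Ort HO HOt; rewrite kO// e1 e2.
have Kloc j s : O s -> \forall t \near s, be j (lr s).1 (lr s).2 t = k j t.
  move=> Os; have [ls _ _ _] := Hlr s Os.
  have : \forall t \near s, (lr s).1 < t < (lr s).2.
    have := near_in_itvoo (_ : s \in `](lr s).1, (lr s).2[).
    by rewrite in_itv/= => /(_ ls); apply: filterS => t; rewrite in_itv.
  by apply: filterS => t ts; rewrite (Kcomp j s t).
have KdO j (s : R) : (j < n)%N -> O s -> is_derive s 1 (k j) (k j.+1 s).
  move=> jn Os; rewrite kO//; apply: near_eq_is_derive (Kloc j s Os) _; apply: bed => //.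
  by have [/andP[ls sr] _ _ _] := Hlr s Os; exact: lt_trans sr.
(* Off [O] the exponent [n - j] in [K1] is at least 2, so the derivative exists there and is 0. *)
have Kd j (s : R) : (j.+1 < n)%N -> is_derive s 1 (k j) (k j.+1 s).
  move=> jn; have [Os|Os] := pselect (O s); first by apply: KdO => //; exact: ltnW.
  rewrite [k j.+1 s]knO//; apply: (@is_derive0_quadratic _ _ _ C0) => t t1.
  have jn2 : (2 <= n - j)%N by rewrite ltn_subRL addn1.
  apply: le_trans (K1 j t s (ltnW (ltnW jn)) Os) _; rewrite ler_wpM2l//.
  by rewrite -(subnK jn2) exprD ler_piMl ?exprn_ge0// exprn_ile1.
(* The last derivative is only Lipschitz. If [[x, y]] contains a point off [O], both values are
   compared with 0 there; otherwise [x] and [y] lie in one component. *)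
have KL j x y : j.+1 = n -> `|k j x - k j y| <= C * `|x - y|.
  move=> jn.
  have nj : (n - j = 1)%N by rewrite -jn subSnn.
  have jn' : (j < n)%N by rewrite -jn.
  wlog xy : x y / x <= y.
    by move=> wl; have [/wl//|/ltW/wl] := leP x y; rewrite distrC [X in C * X]distrC.
  have [[z [xz zy Oz]]|Oxy] := pselect (exists z, [/\ x <= z, z <= y & ~ O z]).
    have := ler_normB (k j x) (k j y); move/le_trans; apply.
    have := K1 j x z (ltnW jn') Oz; have := K1 j y z (ltnW jn') Oz; rewrite nj !expr1 => h1 h2.
    rewrite distrC (ger0_norm (_ : 0 <= y - x)) ?subr_ge0//.
    apply: le_trans (lerD h2 h1) _.
    rewrite distrC !ger0_norm ?subr_ge0// -mulrDr addrC addrA subrK.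
    by rewrite ler_wpM2r// subr_ge0.
  have HO t : x <= t <= y -> O t.
    by move=> /andP[xt ty]; apply: contrapT => Ot; apply: Oxy; exists t.
  have Ox : O x by apply: HO; rewrite lexx.
  have [/andP[lx xr] Ol Or _] := Hlr x Ox.
  have yr : y < (lr x).2.
    by rewrite ltNge; apply/negP => ry; apply: Or; apply: HO; rewrite ry ltW.
  have lxr := lt_trans lx xr.
  rewrite !(Kcomp j x)// ?lx ?xr ?yr ?(lt_le_trans lx)//.
  apply: (@is_derive_mvt_norm _ _ (be j.+1 (lr x).1 (lr x).2)); first by move=> t; exact: bed.
  rewrite (max_idPl xy) (min_idPr xy) => t /andP[xt ty].
  have lt : (lr x).1 < t < (lr x).2 by rewrite (lt_le_trans lx)//= (le_lt_trans ty).
  have [+ _] := beB j.+1 _ _ _ jn' lt; rewrite jn subnn expr0 mulr1 => /le_trans; apply.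
  exact: C0C.
have k0 s : 0 <= k 0%N s <= C0 * M ^+ n.
  have [Os|Os] := pselect (O s); last by rewrite knO// lexx mulr_ge0// exprn_ge0// ltW.
  have [ls _ _ _] := Hlr s Os; have /andP[ls1 sr1] := ls.
  have -> : 0 <= k 0%N s.
    have ls2 : 0 <= s - (lr s).1 by rewrite subr_ge0 ltW.
    have sr2 : 0 <= (lr s).2 - s by rewrite subr_ge0 ltW.
    rewrite kO//; apply: le_trans (beL _ _ _ 0 (lexx _) ls ls2 sr2).
    by rewrite mul0r exprn_ge0.
  have sM := OM _ Os; have Mo z : M <= `|z| -> ~ O z by move=> Mz /OM /=; rewrite ltNge Mz.
  apply: le_trans (ler_norm _) _.
  have bnd z : ~ O z -> `|s - z| <= M -> `|k 0%N s| <= C0 * M ^+ n.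
    move=> Oz sz; apply: le_trans (K1 0%N s z (leq0n _) Oz) _.
    by rewrite subn0 ler_wpM2l// lerXn2r// nnegrE ltW.
  move: sM => /=; rewrite ltr_norml => /andP[Ms sM].
  have [s0|/ltW s0] := leP 0 s.
    apply: (bnd M); first by apply: Mo; rewrite ler_norm.
    by rewrite ler0_norm ?subr_le0 ?(ltW sM)//; lra.
  apply: (bnd (- M)); first by apply: Mo; rewrite normrN ler_norm.
  by rewrite ger0_norm; lra.
have kM x : M <= `|x| -> k 0%N x = 0.
  by move=> Mx; apply: knO => /OM /=; rewrite ltNge Mx.
have kc : (0 < n)%N -> continuous (k 0%N).
  rewrite leq_eqVlt => /predU1P[n1|n1]; last by apply: (@is_derive_continuous _ _ (k 1%N)) => x; exact: Kd.
  by apply: (@lipschitz_continuous _ _ C) => x y; apply: KL.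
have mk : measurable_fun setT (k 0%N).
  have [n0|n0] := posnP n; last exact: continuous_measurable (kc n0).
  have -> : k 0%N = \1_O.
    apply/funext => x; rewrite indicE; have [Ox|Ox] := pselect (O x).
      by rewrite mem_set// kO// be1.
    by rewrite memNset// knO.
  by apply: measurable_indic; exact: open_measurable.
pose h i := if i is i'.+1 then k i' else prim (k 0%N).
have pb x y : x <= y -> 0 <= prim (k 0%N) y - prim (k 0%N) x <= C0 * M ^+ n * (y - x).
  exact: (prim_bounds mk k0 kM).
have Mn0 : 0 <= M ^+ n by rewrite exprn_ge0// ltW.
exists h; split.
- split.
    move=> [|i] x iN /=; last exact: Kd.
    exact: (is_derive_prim mk k0 kM) (kc iN).
  case: (n) pb KL => [|m] pb KL; last by move=> x y; exact: KL.
  move=> x y /=; wlog xy : x y / x <= y.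
    by move=> wl; have [/wl//|/ltW/wl] := leP x y; rewrite distrC [X in C * X]distrC.
  have /andP[p0 pC] := pb _ _ xy.
  rewrite distrC (ger0_norm p0) distrC ger0_norm ?subr_ge0//.
  apply: le_trans pC _; rewrite expr0 mulr1 ler_wpM2r ?subr_ge0//.
- move=> x y xy /=; have /andP[-> /le_trans] := pb _ _ xy; apply.
  by rewrite ler_wpM2r ?subr_ge0// ler_wpM2r.
- move=> x y xy Oxy /=; apply/esym; apply: (prim_const mk k0 kM) => // t /andP[xt].
  rewrite le_eqVlt => /predU1P[ty|ty]; last by rewrite knO//; apply: Oxy; rewrite xt.
  rewrite ty in xt *.
  (* The right end belongs to the interval of integration but not to the hypothesis; if it were in
     [O], so would be points just before it. *)
  apply: knO => Oy; have /nbhs_ballP[e /= e0 He] := open_nbhs_nbhs (conj oO Oy).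

  pose z := Num.max ((x + y) / 2) (y - e / 2).
  have zy : z < y by rewrite /z gt_max; apply/andP; split; lra.
  apply: (Oxy z); first by rewrite zy andbT /z lt_max; apply/orP; left; lra.
  apply: He; rewrite /ball/= ger0_norm; last by lra.
  have : y - e / 2 <= z by rewrite /z le_max lexx orbT.
  by lra.
- move=> x y xy Oxy /=.
  (* On the middle half both ends are at distance at least [e], so the density is at least
     [(e / 2)^n] over a length [2 e]; this explains [8^n * 2] in [C]. *)
  pose e := (y - x) / 4; have e0 : 0 <= e by rewrite divr_ge0// subr_ge0.
  have exy : y - x = 4 * e by rewrite /e; field.
  have uv : x + e <= y - e by lra.
  have h1 : (e / 2) ^+ n * (y - e - (x + e)) <= prim (k 0%N) (y - e) - prim (k 0%N) (x + e).
    apply: (prim_lower mk k0 kM) => // t /andP[ut tv].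
    have xt : x < t by lra.
    have [ty|ty] := ltP t y; last first.
      have e00 : e = 0 by lra.
      by move: ut tv; rewrite e00; lra.
    have Ot : O t by apply: Oxy; rewrite xt ty.
    have [ls Ol Or _] := Hlr t Ot; rewrite kO//; have /andP[lt tr] := ls.
    have lx : (lr t).1 <= x.
      by rewrite leNgt; apply/negP => xl; apply: Ol; apply: Oxy; rewrite xl (lt_trans lt).
    have yr : y <= (lr t).2.
      by rewrite leNgt; apply/negP => ry; apply: Or; apply: Oxy; rewrite ry andbT (lt_trans xt).
    by apply: beL => //; lra.
  have /pb/andP[h2 _] : y - e <= y by lra.
  have /pb/andP[h3 _] : x <= x + e by lra.
  have h4 : (e / 2) ^+ n * (2 * e) <= prim (k 0%N) y - prim (k 0%N) x.
    by move: h1; rewrite (_ : y - e - (x + e) = 2 * e); lra.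
  have -> : (y - x) ^+ n.+1 = (8 ^+ n * 2) * ((e / 2) ^+ n * (2 * e)).
    rewrite exprS exy (_ : 4 * e = 8 * (e / 2)); last by field.
    by rewrite exprMn; field.
  apply: le_trans (_ : 8 ^+ n * 2 * (prim (k 0%N) y - prim (k 0%N) x) <= _).
    by rewrite ler_wpM2l// mulr_ge0.
  by have /andP[h5 _] := pb _ _ xy; exact: ler_wpM2r.
Qed.

End whitney.

(** * The test function for two monotone maps *)

Section transport_test.
Variable R : realType.

(** For each [z] the interval between [a z] and [b z] lies off one of the two sets, and the
    corresponding primitive is constant along it. The cut-off at [M] keeps the sets bounded; if the
    larger value [m] of [|a z|] and [|b z|] reaches [M], then [1 <= M^-2 m^2] and the last term
    pays. *)
Lemma transport_test (p : nat) : (0 < p)%N -> exists2 C : R, 0 <= C &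
  forall (a b : R -> R) (M : R), {homo a : x y / x <= y} -> {homo b : x y / x <= y} -> 0 < M ->
  exists h : nat -> R -> R, [/\ jet p.-1 C h,
    (forall x, `|h 0%N x| <= C * M ^+ p.-1 * `|x|) &
    (forall z, `|a z - b z| ^+ p <= C * (h 0%N (b z) - h 0%N (a z)) +
       C * M ^- 2 * (`|a z| ^+ (p + 2) + `|b z| ^+ (p + 2)))].
Proof.
case: p => // n _; have [C C0 HC] := whitney R n.
pose C' := C + C + 2 ^+ n.+1.
have C'0 : 0 <= C' by rewrite !addr_ge0.
have CC' : C <= C' by rewrite /C' -addrA lerDl addr_ge0.
have pC' : 2 ^+ n.+1 <= C' by rewrite /C' lerDr addr_ge0.
exists C' => // a b M am bm M0.
pose cross (f g : R -> R) : set R := [set x | `|x| < M /\ exists z, f z < x < g z].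
have cross_open f g : open (cross f g).
  rewrite openE => x /= [xM [z /andP[fx xg]]].
  have h1 : \forall t \near x, t \in `](Num.max (- M) (f z)), (Num.min M (g z))[.
    apply: near_in_itvoo; rewrite in_itv/= gt_max lt_min fx xg !andbT.
    by rewrite -ltr_norml.
  apply: filterS h1 => t; rewrite in_itv/= gt_max lt_min => /andP[/andP[Mt ft] /andP[tM tg]].
  by split; [rewrite ltr_norml Mt|exists z; rewrite ft].
have cross_M f g : cross f g `<=` [set x | `|x| < M] by move=> x [].
have disj x : cross a b x -> cross b a x -> False.
  move=> [_ [z /andP[az zb]]] [_ [w /andP[bw wa]]].
  have [zw|wz] := ltP z w.
    by have := bm _ _ (ltW zw); rewrite leNgt (lt_trans bw).
  by have := am _ _ wz; rewrite leNgt (lt_trans az).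
have [hP [jP mP cP lP]] := HC _ _ (cross_open a b) M0 (cross_M _ _).
have [hN [jN mN cN lN]] := HC _ _ (cross_open b a) M0 (cross_M _ _).
have Mn0 : 0 <= M ^+ n by rewrite exprn_ge0// ltW.
have CM0 : 0 <= C * M ^+ n by rewrite mulr_ge0.
pose c := hP 0%N 0 - hN 0%N 0.
pose h i x := hP i x - hN i x - (if i is 0 then c else 0).
have hLip x y : x <= y -> `|h 0%N y - h 0%N x| <= C' * M ^+ n * (y - x).
  move=> xy; have /andP[p0 pC] := mP _ _ xy; have /andP[n0 nC] := mN _ _ xy.
  have -> : h 0%N y - h 0%N x = (hP 0%N y - hP 0%N x) - (hN 0%N y - hN 0%N x) by rewrite /h; ring.
  apply: le_trans (ler_normB _ _) _; rewrite (ger0_norm p0) (ger0_norm n0).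
  apply: le_trans (lerD pC nC) _; rewrite -!mulrDl ler_wpM2r ?subr_ge0// ler_wpM2r//.
  by rewrite /C' lerDl.
exists h; split.
- split.
    move=> k x kn; rewrite /h subr0; case: k kn => [|k] kn.
      have := is_derive_sub (is_derive_sub (jP.1 0%N x kn) (jN.1 0%N x kn)) (is_derive_cst c x 1).
      by rewrite subr0.
    have := is_derive_sub (is_derive_sub (jP.1 k.+1 x kn) (jN.1 k.+1 x kn)) (is_derive_cst 0 x 1).
    by rewrite subr0.
  move=> x y; rewrite /h opprD addrACA subrr addr0.
  have -> : hP n x - hN n x - (hP n y - hN n y) = (hP n x - hP n y) - (hN n x - hN n y) by ring.
  apply: le_trans (ler_normB _ _) _; apply: le_trans (lerD (jP.2 x y) (jN.2 x y)) _.
  by rewrite -mulrDl ler_wpM2r// /C' lerDl.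
- move=> x; have h00 : h 0%N 0 = 0 by rewrite /h /c subrr.
  have [x0|/ltW x0] := leP 0 x.
    by have := hLip _ _ x0; rewrite h00 !subr0 (ger0_norm x0).
  by have := hLip _ _ x0; rewrite h00 !sub0r normrN (ler0_norm x0).
move=> z /=.
have E0 : 0 <= C' * M ^- 2 * (`|a z| ^+ (n.+1 + 2) + `|b z| ^+ (n.+1 + 2)).
  by rewrite mulr_ge0 ?addr_ge0 ?exprn_ge0// mulr_ge0// invr_ge0 exprn_ge0// ltW.
have out : M <= Num.max `|a z| `|b z| ->
    `|a z - b z| ^+ n.+1 <= C' * M ^- 2 * (`|a z| ^+ (n.+1 + 2) + `|b z| ^+ (n.+1 + 2)).
  set m := Num.max _ _ => Mm; have m0 : 0 <= m by rewrite (le_trans _ Mm)// ltW.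
  have h1 : `|a z - b z| <= 2 * m.
    apply: le_trans (ler_normB _ _) _; rewrite mulr_natl mulr2n.
    by rewrite lerD// /m le_max lexx ?orbT.
  have h2 : m ^+ (n.+1 + 2) <= `|a z| ^+ (n.+1 + 2) + `|b z| ^+ (n.+1 + 2).
    by rewrite /m; case: (leP `|a z| `|b z|) => _; rewrite ?lerDl ?lerDr exprn_ge0.
  have h3 : 1 <= M ^- 2 * m ^+ 2.
    by rewrite mulrC ler_pdivlMr ?exprn_gt0// mul1r lerXn2r// nnegrE ltW.
  apply: (@le_trans _ _ ((2 * m) ^+ n.+1)).
    by rewrite lerXn2r// ?nnegrE// mulr_ge0.
  apply: (@le_trans _ _ (C' * (M ^- 2 * m ^+ (n.+1 + 2)))); last first.
    by rewrite -mulrA ler_wpM2l// ler_wpM2l// invr_ge0 exprn_ge0// ltW.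
  rewrite exprMn ler_pM ?exprn_ge0// exprD mulrCA ler_peMr// exprn_ge0//.
have inc : 0 <= hP 0%N (b z) - hP 0%N (a z) - (hN 0%N (b z) - hN 0%N (a z)) /\
    (Num.max `|a z| `|b z| < M -> `|a z - b z| ^+ n.+1 <= C *
     (hP 0%N (b z) - hP 0%N (a z) - (hN 0%N (b z) - hN 0%N (a z)))).
  have [ab|ba] := leP (a z) (b z).
    have -> : hN 0%N (b z) = hN 0%N (a z).
      apply/esym/cN => // t tab Ot; apply: (@disj t) => //; split; last by exists z.
      by case: Ot.
    rewrite subrr subr0; split; first by case/andP: (mP _ _ ab).
    rewrite gt_max => /andP[aM bM]; rewrite distrC ger0_norm ?subr_ge0//.
    apply: lP => // t tab; split; last by exists z.
    move: aM bM tab; rewrite !ltr_norml => /andP[? ?] /andP[? ?] /andP[? ?]; apply/andP; split; lra.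
  have ba' := ltW ba.
  have -> : hP 0%N (a z) = hP 0%N (b z).
    apply/esym/cP => // t tab Ot; apply: (@disj t) => //; split; last by exists z.
    by case: Ot.
  rewrite subrr sub0r opprB; split; first by case/andP: (mN _ _ ba').
  rewrite gt_max => /andP[aM bM]; rewrite ger0_norm ?subr_ge0//.
  apply: lN => // t tab; split; last by exists z.
  move: aM bM tab; rewrite !ltr_norml => /andP[? ?] /andP[? ?] /andP[? ?]; apply/andP; split; lra.
have hE : h 0%N (b z) - h 0%N (a z) =
    hP 0%N (b z) - hP 0%N (a z) - (hN 0%N (b z) - hN 0%N (a z)) by rewrite /h; ring.
rewrite hE; case: inc => inc0 inc.
have [Mm|mM] := leP M (Num.max `|a z| `|b z|).
  by apply: le_trans (out Mm) _; rewrite lerDr mulr_ge0.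
by apply: le_trans (inc mM) _; rewrite -[leLHS]addr0 lerD// ler_wpM2r.
Qed.

End transport_test.

(** * Monotone transport *)

Section pushforward_expectation.
Variables (d d' : measure_display) (T : measurableType d) (T' : measurableType d') (R : realType).
Variables (P : probability T R) (Q : probability T' R) (g : T -> T').
Hypotheses (mg : measurable_fun setT g)
  (PQ : forall A, measurable A -> P (g @^-1` A) = Q A).

Lemma ge0_integral_image (f : T' -> \bar R) : measurable_fun setT f -> (forall y, (0 <= f y)%E) ->
  (\int[P]_x f (g x) = \int[Q]_y f y)%E.
Proof.
move=> mf f0; have := @ge0_integral_pushforward _ _ _ _ _ g mg P setT f measurableT mf (fun y _ => f0 y).
rewrite preimage_setT => <-.
by apply: eq_measure_integral => A mA _; exact: PQ.
Qed.

Lemma integ_image (f : T' -> R) : measurable_fun setT f ->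
  integ P (fun x => f (g x)) <-> integ Q f.
Proof.
move=> mf; have e : (\int[P]_x `|f (g x)|%:E = \int[Q]_y `|f y|%:E)%E.
  by apply: (@ge0_integral_image (fun y => `|f y|%:E)) => //; apply/measurable_EFinP/measurableT_comp.
split=> /integrableP[_ fi]; apply/integrableP; split.
- exact/measurable_EFinP.
- by move: fi => /=; rewrite e.
- exact/measurable_EFinP/measurableT_comp.
- by move: fi => /=; rewrite e.
Qed.

Lemma Ex_image (f : T' -> R) : integ Q f -> Ex P (fun x => f (g x)) = Ex Q f.
Proof.
move=> fi; have mf := integ_measurable fi.
rewrite /Ex /Rintegral; congr fine; rewrite integralE [in RHS]integralE.
have mfE : measurable_fun setT (EFin \o f) by exact/measurable_EFinP.
rewrite -(@ge0_integral_image (EFin \o f)^\+%E)//; last exact: measurable_funepos.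
rewrite -(@ge0_integral_image (EFin \o f)^\-%E)//; last exact: measurable_funeneg.
by congr (_ - _)%E; apply: eq_integral => x _; rewrite ?funeposE ?funenegE.
Qed.

End pushforward_expectation.

Section quantile.
Variable R : realType.
Local Notation gam := (@std_normal R).

Lemma measure_eq_rays (m1 m2 : {measure set R -> \bar R}) : (m1 setT < +oo)%E ->
  (forall x : R, m1 `]-oo, x]%classic = m2 `]-oo, x]%classic) -> forall A, measurable A -> m1 A = m2 A.
Proof.
move=> m1T m12 A mA.
have fin (B : set R) : measurable B -> (m1 B < +oo)%E.
  by move=> mB; apply: le_lt_trans m1T; apply: le_measure; rewrite ?inE.
apply: (measure_unique (@ocitv R) (fun n => `](- n%:R : R), n%:R]%classic)) => //.
- exact: ocitvI.
- by move=> n; exact: is_ocitv.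
- apply/seteqP; split=> // x _; exists (Num.truncn `|x|).+1 => //=.
  by rewrite in_itv/=; have := Num.Theory.truncnS_gt `|x|; rewrite ltr_norml => /andP[-> /ltW].
- move=> _ [[a b] /= _ <-].
  have [ab|ba] := leP a b; last by rewrite set_itv_ge ?measure0// bnd_simp -leNgt ltW.
  have -> : `]a, b]%classic = `]-oo, b]%classic `\` `]-oo, a]%classic :> set R.
    by rewrite -[RHS]setCK setCD setCitvl setUC -[LHS]setCK setCitv.
  have m1b : (m2 `]-oo, b]%classic < +oo)%E by rewrite -m12 fin.
  have sub : `]-oo, a]%classic `<=` `]-oo, b]%classic by apply: subset_itvl; rewrite bnd_simp.
  rewrite measureD//; last exact: fin.
  rewrite measureD//; rewrite !setIidr//.
  by congr (_ - _)%E; exact: m12.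
- by move=> n; exact: fin.
Qed.

Definition dfun (mu : probability R R) (x : R) : R := fine (mu `]-oo, x]%classic).

Section dfun.
Variable mu : probability R R.

Lemma dfun_bounds x : 0 <= dfun mu x <= 1.
Proof.
rewrite fine_ge0//= -lee_fin fineK ?fin_num_measure//.
exact: probability_le1.
Qed.

Let idR : R -> R := idfun.
Let idRV : {RV mu >-> R} := mfun_Sub (mem_set (@measurable_id _ R setT) : idR \in mfun).

Let cdfE x : cdf idRV x = mu `]-oo, x]%classic. Proof. by []. Qed.

Lemma dfun_mono : {homo dfun mu : x y / x <= y}.
Proof.
by move=> x y xy; rewrite fine_le ?fin_num_measure//; exact: (cdf_nondecreasing idRV).
Qed.

Lemma dfun_rc x (u : R) : dfun mu x < u -> exists2 e : R, 0 < e & forall y, y < x + e -> dfun mu y < u.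
Proof.
move=> xu.
have : dfun mu y @[y --> x^'+] --> dfun mu x.
  apply: fine_cvg; rewrite /dfun fineK ?fin_num_measure//.
  have -> : (fun y : R => mu `]-oo, y]%classic) = cdf idRV by [].
  rewrite -(cdfE x).
  have H := @cdf_right_continuous _ _ _ _ idRV. exact: (H x).
move=> /cvgrPdist_lt /(_ (u - dfun mu x)); rewrite subr_gt0 => /(_ xu).
rewrite near_withinE => /nbhs_ballP[e /= e0 He]; exists e => // y ye.
have [yx|xy] := leP y x; first by rewrite (le_lt_trans _ xu)// dfun_mono.
have := He y; rewrite /ball/= ltr0_norm ?subr_lt0// opprB ltrBlDl => /(_ ye xy).
rewrite distrC => /ltr_normlW.
by rewrite ltrD2r.
Qed.

Lemma dfun_gt (u : R) : u < 1 -> exists x, u < dfun mu x.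
Proof.
move=> u1; have : dfun mu x @[x --> +oo] --> (1 : R).
  by apply: fine_cvg; exact: (cvg_cdfy1 idRV).
move=> /cvgrPdist_lt /(_ (1 - u)); rewrite subr_gt0 => /(_ u1).
move=> [M [_ HM]]; exists (M + 1); have := HM (M + 1); rewrite ltrDl => /(_ ltr01).
by move=> /ltr_normlW; lra.
Qed.

Lemma dfun_lt (u : R) : 0 < u -> exists x, dfun mu x < u.
Proof.
move=> u0; have : dfun mu x @[x --> -oo] --> (0 : R).
  by apply: fine_cvg; exact: (cvg_cdfNy0 idRV).
move=> /cvgrPdist_lt /(_ u u0).
move=> [M [_ HM]]; exists (M - 1); have := HM (M - 1); rewrite ltrBlDr ltrDl => /(_ ltr01).
by rewrite sub0r normrN => /ltr_normlW.
Qed.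

End dfun.

Lemma is_derive_dfun_gauss (x : R) : is_derive x 1 (dfun gam) (npdf x).
Proof.
have -> : dfun gam = lint (cst 1).
  by apply/funext => y; rewrite /lint Rintegral_cst// mul1r.
by have := is_derive_lint x (@cst_continuous _ _ (1 : R)) (polybd_cst 1); rewrite mul1r.
Qed.

Lemma dfun_gauss_incr x y : x < y -> dfun gam x < dfun gam y.
Proof.
move=> xy; have [c [_ e]] := is_derive_mvt (ltW xy) is_derive_dfun_gauss.
by rewrite -subr_gt0 e mulr_gt0 ?npdf_gt0// subr_gt0.
Qed.

Lemma dfun_gauss_bounds x : 0 < dfun gam x < 1.
Proof.
have h1 : dfun gam (x - 1) < dfun gam x by apply: dfun_gauss_incr; rewrite ltrBlDr ltrDl.
have h2 : dfun gam x < dfun gam (x + 1) by apply: dfun_gauss_incr; rewrite ltrDl.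
have /andP[h3 _] := dfun_bounds gam (x - 1); have /andP[_ h4] := dfun_bounds gam (x + 1).
by rewrite (le_lt_trans h3)// (lt_le_trans h2).
Qed.

(** The quantile function of [mu] after the normal distribution function. Everything rests on the
    adjunction between [a z <= x] and [dfun gam z <= dfun mu x], where right continuity of [dfun mu]
    enters. *)
Lemma monotone_transport (mu : probability R R) : exists a : R -> R,
  [/\ {homo a : x y / x <= y}, measurable_fun setT a,
   (forall A, measurable A -> gam (a @^-1` A) = mu A) &
   (continuous (dfun mu) -> forall z, dfun mu (a z) = dfun gam z)].
Proof.
pose E z := [set x | dfun gam z <= dfun mu x]; pose a z := inf (E z).
have Ei z : has_inf (E z).
  have /andP[z0 z1] := dfun_gauss_bounds z; split.
    by have [x /ltW] := dfun_gt mu z1; exists x.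
  have [x xz] := dfun_lt mu z0; exists x => y /= zy.
  by rewrite leNgt; apply/negP => /ltW/(dfun_mono mu); rewrite leNgt (lt_le_trans xz).
have adj z x : (a z <= x) <-> (dfun gam z <= dfun mu x).
  split=> [ax|zx]; last exact: ge_inf (Ei z).2 _ zx.
  apply: (@le_trans _ _ (dfun mu (a z))); last exact: dfun_mono.
  rewrite leNgt; apply/negP => /dfun_rc[e e0 He].
  have [y yE ye] := inf_adherent e0 (Ei z).
  by move: yE; rewrite /E/= leNgt He.
have am : {homo a : x y / x <= y}.
  move=> z z' zz'; apply/adj; apply: (@le_trans _ _ (dfun gam z')); first exact: dfun_mono.
  exact/adj.
have ma : measurable_fun setT a by exact: nondecreasing_measurable.
exists a; split => //.
- pose amf : {mfun R >-> R} := mfun_Sub (mem_set ma : a \in mfun).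
  apply: (@measure_eq_rays (distribution gam amf) mu).
    by rewrite (le_lt_trans (probability_le1 _ _)) ?ltry.
  move=> x; rewrite /distribution/= /pushforward.
  have -> : a @^-1` `]-oo, x]%classic = [set z | dfun gam z <= dfun mu x].
    by apply/seteqP; split => z /=; rewrite in_itv/= => /adj.
  have /andP[F0 F1] := dfun_bounds mu x.
  rewrite -[RHS]fineK ?fin_num_measure// -/(dfun mu x).
  have [e0|F0'] := eqVneq (dfun mu x) 0.
    rewrite e0 (_ : [set z | _] = set0) ?measure0//.
    apply/seteqP; split => // z /=; rewrite leNgt.
    by have /andP[-> _] := dfun_gauss_bounds z.
  have [e1|F1'] := eqVneq (dfun mu x) 1.
    rewrite e1 (_ : [set z | _] = setT); first exact: probability_setT.
    apply/seteqP; split => // z _ /=; rewrite ltW//.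
    by have /andP[_ ->] := dfun_gauss_bounds z.
  have {}F0 : 0 < dfun mu x by rewrite lt_neqAle eq_sym F0' F0.
  have {}F1 : dfun mu x < 1 by rewrite lt_neqAle F1' F1.
  have [u Hu] := dfun_lt gam F0; have [v Hv] := dfun_gt gam F1.
  have uv : u <= v by rewrite leNgt; apply/negP => /dfun_gauss_incr; rewrite ltNge (ltW (lt_trans Hu Hv)).
  have cG : {within `[u, v], continuous (dfun gam)}.
    exact/continuous_subspaceT/is_derive_continuous/is_derive_dfun_gauss.
  have [|q _ qE] := IVT (v := dfun mu x) uv cG.
    by rewrite ge_min le_max (ltW Hu) (ltW Hv) orbT.
  have -> : [set z | dfun gam z <= dfun mu x] = `]-oo, q]%classic.
    apply/seteqP; split => z /=; rewrite in_itv/= -qE.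
      by move=> zq; rewrite leNgt; apply/negP => /dfun_gauss_incr; rewrite ltNge zq.
    exact: dfun_mono.
  by rewrite -qE /dfun fineK ?fin_num_measure.
(* If [dfun mu (a z)] exceeded [dfun gam z], continuity would preserve the excess at [a z - e / 2],
   contradicting the adjunction. *)
- move=> muc z; apply/eqP; rewrite eq_le; apply/andP; split; last exact/adj.
  rewrite leNgt; apply/negP => lt.
  have /cvgrPdist_lt /(_ (dfun mu (a z) - dfun gam z)) := muc (a z).
  rewrite subr_gt0 => /(_ lt)/nbhs_ballP[e /= e0 He].
  have : a z <= a z - e / 2.
    apply/adj; have := He (a z - e / 2); rewrite /ball/= opprB addrC subrK.
    rewrite gtr0_norm ?divr_gt0// => h; have {}h := h _; have /ltr_normlW := h ltac:(lra).
    by lra.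
  by lra.
Qed.

End quantile.

(** * Positive density close to the Edgeworth expansion *)

Section density_correction.
Variable R : realType.
Local Notation gam := (@std_normal R).

Let clip (x : R) : R := Num.max (- (1 / 4)) (Num.min (1 / 4) x).

Let clip_le x : `|clip x| <= 1 / 4.
Proof. by rewrite /clip ler_norml ge_max le_max lexx/= ge_min lexx; apply/andP; split => //; lra. Qed.

Let clip_norm x : `|clip x| <= `|x|.
Proof.
have h1 := ler_norm x; have h2 := ler_norm (- x); rewrite normrN in h2.
rewrite /clip ler_norml; case: (leP (1 / 4) x) => h3; case: (leP (- (1 / 4)) _) => h4;
  apply/andP; split; lra.
Qed.

(** Clipping acts only where [4 |x| > 1], so any number of factors [4 |x|] may be inserted. This
    turns the truncation into an error of arbitrarily high order. *)
Let clip_err k x : `|x - clip x| <= `|x| * (4 * `|x|) ^+ k.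
Proof.
have [x4|x4] := leP `|x| (1 / 4).
  have /andP[h1 h2] : - (1/4) <= x <= 1/4 by rewrite -ler_norml.
  by rewrite /clip (min_idPr h2) (max_idPr h1) subrr normr0 mulr_ge0 ?exprn_ge0 ?mulr_ge0.
apply: (@le_trans _ _ `|x|).
  have h1 := ler_norm x; have h2 := ler_norm (- x); rewrite normrN in h2.
  rewrite /clip ler_norml; case: (leP (1 / 4) x) => h3; case: (leP (- (1 / 4)) _) => h4;
    apply/andP; split; lra.
by rewrite ler_peMr// exprn_ege1//; lra.
Qed.

Let clip_cont : continuous clip.
Proof.
apply: (@lipschitz_continuous _ _ 1) => x y; rewrite mul1r.
have h1 := ler_norm (x - y); have h2 := ler_norm (y - x); rewrite distrC in h2.
have clipP (z : R) : [\/ z <= - (1 / 4) /\ clip z = - (1 / 4),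
    - (1 / 4) <= z <= 1 / 4 /\ clip z = z | 1 / 4 <= z /\ clip z = 1 / 4].
  have q : - (1 / 4) <= 1 / 4 :> R by lra.
  have [z4|z4] := leP z (1 / 4); last first.
    by apply: Or33; split; [exact: ltW|rewrite /clip (min_idPl (ltW z4)) (max_idPr q)].
  rewrite /clip (min_idPr z4).
  have [z3|z3] := leP z (- (1 / 4)); first by apply: Or31.
  by apply: Or32; split=> //; rewrite (ltW z3).
rewrite ler_norml; case: (clipP x) => -[h3 ->]; case: (clipP y) => -[h4 ->];
  apply/andP; split; lra.
Qed.

(** Clipping may disturb the mean, and the constant [c] restores it. Both shifts are at most [1/4],
    whence [1/2] and [3/2]. As [Q] has mean zero, [c] is the mean of the clipping error and is
    equally small. *)
Lemma density_correction (N k : nat) : exists (C : R) (m : nat), 0 <= C /\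
  forall A Q, hermite_comb N A Q -> exists rho : R -> R,
  [/\ continuous rho, (forall x, 1 / 2 <= rho x <= 3 / 2), Ex gam rho = 1,
    (forall x, `|1 - rho x| <= C * A * (1 + `|x|) ^+ m) &
    (forall x, `|1 + Q x - rho x| <= C * A ^+ k.+1 * (1 + `|x|) ^+ m)].
Proof.
have [C0 [n [C00 HC]]] := hermite_comb_bound R N.
pose e j : R := Ex gam (fun x => (1 + `|x|) ^+ j).
have e0 j : 0 <= e j by apply: Ex_ge0 => x; rewrite exprn_ge0// addr_ge0.
pose m := (n * k.+1)%N.
have nm : (n <= m)%N by rewrite /m leq_pmulr.
pose B := 4 ^+ k * C0 ^+ k.+1.
have B0 : 0 <= B by rewrite mulr_ge0// exprn_ge0.
have x1 (x : R) : 1 <= 1 + `|x| by rewrite lerDl.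
have p1 j (x : R) : 1 <= (1 + `|x|) ^+ j by rewrite exprn_ege1.
exists (C0 * (1 + e n) + B * (1 + e m)), m; split.
  by rewrite addr_ge0// mulr_ge0// addr_ge0.
move=> A Q HQ; have A0 : 0 <= A by case: HQ => c [c1 _]; exact: le_trans (c1 0%N).
have Qc := continuous_hermite_comb HQ; have QB := HC A Q HQ.
pose u x := clip (Q x); pose c := - Ex gam u.
have uc : continuous u.
  by move=> x; apply: (@continuous_comp _ _ _ Q clip); [exact: Qc|exact: clip_cont].
have mu := continuous_measurable uc.
have ui : integ gam u by apply: integ_le mu (fun x => clip_le (Q x)) (integ_cst _ _).
have Qi : integ gam Q by apply: gauss_integ (continuous_measurable Qc) (polybd_hermite_comb HQ).
have pi j : integ gam (fun x => (1 + `|x|) ^+ j) by exact: gauss_integ_pow.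
have c4 : `|c| <= 1 / 4.
  rewrite normrN -(Ex_cst gam (1 / 4)); apply: Ex_norm_le mu (integ_cst _ _) _ => x.
  exact: clip_le.
have cA : `|c| <= C0 * A * e n.
  rewrite normrN -ExZ//; apply: Ex_norm_le mu (integZ _ (pi n)) _ => x.
  exact: le_trans (clip_norm _) (QB x).
have errB x : `|Q x - u x| <= B * A ^+ k.+1 * (1 + `|x|) ^+ m.
  apply: (le_trans (clip_err k (Q x))).
  rewrite exprMn mulrCA -exprS.
  apply: (@le_trans _ _ (4 ^+ k * (C0 * A * (1 + `|x|) ^+ n) ^+ k.+1)).
    rewrite ler_wpM2l ?exprn_ge0// lerXn2r// nnegrE//.
    by rewrite mulr_ge0 ?exprn_ge0 ?mulr_ge0// (le_trans _ (x1 x)).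
  by rewrite !exprMn -exprM -/m /B !mulrA.
have cB : `|c| <= B * A ^+ k.+1 * e m.
  have -> : c = Ex gam (fun x => Q x - u x) by rewrite ExB// (Ex_hermite_comb HQ) sub0r.
  rewrite -ExZ//; apply: Ex_norm_le (integZ _ (pi m)) errB.
  by apply: measurable_funB => //; exact: continuous_measurable.
exists (fun x => 1 + u x + c); split.
- by move=> x; apply: cvgD; [apply: cvgD; [exact: cvg_cst|exact: uc]|exact: cvg_cst].
- move=> x; have := clip_le (Q x); rewrite -/(u x) ler_norml; move: c4; rewrite ler_norml.
  by move=> /andP[? ?] /andP[? ?]; apply/andP; split; lra.
- rewrite ExD; [|by apply: integD => //; exact: integ_cst|exact: integ_cst].
  by rewrite ExD// ?Ex_cst ?addrK//; exact: integ_cst.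
- move=> x.
  have -> : 1 - (1 + u x + c) = - (u x + c) by ring.
  rewrite normrN (le_trans (ler_normD _ _))//.
  have h1 : `|u x| <= C0 * A * (1 + `|x|) ^+ m.
    apply: (le_trans (clip_norm _)); apply: (le_trans (QB x)).
    by rewrite ler_wpM2l ?mulr_ge0// ler_weXn2l.
  have h2 : `|c| <= C0 * A * e n * (1 + `|x|) ^+ m.
    by rewrite (le_trans cA)// ler_peMr// !mulr_ge0.
  apply: (le_trans (lerD h1 h2)).
  rewrite -mulrDl ler_wpM2r ?exprn_ge0 ?addr_ge0//.
  rewrite [leRHS](_ : _ = C0 * A + C0 * A * e n + B * (1 + e m) * A); last by ring.
  by rewrite lerDl mulr_ge0// mulr_ge0// addr_ge0.
- move=> x.
  have -> : 1 + Q x - (1 + u x + c) = (Q x - u x) - c by ring.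
  rewrite (le_trans (ler_normB _ _))//.
  have h2 : `|c| <= B * A ^+ k.+1 * e m * (1 + `|x|) ^+ m.
    by rewrite (le_trans cB)// ler_peMr// !mulr_ge0 ?exprn_ge0.
  apply: (le_trans (lerD (errB x) h2)).
  rewrite -mulrDl ler_wpM2r ?exprn_ge0 ?addr_ge0//.
  rewrite [leRHS](_ : _ = B * A ^+ k.+1 + B * A ^+ k.+1 * e m + C0 * (1 + e n) * A ^+ k.+1); last by ring.
  by rewrite lerDl mulr_ge0 ?exprn_ge0// mulr_ge0// addr_ge0.
Qed.

End density_correction.

Section density_measure.
Variable R : realType.
Local Notation gam := (@std_normal R).
Local Notation lam := (@lebesgue_measure R).
Variable rho : R -> R.
Hypotheses (rhoc : measurable_fun setT rho) (rho0 : forall x, 0 <= rho x)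
  (rhoi : integ gam rho) (rho1 : Ex gam rho = 1).

Definition dens (A : set R) : \bar R := (\int[gam]_(x in A) (rho x)%:E)%E.

Let dens0 : dens set0 = 0%E. Proof. by rewrite /dens integral_set0. Qed.

Let dens_ge0 A : (0 <= dens A)%E.
Proof. by apply: integral_ge0 => x _; rewrite lee_fin. Qed.

Let dens_sigma_additive : semi_sigma_additive dens.
Proof.
move=> /= A mA tA mUA; rewrite /dens/= integral_bigcup//=; last first.
  exact: (integrableS _ _ (subsetT _) rhoi).
apply: is_cvg_ereal_nneg_natsum_cond => n _ _.
by apply: integral_ge0 => /= x ?; rewrite lee_fin.
Qed.

#[local] HB.instance Definition _ := isMeasure.Build _ R R dens dens0 dens_ge0 dens_sigma_additive.

Let densT : dens setT = 1%E.
Proof.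
rewrite /dens -[LHS]fineK; last exact: integrable_fin_num.
by congr EFin; exact: rho1.
Qed.

#[local] HB.instance Definition _ := @Measure_isProbability.Build _ R R dens densT.

Lemma density_measure : exists nu : probability R R, 
  (forall x, dfun nu x = lint rho x) /\
  forall f : R -> R, measurable_fun setT f -> integ gam (fun x => f x * rho x) ->
    integ nu f /\ Ex nu f = Ex gam (fun x => f x * rho x).
Proof.
exists dens; split => // f mf fi.
have ge0 (g : R -> R) : measurable_fun setT g -> (forall x, 0 <= g x) ->
    (\int[dens]_x (g x)%:E = \int[gam]_x (g x * rho x)%:E)%E.
  move=> mg g0.
  rewrite (@ge0_integral_density _ _ (fun x => rho x * npdf x))//; last 4 first.
  - by apply: measurable_funM => //; exact: measurable_npdf.
  - by move=> x; rewrite mulr_ge0// npdf_ge0.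
  - move=> A mA; rewrite /= /dens integral_mkcond ge0_integral_gauss; last 2 first.
    + apply/(measurable_restrictT _ mA)/measurable_funTS; exact/measurable_EFinP.
    + by move=> x; rewrite patchE; case: ifP => // _; rewrite lee_fin.
    rewrite [RHS]integral_mkcond; apply: eq_integral => x _.
    by rewrite !patchE; case: ifP => _; rewrite ?mul0e// EFinM.
  - exact/measurable_EFinP.
  - rewrite ge0_integral_gauss; last 2 first.
    + by apply/measurable_EFinP/measurable_funM.
    + by move=> x; rewrite lee_fin mulr_ge0.
    by apply: eq_integral => x _; rewrite -!EFinM mulrA.
have nfi : (\int[dens]_x `|f x|%:E = \int[gam]_x `|f x * rho x|%:E)%E.
  rewrite ge0//; last exact: measurableT_comp.
  by apply: eq_integral => x _; rewrite normrM (ger0_norm (rho0 x)).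
have fi' : integ dens f.
  apply/integrableP; split; first exact/measurable_EFinP.
  by move/integrableP : fi => [_]; rewrite /= nfi.
split => //.
have mnf : measurable_fun setT (fun x => `|f x|) by exact: measurableT_comp.
(* [f + |f|] and [|f|] are nonnegative, so the signed identity follows by subtraction. *)
have p1 : Ex dens (fun x => f x + `|f x|) = Ex gam (fun x => f x * rho x + `|f x * rho x|).
  rewrite /Ex /Rintegral ge0; last 2 first.
  - exact: measurable_funD.
  - by move=> x; have := ler_norm (- f x); rewrite normrN; lra.
  by congr fine; apply: eq_integral => x _; rewrite mulrDl normrM (ger0_norm (rho0 x)).
have p2 : Ex dens (fun x => `|f x|) = Ex gam (fun x => `|f x * rho x|).
  by rewrite /Ex /Rintegral nfi.
have := p1; rewrite ExD//; last exact: integ_norm.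
rewrite ExD//; last exact: integ_norm.
by rewrite p2 => /addIr.
Qed.

End density_measure.

Section density_transport.
Variable R : realType.
Local Notation gam := (@std_normal R).

(* With [D] the difference of the two distribution functions, [b z - z] times
   the normal density at the larger of [|z|], [|b z|] is at most [2 |D|] there,
   while [D] itself is bounded by the density times a polynomial. *)
Lemma density_transport (m : nat) : exists2 C : R, 0 <= C &
  forall (A : R) (rho : R -> R), continuous rho -> (forall x, 1 / 2 <= rho x <= 3 / 2) ->
  Ex gam rho = 1 -> (forall x, `|1 - rho x| <= A * (1 + `|x|) ^+ m) ->
  exists b : R -> R, [/\ {homo b : x y / x <= y}, measurable_fun setT b,
    (forall f, measurable_fun setT f -> polybd f ->
      integ gam (fun z => f (b z)) /\ Ex gam (fun z => f (b z)) = Ex gam (fun x => f x * rho x)) &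
    (forall z, `|b z - z| <= C * A * ((1 + `|z|) ^+ m + (1 + `|b z|) ^+ m))].
Proof.
have [C [C0 HC]] := lint_bound R m.
exists (2 * C); first by rewrite mulr_ge0// ltW.
move=> A rho rhoc rhoB rho1 rhoA.
have A0 : 0 <= A.
  by have := rhoA 0; rewrite normr0 addr0 expr1n mulr1; exact: le_trans.
have rho0 x : 0 <= rho x by have /andP[+ _] := rhoB x; lra.
have mrho := continuous_measurable rhoc.
have rhop : polybd rho.
  exists (3 / 2), 0%N; split; first by lra.
  by move=> x; rewrite expr0 mulr1 ger0_norm//; case/andP: (rhoB x).
have rhoi := gauss_integ mrho rhop.
have [nu [nuF nuE]] := density_measure mrho rho0 rhoi rho1.
have dF (x : R) : is_derive x 1 (dfun nu) (rho x * npdf x).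
  have -> : dfun nu = lint rho by apply/funext.
  exact: is_derive_lint.
have [b [bm mb bE bF]] := monotone_transport nu.
have {}bF := bF (is_derive_continuous dF).
exists b; split => //.
  move=> f mf fp.
  have fi : integ gam (fun x => f x * rho x).
    by apply: gauss_integ; [exact: measurable_funM|exact: polybd_mul].
  have [fi1 fE1] := nuE f mf fi.
  split; first exact/(integ_image mb bE).
  by rewrite -fE1; exact: (Ex_image mb bE).
move=> z; set y := b z.
pose D x := dfun gam x - dfun nu x.
have DE x : D x = lint (fun x => 1 - rho x) x.
  rewrite /D nuF (_ : dfun gam x = lint (cst 1) x); last by rewrite /lint Rintegral_cst// mul1r.
  rewrite /lint -RintegralB//.
    exact: (integrableS _ _ (subsetT _) (integ_cst gam 1)).
  exact: (integrableS _ _ (subsetT _) rhoi).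
have DB x : `|D x| <= C * A * (1 + `|x|) ^+ m * npdf x.
  rewrite DE; apply: HC => //; first exact: measurable_funB.
  by rewrite ExB// ?Ex_cst ?rho1 ?subrr//; exact: integ_cst.
(* The distribution function of [nu] at [y] equals the normal one at [z], so each of the two
   increments between [z] and [y] is a value of [D]. *)
have Dy : dfun gam y - dfun gam z = D y by rewrite /D /y bF.
have Dz : dfun nu y - dfun nu z = D z by rewrite /D /y bF.
have P0 x : 0 <= (1 + `|x|) ^+ m by rewrite exprn_ge0// addr_ge0.
have CA0 : 0 <= C * A by rewrite mulr_ge0// ltW.
(* Both points lie in [[-|t|, |t|]], where the normal density is at least its value at [t]. *)
have mvt (F dF' : R -> R) (t c : R) : 0 < c -> (forall x : R, is_derive x 1 F (dF' x)) ->
    (forall x, `|x| <= `|t| -> c * npdf t <= dF' x) -> `|y| <= `|t| -> `|z| <= `|t| ->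
    c * npdf t * `|y - z| <= `|F y - F z|.
  move=> c0 Fd Fc yt zt.
  have key u v : u <= v -> `|u| <= `|t| -> `|v| <= `|t| -> c * npdf t * `|v - u| <= `|F v - F u|.
    move=> uv ut vt; have [s [/andP[us sv] ->]] := is_derive_mvt uv Fd.
    rewrite normrM ler_wpM2r// (le_trans _ (ler_norm _))// Fc//.
    rewrite ler_norml; move: ut vt; rewrite !ler_norml => /andP[? _] /andP[_ ?].
    by apply/andP; split; [exact: (le_trans _ us)|exact: (le_trans sv)].
  have [yz|/ltW zy] := leP y z; last exact: key.
  by rewrite distrC [leRHS]distrC; exact: key.
have nD (t c : R) : c * npdf t * `|y - z| <= C * A * (1 + `|t|) ^+ m * npdf t -> 
    c * `|y - z| <= C * A * (1 + `|t|) ^+ m.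
  by rewrite mulrAC ler_pM2r// npdf_gt0.
have [zy|/ltW yz] := leP `|z| `|y|.
  have h : 1 * npdf y * `|y - z| <= `|dfun gam y - dfun gam z|.
    apply: (mvt _ _ y 1 ltr01 (@is_derive_dfun_gauss R)) => // x xy.
    by rewrite mul1r npdf_decr.
  rewrite Dy in h; have {h} := nD _ _ (le_trans h (DB y)); rewrite mul1r => /le_trans; apply.
  have h1 : 0 <= C * A * (1 + `|z|) ^+ m by rewrite mulr_ge0.
  have h2 : 0 <= C * A * (1 + `|y|) ^+ m by rewrite mulr_ge0.
  by rewrite -[2 * C * A]mulrA -[leRHS]mulrA mulrDr; lra.
have h : 1 / 2 * npdf z * `|y - z| <= `|dfun nu y - dfun nu z|.
  have h12 : (0 : R) < 1 / 2 by lra.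
  apply: (mvt _ _ z _ h12 dF) => //.
  move=> x xz; apply: ler_pM; rewrite ?npdf_ge0 ?npdf_decr//; last by case/andP: (rhoB x).
rewrite Dz in h; have {h} := nD _ _ (le_trans h (DB z)).
have h1 : 0 <= C * A * (1 + `|z|) ^+ m by rewrite mulr_ge0.
have h2 : 0 <= C * A * (1 + `|y|) ^+ m by rewrite mulr_ge0.
rewrite -[2 * C * A]mulrA -[leRHS]mulrA mulrDr; lra.
Qed.

End density_transport.

(** * Coupling with the normal law *)

Section coupling.
Variable R : realType.
Local Notation gam := (@std_normal R).

Lemma exprD_le (x y : R) n : 0 <= x -> 0 <= y -> (x + y) ^+ n <= 2 ^+ n * (x ^+ n + y ^+ n).
Proof.
move=> x0 y0.
have m0 : 0 <= Num.max x y by rewrite le_max x0.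
apply: (@le_trans _ _ ((2 * Num.max x y) ^+ n)).
  rewrite lerXn2r// ?nnegrE ?addr_ge0// ?mulr_ge0// mulr_natl mulr2n.
  by rewrite lerD// le_max lexx ?orbT.
rewrite exprMn ler_wpM2l ?exprn_ge0//.
by case: (leP x y) => _; rewrite ?lerDl ?lerDr exprn_ge0.
Qed.

(** The moment of [W] may grow like [lam^-(p+4)], because the truncation level can be a large power
    of [1/lam]. The map [a] encodes the coupling of [a(Z)] with [Z] for [Z] standard normal. *)
Lemma stein_coupling (p : nat) (C0 C1 : R) : (0 < p)%N -> 0 <= C0 -> 0 <= C1 ->
  exists2 C : R, 0 <= C &
  forall d (Om : measurableType d) (P : probability Om R) (W : Om -> R) (lam : R),
  stein_approx P W p C0 lam -> 0 < lam ->
  integ P (fun w => `|W w| ^+ (p + 2)) ->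
  Ex P (fun w => `|W w| ^+ (p + 2)) <= C1 * lam^-1 ^+ (p + 4) ->
  exists a : R -> R, [/\ measurable_fun setT a,
    (forall A, measurable A -> gam (a @^-1` A) = P (W @^-1` A)),
    integ gam (fun z => `|a z - z| ^+ p) &
    Ex gam (fun z => `|a z - z| ^+ p) <= C * lam ^+ p].
Proof.
case: p => // p' _ C00 C10; set p := p'.+1.
have [N [C' [C'0 HE]]] := @edgeworth R p C0 p C00.
(* The exponent of the clipping error is [(p + 4)(p - 1) + p]: the first summand will cancel
   [M^(p-1)], the second leaves [lam^p]. *)
have [Cd [m [Cd0 HD]]] := density_correction R N ((p + 4) * p' + p').
have [Ct Ct0 HT] := density_transport R m.
have [Cw Cw0 HW] := @transport_test R p isT.
pose e j : R := Ex gam (fun x => (1 + `|x|) ^+ j).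
have e0 j : 0 <= e j by apply: Ex_ge0 => x; rewrite exprn_ge0// addr_ge0.
(* [C2], [C3] and [C4] belong to the three parts of [G]: the difference of expectations of [h], the
   truncation tail, and the distance of [b] from the identity. *)
pose C2 := Cw * (C' * Cw + Cw * Cd * C' ^+ ((p + 4) * p' + p').+1 * e m.+1).
pose C3 := Cw * (C1 + 3 / 2 * e (p + 2)%N).
pose C4 := (Ct * (Cd * C')) ^+ p * 2 ^+ p * (e (m * p)%N + 3 / 2 * e (m * p)%N).
have C20 : 0 <= C2.
  by rewrite mulr_ge0// addr_ge0// ?mulr_ge0// ?mulr_ge0// ?exprn_ge0// ?mulr_ge0.
have C30 : 0 <= C3 by rewrite mulr_ge0// addr_ge0// mulr_ge0.
have C40 : 0 <= C4.
  by rewrite mulr_ge0//; [rewrite mulr_ge0 ?exprn_ge0// !mulr_ge0|rewrite addr_ge0// mulr_ge0].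
exists (2 ^+ p * (C2 + C3 + C4)); first by rewrite mulr_ge0 ?exprn_ge0// addr_ge0// addr_ge0.
move=> d Om P W lam H lam0 Wi WE.
have /andP[_ lam1] := sa_lam H; have mW := sa_meas H.
pose Wm : {RV P >-> R} := mfun_Sub (mem_set mW : W \in mfun).
pose mu := distribution P Wm.
have WP A : measurable A -> P (W @^-1` A) = mu A by [].
have [a [am ma aP _]] := monotone_transport mu.
have [Q [HQ HEQ]] := HE _ _ _ _ _ H p (leqnn p) (leqnn p).
have [rho [rhoc rhoB rho1 rhoA rhoQ]] := HD _ _ HQ.
have [b [bm mb bE bz]] := HT _ _ rhoc rhoB rho1 rhoA.
(* [M] is large enough for the truncation error [M^-2 E|W|^(p+2)] to be
   [O(lam^p)]; the clipping error, a high power of [lam], absorbs the factor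
   [M^(p-1)] in the size of the test function. *)
pose M : R := lam^-1 ^+ (p + 4); have M0 : 0 < M by rewrite exprn_gt0// invr_gt0.
have [h [hj hM hab]] := HW a b M am bm M0.
have lamM j : lam ^+ ((p + 4) * j) * M ^+ j = 1.
  by rewrite /M -exprM -exprMn divff ?expr1n// gt_eqF.
have lamW i j : (i <= j)%N -> lam ^+ j <= lam ^+ i.
  by move=> ij; rewrite ler_wiXn2l// ltW.
have hc := jet_continuous hj (leq0n _); have hp := jet_polybd hj (leq0n _).
have mh := continuous_measurable hc.
have mrho := continuous_measurable rhoc.
have tra f : measurable_fun setT f -> integ P (fun w => f (W w)) ->
    integ gam (fun z => f (a z)) /\ Ex gam (fun z => f (a z)) = Ex P (fun w => f (W w)).
  move=> mf fi; have fmu : integ mu f by apply/(integ_image mW WP).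
  split; first exact/(integ_image ma aP).
  by rewrite (Ex_image ma aP fmu) -(Ex_image mW WP fmu).
have [hai haE] := tra (h 0%N) mh (sa_int H hj (leq_pred p)).
have mpow j : measurable_fun setT (fun x : R => `|x| ^+ j).
  apply: measurable_funX; apply: continuous_measurable; exact: norm_continuous.
have [api apE] := tra _ (mpow (p + 2)%N) Wi.
have [hbi hbE] := bE _ mh hp.
have mpow1 j : measurable_fun setT (fun x : R => (1 + `|x|) ^+ j).
  by apply: measurable_funX; apply: measurable_funD => //; exact: measurableT_comp.
have pp1 j : polybd (fun x : R => (1 + `|x|) ^+ j).
  by exists 1, j; split => // x; rewrite mul1r ger0_norm// exprn_ge0// addr_ge0.
have pi j : integ gam (fun x => (1 + `|x|) ^+ j) by exact: gauss_integ_pow.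
have bpow j : integ gam (fun z => (1 + `|b z|) ^+ j) /\ Ex gam (fun z => (1 + `|b z|) ^+ j) <= 3 / 2 * e j.
  have [i1 e1] := bE _ (mpow1 j) (pp1 j); split => //; rewrite e1 -ExZ//.
  apply: Ex_le; [|exact: integZ|].
    have rp : polybd rho by exists (3/2), 0%N; split => [|x]; [lra|
      rewrite expr0 mulr1; have /andP[? ?] := rhoB x; rewrite ger0_norm//; lra].
    by apply: gauss_integ; [exact: measurable_funM|exact: polybd_mul].
  move=> x; rewrite mulrC ler_wpM2r ?exprn_ge0 ?addr_ge0//.
  by case/andP: (rhoB x).
pose G z : R := 2 ^+ p * ((Cw * (h 0%N (b z) - h 0%N (a z)) +
   Cw * M ^- 2 * (`|a z| ^+ (p + 2) + (1 + `|b z|) ^+ (p + 2))) +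
   (Ct * (Cd * (C' * lam))) ^+ p * 2 ^+ p * ((1 + `|z|) ^+ (m * p) + (1 + `|b z|) ^+ (m * p))).
have i1 : integ gam (fun z => Cw * (h 0%N (b z) - h 0%N (a z))) by apply/integZ/integB.
have i2 : integ gam (fun z => Cw * M ^- 2 * (`|a z| ^+ (p + 2) + (1 + `|b z|) ^+ (p + 2))).
  by apply/integZ/integD => //; exact: (bpow _).1.
have i3 : integ gam (fun z => (Ct * (Cd * (C' * lam))) ^+ p * 2 ^+ p * ((1 + `|z|) ^+ (m * p) + (1 + `|b z|) ^+ (m * p))).
  by apply/integZ/integD => //; exact: (bpow _).1.
have Gi : integ gam G by apply/integZ/integD => //; exact: integD.
have CC0 : 0 <= Ct * (Cd * (C' * lam)) by rewrite !mulr_ge0// ltW.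
have G_ge z : `|a z - z| ^+ p <= G z.
  have -> : a z - z = (a z - b z) + (b z - z) by ring.
  apply: (@le_trans _ _ ((`|a z - b z| + `|b z - z|) ^+ p)).
    by rewrite lerXn2r// ?nnegrE ?addr_ge0// ler_normD.
  apply: (le_trans (exprD_le _ (normr_ge0 _) (normr_ge0 _))).
  rewrite /G ler_wpM2l ?exprn_ge0// lerD//.
    apply: (le_trans (hab z)); rewrite lerD2l ler_wpM2l//.
      by rewrite mulr_ge0// invr_ge0 exprn_ge0// ltW.
    by rewrite lerD2l lerXn2r ?nnegrE ?addr_ge0// lerDr.
  apply: (@le_trans _ _ ((Ct * (Cd * (C' * lam)) * ((1 + `|z|) ^+ m + (1 + `|b z|) ^+ m)) ^+ p)).
    by rewrite lerXn2r// nnegrE mulr_ge0// addr_ge0// exprn_ge0// addr_ge0.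
  rewrite exprMn -mulrA ler_wpM2l ?exprn_ge0// !exprM.
  by apply: exprD_le; rewrite exprn_ge0// addr_ge0.
have mG : measurable_fun setT (fun z => `|a z - z| ^+ p).
  by apply: measurable_funX; apply: measurableT_comp => //; exact: measurable_funB.
have ai : integ gam (fun z => `|a z - z| ^+ p).
  by apply: integ_le mG _ Gi => z; rewrite ger0_norm// exprn_ge0.
exists a; split => //.
apply: (le_trans (Ex_le ai Gi G_ge)).
rewrite /G ExZ; last by apply: integD => //; exact: integD.
rewrite -mulrA ler_wpM2l ?exprn_ge0// mulrDl ExD//; last exact: integD.
rewrite ExD// mulrDl lerD// ?lerD//.
- rewrite ExZ ?ExB//; last exact: integB.
  (* The integral of [h * rho] and [E h(W)] are compared through the Gaussian integral of
     [h * (1 + Q)]. *)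
  rewrite /C2 -mulrA ler_wpM2l// hbE haE.
  have Qc := continuous_hermite_comb HQ; have Qp := polybd_hermite_comb HQ.
  have mQ := continuous_measurable Qc.
  have iQ : integ gam (fun x => h 0%N x * (1 + Q x)).
    apply: gauss_integ; first by apply: measurable_funM => //; exact: measurable_funD.
    by apply: polybd_mul => //; apply: polybd_add => //; exact: polybd_cst.
  have E1 := HEQ _ _ hj; rewrite distrC in E1; have {}E1 := le_trans (ler_norm _) E1.
  have E2 : `|Ex gam (fun x => h 0%N x * (1 + Q x - rho x))| <=
      Cw * Cd * C' ^+ ((p + 4) * p' + p').+1 * e m.+1 * lam ^+ p.
    pose K := Cw * M ^+ p' * (Cd * (C' * lam) ^+ ((p + 4) * p' + p').+1).
    apply: (@le_trans _ _ (K * e m.+1)).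
      rewrite -ExZ//; apply: Ex_norm_le; [|exact: integZ|].
        apply: measurable_funM => //; apply: measurable_funB => //; exact: measurable_funD.
      move=> x; rewrite normrM exprS.
      have -> : K * ((1 + `|x|) * (1 + `|x|) ^+ m) = (Cw * M ^+ p' * (1 + `|x|)) *
        (Cd * (C' * lam) ^+ ((p + 4) * p' + p').+1 * (1 + `|x|) ^+ m) by rewrite /K; ring.
      apply: ler_pM => //; apply: le_trans (hM x) _.
      by rewrite ler_wpM2l ?lerDr// mulr_ge0// exprn_ge0// ltW.
    rewrite [K * _]mulrC [leRHS]mulrAC [leRHS]mulrC ler_wpM2l//.
    rewrite /K exprMn -addnS -/p !(exprD _ _ p).
    have := lamM p'; move: (lam ^+ (_ * p')) (M ^+ p') (lam ^+ p) => x y t xy.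
    by rewrite le_eqVlt; apply/orP; left; apply/eqP; ring: xy.
  have E3 : Ex gam (fun x => h 0%N x * rho x) = Ex gam (fun x => h 0%N x * (1 + Q x)) -
      Ex gam (fun x => h 0%N x * (1 + Q x - rho x)).
    have irho : integ gam (fun x => h 0%N x * rho x).
      have rp : polybd rho by exists (3/2), 0%N; split => [|x]; [lra|
        rewrite expr0 mulr1; have /andP[? ?] := rhoB x; rewrite ger0_norm//; lra].
      by apply: gauss_integ; [exact: measurable_funM|exact: polybd_mul].
    have -> : (fun x => h 0%N x * (1 + Q x - rho x)) =
        (fun x => h 0%N x * (1 + Q x) - h 0%N x * rho x).
      by apply/funext => x; rewrite mulrBr.
    by rewrite ExB// subKr.
  rewrite E3 mulrDl; rewrite -normrN in E2.
  by have := lerD E1 (le_trans (ler_norm _) E2); rewrite addrAC.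
- rewrite ExZ; last by apply: integD => //; exact: (bpow _).1.
  rewrite /C3 -!mulrA ler_wpM2l// ExD//; last exact: (bpow _).1.
  have M2 : M ^- 2 = lam ^+ (p + 4) * lam ^+ (p + 4).
    by rewrite /M exprVn expr2 invfM invrK.
  have M20 : 0 <= M ^- 2 by rewrite invr_ge0 exprn_ge0// ltW.
  rewrite mulrDr mulrDl lerD//.
    rewrite apE; apply: (le_trans (ler_wpM2l M20 WE)).
    rewrite M2 mulrCA ler_wpM2l// -mulrA -exprMn divff ?gt_eqF// expr1n mulr1.
    by apply: lamW; rewrite leq_addr.
  apply: (le_trans (ler_wpM2l M20 (bpow _).2)); rewrite [3 * (_ * _)]mulrA mulrC.
  apply: ler_wpM2l; first by rewrite mulr_ge0.
  by rewrite M2 -exprD; apply: lamW; rewrite -addnA leq_addr.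
- rewrite ExZ; last by apply: integD => //; exact: (bpow _).1.
  rewrite ExD//; last exact: (bpow _).1.
  have -> : (Ct * (Cd * (C' * lam))) ^+ p = (Ct * (Cd * C')) ^+ p * lam ^+ p.
    by rewrite -exprMn; congr (_ ^+ _); ring.
  rewrite (_ : C4 * lam ^+ p = (Ct * (Cd * C')) ^+ p * lam ^+ p * 2 ^+ p *
    (e (m * p)%N + 3 / 2 * e (m * p)%N)); last by rewrite /C4; ring.
  apply: ler_wpM2l; last by rewrite lerD2l (bpow _).2.
  by rewrite !mulr_ge0 ?exprn_ge0 ?mulr_ge0// ltW.
Qed.

End coupling.

(** * Mixing and local dependence *)

Section independence.
Variable R : realType.

(** The product rule on rectangles identifies the joint law with the product measure, and Fubini's
    theorem separates the integral of [x * y]. *)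
Lemma indep_expectation d (Om : measurableType d) (P : probability Om R) (f g : Om -> R) :
  integ P f -> integ P g ->
  (forall A B, measurable A -> measurable B ->
     P (f @^-1` A `&` g @^-1` B) = P (f @^-1` A) * P (g @^-1` B))%E ->
  Ex P (fun w => f w * g w) = Ex P f * Ex P g.
Proof.
move=> fi gi fg; have mf := integ_measurable fi; have mg := integ_measurable gi.
pose fm : {RV P >-> R} := mfun_Sub (mem_set mf : f \in mfun).
pose gm : {RV P >-> R} := mfun_Sub (mem_set mg : g \in mfun).
pose m1 := distribution P fm; pose m2 := distribution P gm.
have mfg : measurable_fun setT (fun w => (f w, g w)) by exact: measurable_fun_pair.
pose fgm : {mfun Om >-> (R * R)%type} := mfun_Sub (mem_set mfg : (fun w => (f w, g w)) \in mfun).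
pose Q := distribution P fgm.
have QE X : measurable X -> (m1 \x m2)%E X = Q X.
  by apply: product_measure_unique => A B mA mB; exact: fg.
pose h (z : R * R) := z.1 * z.2.
have mh : measurable_fun setT h by apply: measurable_funM; [exact: measurable_fst|exact: measurable_snd].
have mhE : measurable_fun setT (EFin \o h) by exact/measurable_EFinP.
have fm1 A : measurable A -> P (f @^-1` A) = m1 A by [].
have gm2 A : measurable A -> P (g @^-1` A) = m2 A by [].
have idm : measurable_fun setT (fun x : R => x) by exact: measurable_id.
have mnorm : measurable_fun setT (fun x : R => `|x|).
  by apply: continuous_measurable; exact: norm_continuous.
have f1 : integ m1 (fun x => x) by exact/(integ_image mf fm1 idm).
have g1 : integ m2 (fun x => x) by exact/(integ_image mg gm2 idm).
have nE (x : R) : (\int[m2]_y `|(h (x, y))%:E| = `|x|%:E * (Ex m2 (fun y => `|y|))%:E)%E.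
  rewrite /h /=; under eq_integral do rewrite normrM EFinM.
  rewrite ge0_integralZl//=; last exact/measurable_EFinP.
  rewrite /Ex /Rintegral fineK//.
  by apply: (integrable_fin_num _ (integ_norm g1)).
have hi : (m1 \x m2)%E.-integrable setT (EFin \o h).
  apply/integrable12ltyP => //=; under eq_integral do rewrite nE.
  rewrite ge0_integralZr//=; last 2 first.
  - exact/measurable_EFinP.
  - by rewrite lee_fin; exact: Ex_ge0.
  apply: lte_mul_pinfty => //; [exact: integral_ge0|exact: (integrable_fin_num _ (integ_norm f1))|].
  exact: ltry.
have iQ : integ Q h.
  apply/integrableP; split => //.
  move/integrableP : hi => [_]; congr (_ < _)%E.
  by apply: eq_measure_integral => A mA _; exact: QE.
have fgQ A : measurable A -> P ((fun w => (f w, g w)) @^-1` A) = Q A by [].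
transitivity (Ex Q h); first exact: (Ex_image mfg fgQ iQ).
have -> : Ex P f = Ex m1 (fun x => x) by exact: (Ex_image mf fm1 f1).
have -> : Ex P g = Ex m2 (fun x => x) by exact: (Ex_image mg gm2 g1).
have hE (x : R) : (\int[m2]_y (h (x, y))%:E = x%:E * (Ex m2 (fun y => y))%:E)%E.
  rewrite /h /=; under eq_integral do rewrite EFinM.
  by rewrite integralZl//= /Ex /Rintegral fineK//; exact: (integrable_fin_num _ g1).
have -> : Ex Q h = fine (\int[m1 \x m2]_z (h z)%:E)%E.
  by congr fine; apply/esym/eq_measure_integral => A mA _; exact: QE.
have -> : (\int[m1 \x m2]_z (h z)%:E = \int[m1]_x (x%:E * (Ex m2 (fun y => y))%:E))%E.
  by rewrite -integral12_prod_meas1//=; apply: eq_integral => x _; rewrite -hE.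
rewrite integralZr//= fineM//; exact: (integrable_fin_num _ f1).
Qed.

End independence.

Section mixing_independence.
Context {dd : measure_display} {Omega : measurableType dd} {R : realType}.
Variables (P : probability Omega R) (d : nat) (T : {fset 'rV[int]_d}) (X : T -> {RV P >-> R}).

Lemma alpha_coef0_indep q l (U1 U2 : {set T}) (E F : set Omega) :
  alpha_coef X q l = 0%E -> (#|U1| <= q)%N -> (l%:R%:E <= @set_dist R d T U1 U2)%E ->
  measurable E -> measurable F ->
  sigma_field X U1 E -> sigma_field X U2 F -> P (E `&` F) = (P E * P F)%E.
Proof.
move=> a0 U1q U12 mE mF sE sF.
have : (`|P (E `&` F) - P E * P F| <= 0)%E.
  rewrite -a0 /alpha_coef le_max; apply/orP; right.
  apply: (@le_trans _ _ (alpha_mixing P (sigma_field X U1) (sigma_field X U2))).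
    by apply: ereal_sup_ubound; exists E => //; exists F.
  by apply: ereal_sup_ubound; exists U1, U2.
have fin (S : set Omega) : measurable S -> P S = (fine (P S))%:E.
  by move=> mS; rewrite fineK ?fin_num_measure.
rewrite (fin _ mE) (fin _ mF) (fin _ (measurableI _ _ mE mF)).
by rewrite -EFinM -EFinB lee_fin normr_le0 subr_eq0 => /eqP ->.
Qed.

Variables (U : {set T}) (c : R).
Local Notation G := (\bigcup_(i in [set` U]) preimage_set_system setT (X i) measurable).

Lemma sigma_field_fun (f : Omega -> R) (A : set R) :
  @measurable_fun _ _ (g_sigma_algebraType G) R setT f -> measurable A ->
  sigma_field X U (f @^-1` A).
Proof. by move=> mf mA; have := mf measurableT A mA; rewrite setTI. Qed.

Lemma sigma_field_X i : i \in U ->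
  @measurable_fun _ _ (g_sigma_algebraType G) R setT (fun w => c * X i w).
Proof.
move=> iU; apply: measurable_funM => //.
move=> _ A mA; apply: sub_sigma_algebra; exists i => //; exists A => //.
Qed.

Lemma sigma_field_Prod (s : seq T) : {subset s <= U} ->
  @measurable_fun _ _ (g_sigma_algebraType G) R setT (Prod (fun i w => c * X i w) s).
Proof.
elim: s => [|i s IH] sU.
  by rewrite (_ : Prod _ _ = cst 1)//; apply/funext => w; rewrite /Prod big_nil.
rewrite (_ : Prod _ _ = fun w => (c * X i w) * Prod (fun i w => c * X i w) s w); last first.
  by apply/funext => w; rewrite /Prod big_cons.
apply: measurable_funM; first by apply: sigma_field_X; rewrite sU ?mem_head.
by apply: IH => j js; rewrite sU// in_cons js orbT.
Qed.

Lemma sigma_field_SumY :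
  @measurable_fun _ _ (g_sigma_algebraType G) R setT (SumY (fun i w => c * X i w) U).
Proof.
have : {subset enum U <= U} by move=> i; rewrite mem_enum.
rewrite (_ : SumY _ _ = fun w => \sum_(i <- enum U) c * X i w); last first.
  by apply/funext => w; rewrite /SumY big_enum.
elim: (enum U) => [|i s IH] sU.
  by rewrite (_ : (fun w => _) = cst 0)//; apply/funext => w; rewrite big_nil.
rewrite (_ : (fun w => _) = fun w => c * X i w + \sum_(i <- s) c * X i w); last first.
  by apply/funext => w; rewrite big_cons.
apply: measurable_funD; first by apply: sigma_field_X; rewrite sU ?mem_head.
by apply: IH => j js; rewrite sU// in_cons js orbT.
Qed.

End mixing_independence.

(** * Neighbourhoods in the integer lattice *)

Section lattice.
Variables (d : nat) (T : {fset 'rV[int]_d}).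

Definition lattice_nbh (r : nat) (i : T) : {set T} := [set j : T | `|val i - val j| <= r%:Z].

Lemma lattice_nbh_self r i : i \in lattice_nbh r i.
Proof. by rewrite inE subrr normr0. Qed.

Lemma norm_coord_le (x : 'rV[int]_d) k : `|x 0 k| <= `|x|.
Proof.
rewrite [leRHS]/Num.norm/= mx_normrE.
exact: (@le_bigmax _ _ _ 0 (fun ij => `|x ij.1 ij.2|) (0, k)).
Qed.

(** A point of the ball is determined by its coordinate offsets from the centre, each shifted by [r]
    into the range from 0 to [2 r]. *)
Lemma card_lattice_nbh r i : (#|lattice_nbh r i| <= (2 * r).+1 ^ d)%N.
Proof.
pose f (j : T) : {ffun 'I_d -> 'I_(2 * r).+1} :=
  [ffun k => inord (absz (val j 0 k - val i 0 k + r%:Z))].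
have coord j k : j \in lattice_nbh r i -> 0 <= val j 0 k - val i 0 k + r%:Z <= (2 * r)%:Z.
  rewrite inE => /(le_trans (norm_coord_le _ k)); rewrite !mxE distrC ler_norml.
  by rewrite PoszM => /andP[h1 h2]; apply/andP; split; lra.
have finj : {in lattice_nbh r i &, injective f}.
  move=> j j' jn jn' /ffunP fE; apply: val_inj; apply/rowP => k.
  have := fE k; rewrite !ffunE => /(congr1 val) /=.
  have /andP[h1 h2] := coord j k jn; have /andP[h3 h4] := coord j' k jn'.
  rewrite !inordK ?ltnS; last 2 first.
  - by rewrite -lez_nat gez0_abs.
  - by rewrite -lez_nat gez0_abs.
  by move/(congr1 Posz); rewrite !gez0_abs// => /addIr/addIr.
rewrite -(card_in_imset finj) (leq_trans (max_card _))//.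
by rewrite card_ffun !card_ord.
Qed.

(** Distances are integers, so leaving the ball of radius [r] means distance at least [r + 1], the
    lag at which the mixing coefficient will be zero. *)
Lemma le_set_dist (R : realType) (U1 U2 : {set T}) r :
  (forall i j, i \in U1 -> j \in U2 -> j \notin lattice_nbh r i) ->
  (r.+1%:R%:E <= @set_dist R d T U1 U2)%E.
Proof.
move=> U12; rewrite /set_dist.
elim/big_ind: _ => [|x y hx hy|i iU]; [by rewrite leey|by rewrite le_min hx|].
elim/big_ind: _ => [|x y hx hy|j jU]; [by rewrite leey|by rewrite le_min hx|].
rewrite lee_fin -[r.+1%:R]/(r.+1%:~R) ler_int.
by have := U12 i j iU jU; rewrite inE -ltNge.
Qed.

End lattice.

Section mixing_local_dep.
Context {dd : measure_display} {Omega : measurableType dd} {R : realType}.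
Variables (P : probability Omega R) (d : nat) (T : {fset 'rV[int]_d}) (X : T -> {RV P >-> R}).

(** The at most [p + 1] sites of a product form the small set of the mixing coefficient, and the
    sites outside their neighbourhoods form the unrestricted one. A zero coefficient is exact
    independence of the two sigma-fields. *)
Lemma mixing_local_dep (p r : nat) (K c : R) : 1 <= K -> 0 <= c ->
  (forall i, integ P (fun w => `|X i w| ^+ p.+2)) ->
  (forall i k, (k <= p.+2)%N -> Ex P (fun w => `|X i w| ^+ k) <= K) ->
  alpha_coef X p.+1 r.+1 = 0%E ->
  local_dep P (fun i w => c * X i w) (lattice_nbh r) p ((2 * r).+1 ^ d) K c.
Proof.
move=> K1 c0 Xi XK a0.
have mX i : measurable_fun setT (X i) by [].
have Xk i k : (k <= p.+2)%N -> integ P (fun w => `|X i w| ^+ k).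
  move=> kp; apply: (integ_le _ _ (integD (integ_cst P 1) (Xi i))).
    by apply: measurable_funX; exact: measurableT_comp.
  move=> w; rewrite ger0_norm ?exprn_ge0//.
  have [x1|x1] := leP `|X i w| 1.
    by rewrite (@le_trans _ _ 1)// ?exprn_ile1// lerDl exprn_ge0.
  by rewrite (le_trans (ler_weXn2l (ltW x1) kp))// lerDr.
have cE i k w : `|c * X i w| ^+ k = c ^+ k * `|X i w| ^+ k by rewrite normrM (ger0_norm c0) exprMn.
split => //.
- by move=> i; exact: measurable_funM.
- by move=> i k kp; under eq_fun do rewrite cE; exact/integZ/Xk.
- move=> i k kp; under eq_fun do rewrite cE.
  rewrite ExZ; last exact: Xk.
  by rewrite mulrC ler_wpM2r ?exprn_ge0// XK.
- exact: lattice_nbh_self.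
- exact: card_lattice_nbh.
move=> s g sp gc i1 i2.
pose U1 := [set i in s]; pose U2 := ~: Nbh (lattice_nbh r) s.
have sU : {subset s <= U1} by move=> i; rewrite inE.
have cU1 : (#|U1| <= p.+1)%N.
  by rewrite (leq_trans _ sp)// cardsE card_size.
have dU : (r.+1%:R%:E <= @set_dist R d T U1 U2)%E.
  apply: le_set_dist => i j; rewrite !inE => js jN.
  apply: contra jN => ij; rewrite /Nbh.
  elim: (s) js => // k s' IH; rewrite in_cons big_cons inE => /orP[/eqP <-|/IH ->].
    by rewrite inE ij.
  by rewrite orbT.
apply: indep_expectation => // A B mA mB.
apply: (alpha_coef0_indep a0 cU1 dU).
- by rewrite -[_ @^-1` _]setTI; exact: (integ_measurable i1).
- by rewrite -[_ @^-1` _]setTI; exact: (integ_measurable i2).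
- by apply: sigma_field_fun => //; exact: sigma_field_Prod.
- apply: sigma_field_fun => //; apply: measurableT_comp; last exact: sigma_field_SumY.
  exact: continuous_measurable.
Qed.

End mixing_local_dep.

(** * From the transport map to the Wasserstein distance *)

Section wasserstein_bounds.
Variable R : realType.
Local Notation gam := (@std_normal R).

Lemma wasserstein_le_transport (p : nat) (mu : probability R R) (a : R -> R) (D : R) : (0 < p)%N ->
  measurable_fun setT a -> (forall A, measurable A -> gam (a @^-1` A) = mu A) ->
  integ gam (fun z => `|a z - z| ^+ p) -> Ex gam (fun z => `|a z - z| ^+ p) <= D ->
  (wasserstein p mu gam <= (D `^ p%:R^-1)%:E)%E.
Proof.
move=> p0 ma aE ai aD.
have mg : measurable_fun setT (fun z : R => (a z, z)).
  by apply: measurable_fun_pair => //; exact: measurable_id.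
pose gm : {mfun R >-> (R * R)%type} := mfun_Sub (mem_set mg : (fun z => (a z, z)) \in mfun).
pose g := distribution gam gm.
have gE A : measurable A -> gam ((fun z => (a z, z)) @^-1` A) = g A by [].
apply: ge_ereal_inf; exists ('N[g]_(p%:R%:E)[(fun xy => (xy.1 - xy.2)%:E)])%E.
  exists g => // A mA; split.
    rewrite -(aE _ mA); transitivity (gam ((fun z => (a z, z)) @^-1` (A `*` setT))) => //.
    by congr (gam _); apply/seteqP; split => z //= [].
  transitivity (gam ((fun z => (a z, z)) @^-1` (setT `*` A))) => //.
  by congr (gam _); apply/seteqP; split => z //= [].
have ai0 : 0 <= Ex gam (fun z => `|a z - z| ^+ p) by apply: Ex_ge0 => z; rewrite exprn_ge0.
rewrite unlock.
have -> : (\int[g]_x `|(x.1 - x.2)%:E| `^ p%:R = (Ex gam (fun z => `|a z - z| ^+ p))%:E)%E.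
  pose F (x : R * R) : \bar R := (`|x.1 - x.2| ^+ p)%:E.
  have mF : measurable_fun setT F.
    apply/measurable_EFinP/measurable_funX/measurableT_comp => //.
    by apply: measurable_funB; [exact: measurable_fst|exact: measurable_snd].
  have F0 x : (0 <= F x)%E by rewrite lee_fin exprn_ge0.
  transitivity (\int[g]_x F x)%E.
    by apply: eq_integral => x _; rewrite /F abse_EFin poweR_EFin powR_mulrn.
  rewrite -(ge0_integral_image mg gE mF F0) /Ex /Rintegral fineK//.
  exact: (integrable_fin_num _ ai).
rewrite poweR_EFin lee_fin.
by apply: ge0_ler_powR => //; rewrite ?nnegrE ?invr_ge0// (le_trans ai0).
Qed.

(** [C] is fixed before the space and the field, which gives uniformity in [n]. The assumption
    [1 <= c |T|] makes the variance at least 1, hence [lam <= 1]. *)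
Lemma wasserstein_mixing (p d r : nat) (K c : R) : (0 < p)%N -> 1 <= K -> 0 < c ->
  exists C : R, forall (dd : measure_display) (Omega : measurableType dd) (P : probability Omega R)
    (T : {fset 'rV[int]_d}) (X : T -> {RV P >-> R}),
  (forall i, integ P (fun w => `|X i w| ^+ p.+2)) ->
  (forall i k, (k <= p.+2)%N -> Ex P (fun w => `|X i w| ^+ k) <= K) ->
  (forall i, Ex P (X i) = 0) ->
  alpha_coef X p.+1 r.+1 = 0%E ->
  1 <= c * #|` T|%fset%:R -> ((c * #|` T|%fset%:R)%:E <= 'V_P[field_sum X])%E ->
  (wasserstein p (distribution P (normalized_sum X)) gam
    <= (C * #|` T|%fset%:R `^ (- 2^-1))%:E)%E.
Proof.
move=> p0 K1 c0.
have cV0 : 0 <= c^-1 by rewrite invr_ge0 ltW.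
pose B := ((2 * r).+1 ^ d)%N.
have [C0 C00 HC0] := stein_approx_local_dep p B K cV0.
(* From the crude moment bound [(1 + K) |T|^(p+3) lam^(p+2)] and [|T| <= c^-1 lam^-2]; this produces
   the growth [lam^-(p+4)] allowed in [stein_coupling]. *)
pose C1 := (1 + K) * c^-1 ^+ p.+3.
have C10 : 0 <= C1 by rewrite mulr_ge0 ?exprn_ge0// addr_ge0// (le_trans _ K1).
have [C2 C20 HC2] := stein_coupling p0 C00 C10.
exists (C2 `^ p%:R^-1 * (Num.sqrt c)^-1) => dd Omega P T X Xi XK X0 a0 cT cV.
pose S w := \sum_i X i w.
have SE : (field_sum X : Omega -> R) = S by apply/funext => w; rewrite /field_sum mfun_sum.
have Xk i k : (k <= p.+2)%N -> integ P (fun w => `|X i w| ^+ k).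
  move=> kp; have := ld_int (mixing_local_dep K1 ler01 Xi XK a0) i kp.
  by congr integ; apply/funext => w; rewrite mul1r.
have integ_X i : integ P (X i).
  by have := Xk i 1%N isT; apply: integ_le => // w; rewrite expr1.
have Si : integ P S by apply: integ_sum => i; exact: integ_X.
have S2i : integ P (fun w => S w ^+ 2).
  (* Scale 1 serves only for integrability; the scale [lam] enters once the variance is known. *)
  have H1 := mixing_local_dep K1 ler01 Xi XK a0.
  have := integ_moment H1 (s := [::]) (k := 2) (finset.setTfor T) isT.
  congr integ; apply/funext => w; rewrite /Prod big_nil normr1 mul1r real_normK ?num_real//.
  rewrite /SumY /S; congr (_ ^+ _); rewrite (eq_bigl predT) => [|i]; last by rewrite inE.
  by apply: eq_bigr => i _; rewrite mul1r.
have ES : Ex P S = 0 by rewrite /S Ex_sum ?big1// => i; exact: integ_X.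
pose v := Ex P (fun w => S w ^+ 2).
have VE : 'V_P[field_sum X]%E = v%:E.
  rewrite /variance unlock SE unlock.
  rewrite (_ : fine (\int[P]_w (S w)%:E)%E = 0); last exact: ES.
  rewrite /v /Ex /Rintegral fineK; last exact: (integrable_fin_num _ S2i).
  apply: eq_integral => w _; rewrite -[((_ \- _) * _) w]/((S w - 0) * (S w - 0)).
  by rewrite subr0 expr2.
rewrite VE lee_fin in cV.
have v1 : 1 <= v by exact: le_trans cV.
have v0 : 0 < v by exact: lt_le_trans v1.
pose lam := (field_sd X)^-1.
have sdE : field_sd X = Num.sqrt v by rewrite /field_sd VE.
have lam0 : 0 < lam by rewrite /lam sdE invr_gt0 sqrtr_gt0.
have lam2 : lam ^+ 2 = v^-1 by rewrite /lam sdE exprVn sqr_sqrtr// ltW.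
have lam1 : lam <= 1.
  by rewrite /lam sdE invf_le1 ?sqrtr_gt0// -[leLHS]sqrtr1 ler_wsqrtr.
have NE : #|` T|%fset = #|{: T}| by rewrite cardfE.
rewrite NE in cT cV *.
set N : R := #|{: T}|%:R in cT cV *.
have N0 : 0 < N by rewrite -(pmulr_rgt0 _ c0) (lt_le_trans _ cT).
have N1 : 1 <= N by move: N0; rewrite /N ltr0n ler1n.
have NA : N * lam ^+ 2 <= c^-1.
  by rewrite lam2 ler_pdivrMr// ler_pdivlMl.
pose Y i w := lam * X i w.
have H : local_dep P Y (lattice_nbh r) p B K lam.
  exact: (mixing_local_dep K1 (ltW lam0) Xi XK a0).
set W := SumY Y (finset.setTfor T).
have WE : W = fun w => lam * S w.
  apply/funext => w; rewrite /W /SumY /S mulr_sumr.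
  by apply: eq_bigl => i; rewrite inE.
have nWE : (normalized_sum X : Omega -> R) = W.
  apply/funext => w; rewrite WE /normalized_sum /= SE mulrC//.
have EW : Ex P W = 0 by rewrite WE ExZ// ES mulr0.
have EW2 : Ex P (fun w => W w ^+ 2) = 1.
  rewrite WE; under [X in Ex _ X]eq_fun do rewrite exprMn.
  by rewrite ExZ// lam2 mulVf ?gt_eqF.
have HS : stein_approx P W p C0 lam by exact: (HC0 _ _ _ _ _ _ _ H).
have Wp : integ P (fun w => `|W w| ^+ (p + 2)).
  have := integ_moment H (s := [::]) (k := p.+2) (finset.setTfor T) (leqnn _).
  by rewrite addn2; congr integ; apply/funext => w; rewrite /Prod big_nil normr1 mul1r.
have EWp : Ex P (fun w => `|W w| ^+ (p + 2)) <= C1 * lam^-1 ^+ (p + 4).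
  have := moment_le H (s := [::]) (k := p.+2) (N := finset.setTfor T) (b := N) (leqnn _).
  have nil_sub : {subset [::] <= finset.setTfor T} by [].
  rewrite cardsT => /(_ nil_sub (lexx _) N1) => h.
  apply: le_trans (_ : (1 + N ^+ p.+3 * K) * lam ^+ p.+2 <= _).
    apply: le_trans _ h; rewrite addn2 le_eqVlt; apply/orP; left; apply/eqP; congr Ex.
    by apply/funext => w; rewrite /Prod big_nil normr1 mul1r.
  apply: (@le_trans _ _ ((1 + K) * N ^+ p.+3 * lam ^+ p.+2)).
    rewrite ler_wpM2r ?exprn_ge0 ?(ltW lam0)// mulrDl mul1r [K * _]mulrC lerD2r.
    by rewrite exprn_ege1.
  have -> : lam ^+ p.+2 = lam ^+ 2 ^+ p.+3 * lam^-1 ^+ (p + 4).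
    rewrite -exprM exprVn (_ : (2 * p.+3 = p.+2 + (p + 4))%N); last by ring.
    by rewrite exprD mulfK// expf_neq0// gt_eqF.
  rewrite /C1 mulrA -[(1 + K) * _ * _]mulrA -exprMn.
  have l0 : 0 <= lam^-1 ^+ (p + 4) by rewrite exprn_ge0// invr_ge0 ltW.
  have NA0 : 0 <= N * lam ^+ 2 by rewrite mulr_ge0 ?exprn_ge0// ltW.
  apply: ler_wpM2r => //; apply: ler_wpM2l; first by rewrite addr_ge0// (le_trans _ K1).
  by rewrite lerXn2r// nnegrE.
have [a [ma aP ai aB]] := HC2 _ _ _ _ _ HS lam0 Wp EWp.
have aP' A : measurable A -> gam (a @^-1` A) = distribution P (normalized_sum X) A.
  by move=> mA; rewrite aP// /distribution/= /pushforward nWE.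
apply: le_trans (wasserstein_le_transport p0 ma aP' ai aB) _.
rewrite lee_fin powRM ?exprn_ge0 ?(ltW lam0)// -(powR_mulrn _ (ltW lam0)) -powRrM.
rewrite divff ?pnatr_eq0 -?lt0n// powRr1 ?(ltW lam0)// -mulrA ler_wpM2l ?powR_ge0//.
rewrite powRN powR12_sqrt ?(ltW N0)// -invfM -sqrtrM ?(ltW c0)//.
rewrite /lam sdE lef_pV2 ?posrE ?sqrtr_gt0 ?mulr_gt0//.
exact: ler_wsqrtr.
Qed.

End wasserstein_bounds.

(** * Variance and moment bounds from the asymptotic hypotheses *)

Section moments.
Variable R : realType.

(** The lower limit is the supremum of the tail infima, so one of these is positive; [c] is its
    value, or 1 if it is infinite. *)
Lemma limn_einf_gt0 (u : (\bar R)^nat) : (0 < limn_einf u)%E ->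
  exists2 c : R, 0 < c & \forall n \near \oo, (c%:E <= u n)%E.
Proof.
rewrite limn_einf_lim (cvg_lim _ (cvg_einfs_sup (u := u)))// => /ereal_sup_gt[_ [n _ <-] un].
have [c c0 cu] : exists2 c : R, 0 < c & (c%:E <= einfs u n)%E.
  case: (einfs u n) un => [x| |//]; first by exists x.
  by exists 1 => //; rewrite leey.
exists c => //; near=> k; apply: (le_trans cu).
apply: ereal_inf_lbound; exists k => //=; near: k; exact: nbhs_infty_ge.
Unshelve. all: by end_near. Qed.

Lemma Lnorm_moment d (Om : measurableType d) (P : probability Om R) (X : Om -> R) (r : nat) (K : R) :
  (0 < r)%N -> measurable_fun setT X -> ('N[P]_(r%:R%:E)[EFin \o X] <= K%:E)%E ->
  integ P (fun w => `|X w| ^+ r) /\ Ex P (fun w => `|X w| ^+ r) <= K ^+ r.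
Proof.
move=> r0 mX NK; have r0' : (r%:R : R) != 0 by rewrite pnatr_eq0 -lt0n.
have N0 := Lnorm_ge0 P r%:R%:E (EFin \o X).
have K0 : 0 <= K by rewrite -lee_fin (le_trans N0).
have IE : (\int[P]_w (`|X w| ^+ r)%:E <= (K ^+ r)%:E)%E.
  have -> : (\int[P]_w (`|X w| ^+ r)%:E = 'N[P]_(r%:R%:E)[EFin \o X] `^ r%:R)%E.
    rewrite poweR_Lnorm//; apply: eq_integral => w _.
    by rewrite /= powR_mulrn.
  rewrite -(powR_mulrn _ K0) -poweR_EFin; apply: gt0_ler_poweR => //.
    by rewrite in_itv/= N0 leey.
  by rewrite in_itv/= lee_fin K0 leey.
have I0 : (0 <= \int[P]_w (`|X w| ^+ r)%:E)%E by apply: integral_ge0 => w _; rewrite lee_fin exprn_ge0.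
split; last by rewrite /Ex /Rintegral -lee_fin fineK// ge0_fin_numE// (le_lt_trans IE) ?ltry.
apply/integrableP; split.
  by apply/measurable_EFinP/measurable_funX; exact: measurableT_comp.
under eq_integral do rewrite /= ger0_norm ?exprn_ge0//.
by rewrite (le_lt_trans IE) ?ltry.
Qed.

End moments.

Theorem corollary2p8 (R : realType) (d : nat) (hd : (0 < d)%N)
    (p : nat) (hp : (0 < p)%N)
    (T : nat -> {fset 'rV[int]_d})
    (T_neq0 : forall n, T n != fset0)
    (T_incr : forall n, (T n `<=` T n.+1)%fset)
    (T_infty : #|` T n|%fset @[n --> \oo] --> \oo)
    (disp : nat -> measure_display)
    (Omega : forall n, measurableType (disp n))
    (P : forall n, probability (Omega n) R)
    (X : forall n, T n -> {RV (P n) >-> R})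
    (X_sqint : forall n (i : T n), (X n i : Omega n -> R) \in Lfun (P n) 2%:E)
    (X_mean0 : forall n (i : T n), ('E_(P n)[X n i] = 0)%E)
    (X_var : (0 < limn_einf (fun n =>
       'V_(P n)[field_sum (X n)] * (#|` T n|%fset%:R^-1)%:E))%E)
    (X_norm : (ereal_sup [set x | exists n (i : T n),
       x = ('N[P n]_((p + 2)%:R%:E)[EFin \o X n i])%E] < +oo)%E)
    (Rdep : nat) (hRdep : (1 <= Rdep)%N)
    (X_mix : forall l n, (Rdep < l)%N -> alpha_coef (X n) p.+1 l = 0%E) :
  exists C : R, \forall n \near \oo,
    (wasserstein p (distribution (P n) (normalized_sum (X n)))
                   (@std_normal R)
     <= (C * #|` T n|%fset%:R `^ (- 2^-1))%:E)%E.
Proof.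
have [c c0 Hc] := limn_einf_gt0 X_var.
set sup := ereal_sup _ in X_norm.
have NK n i : ('N[P n]_((p + 2)%:R%:E)[EFin \o X n i] <= sup)%E.
  by apply: ereal_sup_ubound; exists n, i.
(* A site of the nonempty set [T 0] provides one norm, so the supremum is nonnegative and, being
   below plus infinity, finite. *)
have sup0 : (0 <= sup)%E.
  have /fset0Pn[i iT] := T_neq0 0%N.
  exact: le_trans (Lnorm_ge0 _ _ _) (NK 0%N [` iT]%fset).
have supE : sup = (fine sup)%:E by rewrite fineK// ge0_fin_numE.
set K0 := fine sup in supE.
have mX n (i : T n) : measurable_fun setT (X n i) by [].
have mom n (i : T n) : integ (P n) (fun w => `|X n i w| ^+ p.+2) /\
    Ex (P n) (fun w => `|X n i w| ^+ p.+2) <= K0 ^+ p.+2.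
  have := NK n i; rewrite supE addn2; exact: Lnorm_moment.
have Tc : \forall n \near \oo, 1 <= c * #|` T n|%fset%:R.
  have : \forall n \near \oo, ((Num.truncn c^-1).+1 <= #|` T n|%fset)%N.
    exact: T_infty _ (nbhs_infty_ge (Num.truncn c^-1).+1).
  apply: filterS => n Tn.
  rewrite mulrC -ler_pdivrMr// div1r ltW// (lt_le_trans (Num.Theory.truncnS_gt _))//.
  by rewrite ler_nat.
have K00 : 0 <= K0 by rewrite fine_ge0.
have K1 : 1 <= 1 + K0 ^+ p.+2 by rewrite lerDl exprn_ge0.
(* All moments of order at most [p + 2] are bounded by [1 + K0^(p+2)], because
   [|x|^k <= 1 + |x|^(p+2)]. *)
have [C HC] := @wasserstein_mixing R p d Rdep (1 + K0 ^+ p.+2) c hp K1 c0.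
exists C; near=> n; apply: HC.
- by move=> i; exact: (mom n i).1.
- move=> i k kp; have [i1 i2] := mom n i.
  have ii : integ (P n) (fun w => 1 + `|X n i w| ^+ p.+2) by exact: integD (integ_cst _ _) i1.
  apply: (@le_trans _ _ (Ex (P n) (fun w => 1 + `|X n i w| ^+ p.+2))); last first.
    by rewrite ExD ?Ex_cst ?lerD2l//; exact: integ_cst.
  apply: le_trans (ler_norm _) (Ex_norm_le _ ii _).
    by apply: measurable_funX; exact: measurableT_comp.
  move=> w; rewrite ger0_norm ?exprn_ge0//.
  have [x1|x1] := leP `|X n i w| 1.
    by rewrite (@le_trans _ _ 1)// ?exprn_ile1// lerDl exprn_ge0.
  by rewrite (le_trans (ler_weXn2l (ltW x1) kp))// lerDr.
- by move=> i; rewrite /Ex /Rintegral; have := X_mean0 n i; rewrite unlock => ->.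
- exact: X_mix.
- by near: n.
- have cu : (c%:E <= 'V_(P n)[field_sum (X n)] * (#|` T n|%fset%:R^-1)%:E)%E by near: n.
  have N0 : 0 < (#|` T n|%fset%:R : R) by rewrite ltr0n cardfs_gt0 T_neq0.
  by rewrite EFinM -lee_pdivlMr// muleC.
Unshelve. all: by end_near. Qed.
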